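(* Let $2\le d\le 8$, $\alpha\ge\frac d4+\frac12$, $\nu>0$, and $\theta:=1-\frac{d}{4\alpha}$. There is a constant $C_{\alpha,\nu}>0$, depending only on $\alpha$, $\nu$ (and $d$), such that the following holds. Let $\mu>0$, $h>0$, let $I_h$ be a linear interpolant satisfying $\|I_h(\mathbf g)-\mathbf g\|_{V^s}^2\le c_{0,\alpha}h^2\|\mathbf g\|_{V^{s+\alpha}}^2$ for every $s\ge0$ and every $\mathbf g\in V^{s+\alpha}$, and let $\mathbf f\in V^\alpha$ be time-independent. Let $t_0\ge0$ and $\mathbf u_0,\mathbf v_0\in V^{2\alpha}$. Let $\mathbf u$ be a classical solution on $[0,\infty)$ of $$\mathbf u_t+B(\mathbf u,\mathbf u)+\nu A^\alpha\mathbf u=\mathbf f,\qquad \mathbf u(0)=\mathbf u_0,$$ and let $\mathbf v$ be a classical solution, defined on $[t_0,\infty)$, of $$\mathbf v_t+B(\mathbf v,\mathbf v)+\nu A^\alpha\mathbf v=\mathbf f+\mu P_\sigma I_h(\mathbf u-\mathbf v),\qquad \mathbf v(t_0)=\mathbf v_0.$$ Let $\sigma_1,\sigma_\alpha,\sigma_{\alpha+1}>0$ be such that, for all $t\ge t_0$, $\|\mathbf u(t)\|_{V^s}\le\sigma_s$ and $\|\mathbf v(t)\|_{V^s}\le\sigma_s$ for $s\in\{1,\alpha\}$, and $\|\mathbf u(t)\|_{V^{\alpha+1}}\le\sigma_{\alpha+1}$. Suppose that $$\mu\ge C_{\alpha,\nu}\left(4\sigma_\alpha^{2/\theta}+\sigma_1^{1/\theta}+2\sigma_1^{2/\theta}+\sigma_{\alpha+1}\right)\qquad\text{and}\qquad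 \mu h^2c_{0,\alpha}\le\nu.$$ Then $\|\mathbf u(t)-\mathbf v(t)\|_{V^\alpha}$ decays to $0$ exponentially fast in time, i.e. there are constants $M,\lambda>0$ with $\|\mathbf u(t)-\mathbf v(t)\|_{V^\alpha}\le Me^{-\lambda(t-t_0)}$ for all $t\ge t_0$.
   Context: The domain is the torus $\Omega=\mathbb T^d=\mathbb R^d/\mathbb Z^d=[0,1]^d$. Let $\mathcal V$ be the set of $d$-dimensional vector-valued trigonometric polynomials $\varphi$ on $\Omega$ with $\nabla\cdot\varphi=0$ and $\int_\Omega\varphi\,d\mathbf x=0$. $H$ is the closure of $\mathcal V$ in $L^2(\Omega)^d$, with the $L^2$ norm. $P_\sigma$ is the Leray–Helmholtz projector (orthogonal projection of $L^2(\Omega)^d$ onto $H$). The fractional Laplacian is the Fourier multiplier $(-\Delta)^s\mathbf g(\mathbf x)=\sum_{\mathbf k\in\mathbb Z^d}(2\pi|\mathbf k|)^{2s}\widehat{\mathbf g}_{\mathbf k}e^{2\pi i\mathbf k\cdot\mathbf x}$, and $A^s:=P_\sigma(-\Delta)^s$. For $s\ge0$, $V^s$ is the closure of $\mathcal V$ in the norm $\|\mathbf g\|_{V^s}=\|(-\Delta)^{s/2}\mathbf g\|_{L^2}$ (which equals $\|A^{s/2}\mathbf g\|_{L^2}$ on $\mathcal V$); $V^0=H$. $B(\mathbf a,\mathbf b):=P_\sigma((\mathbf a\cdot\nabla)\mathbf b)$, extended by continuity from $\mathcal V$. $I_h$ is a linear operator on $V^\alpha$ with values in $L^2(\Omega)^d$,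 with associated length scale $h>0$; $c_{0,\alpha}>0$ is a constant, and in the bound on $I_h$ the norm on the left is $\|(-\Delta)^{s/2}(I_h(\mathbf g)-\mathbf g)\|_{L^2}$. A classical solution $\mathbf u$ on $[0,\infty)$ belongs to $C([0,T];V^{2\alpha})\cap L^2(0,T;V^{3\alpha})$ for every $T>0$; a classical solution $\mathbf v$ on $[t_0,\infty)$ belongs to $L^\infty(t_0,T;V^{2\alpha})\cap L^2(t_0,T;V^{3\alpha})$ for every $T>t_0$, is weakly continuous in time with values in $H$, and satisfies its equation and initial condition. *)

(* Defs.v *)
From HB Require Import structures.
From mathcomp Require Import all_boot all_order all_algebra.
From mathcomp Require Import complex.
From mathcomp Require Import all_classical all_reals all_analysis.

Set Implicit Arguments.
Unset Strict Implicit.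
Unset Printing Implicit Defensive.

Import Order.TTheory GRing.Theory Num.Theory.
Import numFieldNormedType.Exports.

Local Open Scope classical_set_scope.
Local Open Scope ring_scope.

Section TorusMeasure.
Context {R : realType}.

(* The library puts Lebesgue measure on measurableTypeR R, a copy of R. *)
Definition consT n (x : measurableTypeR R * n.-tuple R) : n.+1.-tuple R :=
  [the n.+1.-tuple R of (x.1 : R) :: x.2].

Lemma measurable_consT n :
  measurable_fun [set: measurableTypeR R * n.-tuple R] (@consT n).
Proof.
exact: (measurable_cons (T2 := R) (f := fst) measurable_fst measurable_snd).
Qed.

HB.instance Definition _ n :=
  isMeasurableFun.Build _ _ _ _ (@consT n) (@measurable_consT n).

(* Lebesgue measure on [0, 1]^n, as the n-fold product of the uniform
   probability measure on [0, 1]; the points of R^n outside [0, 1]^n form a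
   null set. *)
Fixpoint torus_measure (n : nat) : probability (n.-tuple R) R :=
  match n with
  | 0 => dirac ([tuple] : 0.-tuple R)
  | n'.+1 =>
      distribution (uniform_prob (@ltr01 R) \x torus_measure n')%E (@consT n')
  end.

End TorusMeasure.

Section VectorFields.
Context {R : realType} {d : nat}.

Local Notation T := (d.-tuple R).
Local Notation mu := (@torus_measure R d).
Local Notation leb := (@lebesgue_measure R).

(* Real vector fields on the torus, given component by component; only the
   values on [0, 1]^d matter, and two fields are identified when equal a.e. *)
Definition vfield := 'I_d -> T -> R.

HB.instance Definition _ := GRing.Lmodule.copy vfield ('I_d -> T -> R).

Implicit Types (g w p phi psi : vfield) (k : 'I_d -> int) (s : R).

Definition eq_field g w := forall i, {ae mu, forall x, g i x = w i x}.

Definition L2 : set vfield := [set g | forall i, g i \in Lfun mu 2%:E].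

Definition inner g w : R := \sum_(i < d) \int[mu]_x (g i x * w i x).

Definition L2norm g : R := Num.sqrt (inner g g).

Definition dotk k (x : T) : R := \sum_(i < d) (k i)%:~R * tnth x i.

Definition normk k : R := Num.sqrt (\sum_(i < d) (k i)%:~R ^+ 2).

(* e^{2 pi i k.x} *)
Definition fexp k (x : T) : R[i] :=
  Complex (cos (2 * pi * dotk k x)) (sin (2 * pi * dotk k x)).

(* \int f(x) e^{- 2 pi i k.x} dx *)
Definition fcoef (f : T -> R) k : R[i] :=
  Complex (\int[mu]_x (f x * cos (2 * pi * dotk k x)))
          (- \int[mu]_x (f x * sin (2 * pi * dotk k x))).

(* The frequencies k with |k_i| <= N for all i are the shift m - N, for m
   ranging over {0, ..., 2N}^d. *)
Definition freq (N : nat) (m : {ffun 'I_d -> 'I_(N.*2.+1)}) : 'I_d -> int :=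
  fun i => (m i)%:Z - N%:Z.

Definition trig_poly phi := exists (N : nat) (c : ('I_d -> int) -> 'I_d -> R[i]),
  forall i x, Complex (phi i x) 0 =
    \sum_(m : {ffun 'I_d -> 'I_(N.*2.+1)}) c (freq m) i * fexp (freq m) x.

Definition replace_coord (x : T) (j : 'I_d) (y : R) : T :=
  [tuple if i == j then y else tnth x i | i < d].

Definition partial (j : 'I_d) (f : T -> R) (x : T) : R :=
  derive1 (fun y : R => f (replace_coord x j y)) (tnth x j).

Definition divergence phi (x : T) : R := \sum_(j < d) partial j (phi j) x.

(* (phi . nabla) psi *)
Definition advect phi psi : vfield :=
  fun i x => \sum_(j < d) phi j x * partial j (psi i) x.

Definition Vtrig : set vfield := [set phi | [/\ trig_poly phi,
  forall x, divergence phi x = 0 &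
  forall i, \int[mu]_x phi i x = 0]].

Definition H : set vfield := [set g | L2 g /\
  forall e : R, 0 < e -> exists2 phi, Vtrig phi & L2norm (g - phi) < e].

(* Partial sums of sum_k (2 pi |k|)^{2s} g_k e^{2 pi i k.x}. They are real
   because g is real and the set of frequencies is symmetric, so that taking
   the real part only changes the type. For k = 0 the multiplier is 1 if
   s = 0 and 0 otherwise. *)
Definition fraclap_sum s g (N : nat) : vfield := fun i x =>
  complex.Re (\sum_(m : {ffun 'I_d -> 'I_(N.*2.+1)})
    Complex ((2 * pi * normk (freq m)) `^ (2 * s)) 0 *
    fcoef (g i) (freq m) * fexp (freq m) x).

(* w = (-Delta)^s g, the series being summed in L^2 *)
Definition is_fraclap s g w := [/\ L2 g, L2 w &
  (fun N => L2norm (w - fraclap_sum s g N)) @ \oo --> (0 : R)].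

(* || (-Delta)^{s/2} g ||_{L^2}, equal to +oo when the series defining
   (-Delta)^{s/2} g does not converge in L^2. *)
Definition Vnorm s g : \bar R :=
  ereal_inf [set (L2norm w)%:E | w in [set w | is_fraclap (s / 2) g w]].

Arguments Vnorm s%_R g%_R.

(* The V^s norm controls the L^2 norm on Vtrig, so the abstract closure of
   Vtrig is realised inside H. Restricting to H is needed as Vnorm s does not
   see constants when s > 0. *)
Definition V s : set vfield := [set g | H g /\
  forall e : R, 0 < e ->
    exists2 phi, Vtrig phi & (Vnorm s (g - phi) < e%:E)%E].

(* The operators P_sigma, A^s and B are given as relations between an argument
   and any representative (up to a.e. equality) of the value. *)

Definition is_leray g p :=
  [/\ L2 g, H p & forall phi, H phi -> inner (g - p) phi = 0].

Definition is_A s g a := exists2 w, is_fraclap s g w & is_leray w a.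

(* Extension by continuity of (phi, psi) |-> P_sigma ((phi . nabla) psi) from
   Vtrig x Vtrig to V^s x V^s, with values in H. *)
Definition is_B s g g' b := [/\ V s g, V s g', H b &
  forall e : R, 0 < e -> exists2 r : R, 0 < r & forall phi psi,
    Vtrig phi -> Vtrig psi ->
    (Vnorm s (g - phi) < r%:E)%E -> (Vnorm s (g' - psi) < r%:E)%E ->
    exists2 p, is_leray (advect phi psi) p & L2norm (p - b) < e].

(* I is a linear operator from V^alpha to (L^2)^d (on classes of fields) *)
Definition linear_on_V (alpha : R) (I : vfield -> vfield) :=
  [/\ forall g, V alpha g -> L2 (I g),
      forall g g', V alpha g -> V alpha g' ->
        eq_field g g' -> eq_field (I g) (I g') &
      forall (c : R) g g', V alpha g -> V alpha g' ->
        eq_field (I (c *: g + g')) (c *: I g + I g')].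

Definition interpolant (alpha c0 h : R) (I : vfield -> vfield) :=
  linear_on_V alpha I /\
  forall s g, 0 <= s -> V (s + alpha) g ->
    (Vnorm s (I g - g) ^+ 2 <= (c0 * h ^+ 2)%:E * Vnorm (s + alpha) g ^+ 2)%E.

Implicit Types (u v z : R -> vfield) (a b : R).

Definition simple_V s z := exists (m : nat) (A : 'I_m -> set R)
    (g : 'I_m -> vfield),
  [/\ forall j, measurable (A j), forall j, V s (g j) &
      forall t, z t = \sum_(j < m) (\1_(A j) t : R) *: g j].

(* Bochner measurability on ]a, b[ with values in V^s *)
Definition strongly_measurable s a b z := exists S : nat -> R -> vfield,
  (forall n, simple_V s (S n)) /\
  {ae leb, forall t, a < t < b ->
    V s (z t) /\ (fun n => Vnorm s (S n t - z t)) @ \oo --> (0 : \bar R)}.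

Definition L2_time s a b z := strongly_measurable s a b z /\
  (\int[leb]_(t in `]a, b[) (Vnorm s (z t) ^+ 2) < +oo)%E.

Definition Linfty_time s a b z := strongly_measurable s a b z /\
  exists M : R, {ae leb, forall t, a < t < b -> (Vnorm s (z t) <= M%:E)%E}.

Definition continuous_V s t0 z :=
  (forall t, t0 <= t -> V s (z t)) /\
  forall t, t0 <= t ->
    (fun r => Vnorm s (z r - z t)) @ within `[t0, +oo[%classic (nbhs t)
      --> (0 : \bar R).

Definition weakly_continuous_H t0 z :=
  (forall t, t0 <= t -> H (z t)) /\
  forall phi, H phi -> forall t, t0 <= t ->
    (fun r => inner (z r) phi) @ within `[t0, +oo[%classic (nbhs t)
      --> inner (z t) phi.

(* z' = z_t on [t0, +oo[: z(t) - z(t0) is the (weak) integral of z' in H *)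
Definition time_derivative t0 z z' :=
  {ae leb, forall t, t0 <= t -> H (z' t)} /\
  forall phi, H phi -> forall t, t0 <= t ->
    leb.-integrable `[t0, t] (fun r => (inner (z' r) phi)%:E) /\
    inner (z t) phi - inner (z t0) phi =
      \int[leb]_(r in `[t0, t]) inner (z' r) phi.

(* z_t + B(z, z) + nu A^alpha z = F on [t0, +oo[ and z(t0) = z0; the equation
   holds in H for almost every time *)
Definition solves (alpha nu t0 : R) (z0 : vfield) (F z : R -> vfield) :=
  eq_field (z t0) z0 /\
  exists2 z', time_derivative t0 z z' &
    {ae leb, forall t, t0 <= t -> exists Az Bz,
      [/\ is_A alpha (z t) Az, is_B (2 * alpha) (z t) (z t) Bz &
          eq_field (z' t + Bz + nu *: Az) (F t)]}.

Definition classical_solution_u (alpha nu : R) (f u0 : vfield) u :=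
  [/\ continuous_V (2 * alpha) 0 u,
      forall b, 0 < b -> L2_time (3 * alpha) 0 b u &
      solves alpha nu 0 u0 (fun=> f) u].

Definition classical_solution_v (alpha nu m : R) (I : vfield -> vfield)
    (f : vfield) u t0 (v0 : vfield) v :=
  [/\ weakly_continuous_H t0 v,
      forall b, t0 < b ->
        Linfty_time (2 * alpha) t0 b v /\ L2_time (3 * alpha) t0 b v &
      exists2 p : R -> vfield,
        {ae leb, forall t, t0 <= t -> is_leray (I (u t - v t)) (p t)} &
        solves alpha nu t0 v0 (fun t => f + m *: p t) v].

End VectorFields.

Arguments vfield : clear implicits.
Arguments Vnorm {R d} s%_R g%_R.

(* Main.v *)
(* Put w = u - v and pair the difference of the two equations with the Fourier
   truncation of (-Delta)^alpha w; in Fourier coefficients every pairing is a finite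
   sum.  The nonlinear difference B(w, u) + B(v, w) is bounded in L^2 by
   K sigma_alpha ||w||_{V^{alpha + d/4}}: in a product of trigonometric sums, split the
   pairs of frequencies according to which one is the larger; the smaller factor is
   then summed in sup norm by Cauchy-Schwarz, at the cost of a sum of |k|^(-2p) over
   nonzero k with p = 2 alpha - 1 + d/4 >= 3d/4.  Young's inequality, frequency by
   frequency, interpolates V^{alpha + d/4} between V^alpha and V^{2 alpha} with constant
   sigma_alpha^(2/theta), so the nonlinear term is absorbed by part of the dissipation
   and of the damping mu ||w||_{V^alpha}^2; the interpolation error is absorbed thanks
   to mu h^2 c0 <= nu.  Integrating in time and letting the truncation grow, the
   energy E = ||w||_{V^alpha}^2 satisfies E(b) - E(a) <= - (mu/2) \int_a^b E.  Hence E is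
   nonincreasing, (1 + (mu/2)(b - a)) E(b) <= E(a), and E decays geometrically over
   unit time steps. *)
From mathcomp Require Import all_boot all_order all_algebra.
From mathcomp Require Import complex zify ring lra.
From mathcomp Require Import all_classical all_reals all_analysis measurable_realfun.
Require Import Defs.
Set Implicit Arguments.
Unset Strict Implicit.
Unset Printing Implicit Defensive.
Import Order.TTheory GRing.Theory Num.Theory.
Import numFieldNormedType.Exports.
Local Open Scope classical_set_scope.
Local Open Scope ring_scope.

(** In time only the finite sums [Q] are differentiated. A Fourier coefficient of w is the primitive
    of an integrable function, obtained by testing the weak equation with a divergence-free field
    that isolates it; so the argument needs neither measurability in time of the norms nor a time
    derivative with values in V^alpha. The product rule for such primitives is [sqr_primitive].

    Truncation does not commute with B or with the interpolant. At level N the gains are therefore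
    truncated, with factors 2 nu and 2 mu, while the losses involve full norms, with factors (3/2)
    nu and (3/2) mu. They can be compared only in the limit, which is legitimate because the V^{3
    alpha} regularity keeps the time integral of ||w||_{V^{2 alpha}}^2 finite.

    The hypothesis alpha >= d/4 + 1/2 reads 2 alpha - 1 >= d/2, which is how p reaches 3d/4. Then
    |k|^(-2p) is dominated by a product over the coordinates of summable weights with exponent 3/2,
    so that no lattice points have to be counted. *)

Section CauchySchwarz.
Context {R : realType}.

(** The discriminant argument behind Cauchy-Schwarz, shared by finite sums and by L^2: the form is
    evaluated at a = sqrt B, b = sqrt A. If A or B vanishes that point gives nothing, and another
    one is taken. *)
Lemma le_of_quadratic_form (A B C : R) : 0 <= A -> 0 <= B ->
  (forall a b : R, 0 <= a ^+ 2 * A - a * b * C *+ 2 + b ^+ 2 * B) ->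
  C <= Num.sqrt A * Num.sqrt B.
Proof.
move=> A0 B0 h; have [As Bs] := (sqr_sqrtr A0, sqr_sqrtr B0).
have [A1|A1] := eqVneq A 0.
  rewrite A1 sqrtr0 mul0r leNgt; apply/negP => C0.
  (* With A = 0 the form at (a, 1) is B - 2 a C, which is negative for this a. *)
  have := h ((B + 1) / C) 1.
  by rewrite A1 mulr0 add0r expr1n mul1r mulr1 divfK ?gt_eqF// mulr2n; lra.
have [B1|B1] := eqVneq B 0.
  rewrite B1 sqrtr0 mulr0 leNgt; apply/negP => C0.
  have := h 1 ((A + 1) / C).
  by rewrite B1 mulr0 addr0 expr1n mul1r mul1r divfK ?gt_eqF// mulr2n; lra.
have ab : 0 < Num.sqrt A * Num.sqrt B by rewrite mulr_gt0// sqrtr_gt0 lt0r ?A1 ?B1.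
have h' x y : 0 <= x ^+ 2 * Num.sqrt A ^+ 2 - x * y * C *+ 2 + y ^+ 2 * Num.sqrt B ^+ 2.
  by rewrite As Bs.
have := h' (Num.sqrt B) (Num.sqrt A).
rewrite [X in 0 <= X](_ : _ = (Num.sqrt A * Num.sqrt B) * (Num.sqrt A * Num.sqrt B - C) *+ 2).
  by rewrite pmulrn_lge0// pmulr_rge0// subr_ge0.
by rewrite !mulr2n; ring.
Qed.

Lemma sum_cauchy_schwarz (I : Type) (r : seq I) (p : pred I) (x y : I -> R) :
  \sum_(i <- r | p i) x i * y i <=
  Num.sqrt (\sum_(i <- r | p i) x i ^+ 2) * Num.sqrt (\sum_(i <- r | p i) y i ^+ 2).
Proof.
apply: le_of_quadratic_form => [||a b]; [by apply: sumr_ge0 => i _; exact: sqr_ge0..|].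
rewrite -mulrnAr !mulr_sumr -sumrMnl mulr_sumr -sumrB -big_split/=.
apply: sumr_ge0 => i _.
rewrite [leRHS](_ : _ = (a * x i - b * y i) ^+ 2) ?sqr_ge0// mulr2n; ring.
Qed.

End CauchySchwarz.

(** * The L^2 pairing of real functions on a probability space *)

Section SquareIntegrable.
Context d (T : measurableType d) (R : realType) (P : probability T R).
Implicit Types f g : T -> R.

Local Notation L2s := (Lfun P 2%:E).

Definition ip f g : R := \int[P]_x (f x * g x).

Lemma Lfun2_measurable f : f \in L2s -> measurable_fun setT f.
Proof. by rewrite inE => /andP[+ _]; rewrite inE. Qed.

Lemma Lfun2_of_sqr f : measurable_fun setT f ->
  P.-integrable setT (EFin \o (fun x => f x ^+ 2)) -> f \in L2s.
Proof.
move=> mf /integrableP[_ intf]; rewrite inE; apply/andP; split; rewrite inE//=.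
rewrite /finite_norm unlock poweR_lty//=.
apply: le_lt_trans intf; rewrite le_eqVlt; apply/orP; left; apply/eqP.
apply: eq_integral => x _ /=.
by rewrite powR_mulrn// real_normK ?num_real// ger0_norm// sqr_ge0.
Qed.

Lemma Lfun2_bounded f (M : R) : measurable_fun setT f ->
  (forall x, `|f x| <= M) -> f \in L2s.
Proof.
move=> mf fM; apply: Lfun2_of_sqr => //.
apply: measurable_bounded_integrable => //.
- by rewrite [X in (X < _)%E]probability_setT ltry.
- exact: measurable_funX.
- exists (M ^+ 2); split; first by rewrite num_real.
  move=> y yM x _ /=; apply: le_trans (ltW yM).
  by rewrite normrX lerXn2r ?nnegrE// (le_trans _ (fM x)).
Qed.

Lemma Lfun2D f g : f \in L2s -> g \in L2s -> f + g \in L2s.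
Proof. by move=> ? ?; have := @Lfun_addr_closed _ T R P _ (lee1n 2); case => _; exact. Qed.

Lemma Lfun2Z (a : R) f : f \in L2s -> a *: f \in L2s.
Proof.
move=> lf; have [l0 +] := @Lfun_submod_closed _ T R P _ (lee1n 2).
by move=> /(_ a f 0); rewrite addr0; apply.
Qed.

Lemma Lfun2B f g : f \in L2s -> g \in L2s -> f - g \in L2s.
Proof. by move=> lf lg; rewrite -scaleN1r; apply: Lfun2D => //; exact: Lfun2Z. Qed.

Lemma Lfun2_0 : 0 \in L2s.
Proof. by have [] := @Lfun_submod_closed _ T R P _ (lee1n 2). Qed.

Lemma Lfun2_sum I (r : seq I) (p : pred I) (F : I -> T -> R) :
  (forall i, p i -> F i \in L2s) -> \sum_(i <- r | p i) F i \in L2s.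
Proof.
by move=> Fi; elim/big_ind : _ => //; [exact: Lfun2_0|move=> ? ?; exact: Lfun2D].
Qed.

Lemma Lfun2_mul_integrable f g : f \in L2s -> g \in L2s ->
  P.-integrable setT (EFin \o (fun x => f x * g x)).
Proof. by move=> lf lg; apply/Lfun1_integrable; exact: Lfun2_mul_Lfun1. Qed.

Lemma Lfun2_mul_bounded f g (M : R) : measurable_fun setT f ->
  (forall x, `|f x| <= M) -> g \in L2s -> (fun x => f x * g x) \in L2s.
Proof.
move=> mf fM lg; have mg := Lfun2_measurable lg.
apply: Lfun2_of_sqr; first exact: measurable_funM.
have := Lfun2_mul_integrable lg (Lfun2Z (M ^+ 2) lg).
apply: le_integrable => //.
  by apply/measurable_EFinP; apply: measurable_funX; exact: measurable_funM.
move=> x _ /=; rewrite lee_fin.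
rewrite [leRHS]ger0_norm; last first.
  by rewrite /GRing.scale/= mulrCA mulr_ge0 ?sqr_ge0// -expr2 sqr_ge0.
rewrite ger0_norm ?sqr_ge0// exprMn [leRHS](_ : _ = M ^+ 2 * g x ^+ 2); last first.
  by rewrite expr2 mulrCA.
by rewrite ler_wpM2r ?sqr_ge0// -[leLHS]real_normK ?num_real// lerXn2r ?nnegrE// (le_trans _ (fM x)).
Qed.

Lemma ipC f g : ip f g = ip g f.
Proof. by rewrite /ip; congr Rintegral; apply/funext => x; rewrite mulrC. Qed.

Lemma ipDl f g h : f \in L2s -> g \in L2s -> h \in L2s ->
  ip (f + g) h = ip f h + ip g h.
Proof.
move=> lf lg lh; rewrite /ip -RintegralD//.
- by apply: eq_Rintegral => x _; rewrite mulrDl.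
- exact: Lfun2_mul_integrable.
- exact: Lfun2_mul_integrable.
Qed.

Lemma ipZl a f g : f \in L2s -> g \in L2s -> ip (a *: f) g = a * ip f g.
Proof.
move=> lf lg; rewrite /ip -RintegralZl//.
- by apply: eq_Rintegral => x _; rewrite -mulrA.
- exact: Lfun2_mul_integrable.
Qed.

Lemma ipBl f g h : f \in L2s -> g \in L2s -> h \in L2s ->
  ip (f - g) h = ip f h - ip g h.
Proof.
move=> lf lg lh; rewrite -scaleN1r ipDl ?ipZl ?mulN1r//; exact: Lfun2Z.
Qed.

Lemma ip0l f : ip 0 f = 0.
Proof. by rewrite /ip; under eq_Rintegral do rewrite mul0r; rewrite Rintegral_cst// mul0r. Qed.

Lemma ip_suml I (r : seq I) (p : pred I) (F : I -> T -> R) g :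
  (forall i, p i -> F i \in L2s) -> g \in L2s ->
  ip (\sum_(i <- r | p i) F i) g = \sum_(i <- r | p i) ip (F i) g.
Proof.
move=> Fi lg; suff [] : ip (\sum_(i <- r | p i) F i) g = \sum_(i <- r | p i) ip (F i) g
  /\ \sum_(i <- r | p i) F i \in L2s by [].
elim/big_rec2 : _ => [|i y x pi [<- yl]]; first by rewrite ip0l; split=> //; exact: Lfun2_0.
by rewrite ipDl ?Fi//; split => //; apply: Lfun2D => //; exact: Fi.
Qed.

Lemma ip_ge0 f : 0 <= ip f f.
Proof. by apply: Rintegral_ge0 => x _; rewrite -expr2 sqr_ge0. Qed.

Lemma eq_ae_ip f g h : f \in L2s -> g \in L2s -> h \in L2s ->
  {ae P, forall x, f x = g x} -> ip f h = ip g h.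
Proof.
move=> lf lg lh fg; rewrite /ip /Rintegral; congr fine.
apply: ae_eq_integral => //.
- by case/integrableP : (Lfun2_mul_integrable lf lh).
- by case/integrableP : (Lfun2_mul_integrable lg lh).
- by apply: filterS fg => x -> _.
Qed.

Lemma le_ip_sqr f g (M : R) : measurable_fun setT f ->
  (forall x, `|f x| <= M) -> g \in L2s ->
  ip (fun x => f x * g x) (fun x => f x * g x) <= M ^+ 2 * ip g g.
Proof.
move=> mf fM lg; rewrite -ipZl// /ip.
have lfg := Lfun2_mul_bounded mf fM lg.
apply: le_Rintegral => //.
- exact: Lfun2_mul_integrable.
- by apply: Lfun2_mul_integrable => //; exact: Lfun2Z.
move=> x _; rewrite [leRHS](_ : _ = M ^+ 2 * (g x * g x)); last by rewrite mulrA.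
rewrite mulrACA -!expr2.
by rewrite ler_wpM2r ?sqr_ge0// -[leLHS]real_normK ?num_real// lerXn2r ?nnegrE// (le_trans _ (fM x)).
Qed.

End SquareIntegrable.

(** * The L^2 inner product and norm of vector fields *)

Section FieldSpace.
Context {R : realType} {d : nat}.
Local Notation T := (d.-tuple R).
Local Notation mu := (@torus_measure R d).
Implicit Types (f g w : vfield R d).

Lemma innerE g w : inner g w = \sum_(i < d) ip mu (g i) (w i).
Proof. by []. Qed.

Lemma L2D g w : L2 g -> L2 w -> L2 (g + w).
Proof. by move=> lg lw i; exact: Lfun2D (lg i) (lw i). Qed.

Lemma L2Z (a : R) g : L2 g -> L2 (a *: g).
Proof. by move=> lg i; exact: Lfun2Z (lg i). Qed.

Lemma L2B g w : L2 g -> L2 w -> L2 (g - w).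
Proof. by move=> lg lw i; exact: Lfun2B (lg i) (lw i). Qed.

Lemma L2_0 : L2 (0 : vfield R d).
Proof. by move=> i; exact: Lfun2_0. Qed.

Lemma L2_sum I (r : seq I) (p : pred I) (F : I -> vfield R d) :
  (forall i, p i -> L2 (F i)) -> L2 (\sum_(i <- r | p i) F i).
Proof. by move=> Fi; elim/big_ind : _ => //; [exact: L2_0|exact: L2D]. Qed.

Lemma innerC g w : inner g w = inner w g.
Proof. by rewrite !innerE; apply: eq_bigr => i _; rewrite ipC. Qed.

Lemma innerDl f g w : L2 f -> L2 g -> L2 w ->
  inner (f + g) w = inner f w + inner g w.
Proof.
move=> lf lg lw; rewrite !innerE -big_split /=; apply: eq_bigr => i _.
by rewrite -ipDl; [|exact: lf|exact: lg|exact: lw].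
Qed.

Lemma innerZl a g w : L2 g -> L2 w -> inner (a *: g) w = a * inner g w.
Proof.
move=> lg lw; rewrite !innerE mulr_sumr; apply: eq_bigr => i _.
by rewrite -ipZl; [|exact: lg|exact: lw].
Qed.

Lemma innerBl f g w : L2 f -> L2 g -> L2 w ->
  inner (f - g) w = inner f w - inner g w.
Proof.
by move=> lf lg lw; rewrite -scaleN1r innerDl ?innerZl ?mulN1r//; exact: L2Z.
Qed.

Lemma innerDr f g w : L2 f -> L2 g -> L2 w ->
  inner w (f + g) = inner w f + inner w g.
Proof. by move=> lf lg lw; rewrite innerC innerDl// !(innerC w). Qed.

Lemma innerZr a g w : L2 g -> L2 w -> inner w (a *: g) = a * inner w g.
Proof. by move=> lg lw; rewrite innerC innerZl// !(innerC w). Qed.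

Lemma innerBr f g w : L2 f -> L2 g -> L2 w ->
  inner w (f - g) = inner w f - inner w g.
Proof. by move=> lf lg lw; rewrite innerC innerBl// !(innerC w). Qed.

Lemma inner_ge0 g : 0 <= inner g g.
Proof. by rewrite innerE sumr_ge0// => i _; exact: ip_ge0. Qed.

Lemma inner0l g : inner 0 g = 0.
Proof. by rewrite innerE big1// => i _; exact: ip0l. Qed.

Lemma eq_field_inner f g w : L2 f -> L2 g -> L2 w -> eq_field f g ->
  inner f w = inner g w.
Proof.
move=> lf lg lw fg; rewrite !innerE; apply: eq_bigr => i _.
exact: eq_ae_ip (lf i) (lg i) (lw i) (fg i).
Qed.

Lemma L2norm_ge0 g : 0 <= L2norm g.
Proof. exact: sqrtr_ge0. Qed.

Lemma L2norm_sqr g : L2norm g ^+ 2 = inner g g.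
Proof. by rewrite sqr_sqrtr// inner_ge0. Qed.

Lemma inner_cauchy_schwarz g w : L2 g -> L2 w -> inner g w <= L2norm g * L2norm w.
Proof.
move=> lg lw; apply: le_of_quadratic_form; [exact: inner_ge0..|] => a b.
have := inner_ge0 (a *: g - b *: w).
have [lag lbw] := (L2Z a lg, L2Z b lw).
rewrite innerBl ?innerBr//; [|exact: L2B..].
rewrite !innerZl ?innerZr// (innerC w g).
by congr (0 <= _); rewrite mulr2n; ring.
Qed.

Lemma inner_cauchy_schwarz_norm g w : L2 g -> L2 w ->
  `|inner g w| <= L2norm g * L2norm w.
Proof.
move=> lg lw; rewrite ler_norml inner_cauchy_schwarz// andbT lerNl.
rewrite -mulN1r -innerZl//; apply: le_trans (inner_cauchy_schwarz (L2Z _ lg) lw) _.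
by rewrite /L2norm innerZl ?innerZr ?mulN1r ?opprK//; exact: L2Z.
Qed.

Lemma L2normN g : L2 g -> L2norm (- g) = L2norm g.
Proof.
move=> lg; rewrite -scaleN1r /L2norm innerZl ?innerZr ?mulN1r ?opprK//.
exact: L2Z.
Qed.

Lemma L2normD g w : L2 g -> L2 w -> L2norm (g + w) <= L2norm g + L2norm w.
Proof.
move=> lg lw; rewrite -(@ler_pXn2r _ 2) ?nnegrE ?addr_ge0 ?L2norm_ge0//.
rewrite L2norm_sqr sqrrD !L2norm_sqr innerDl ?innerDr//; [|exact: L2D..].
rewrite (innerC w g).
by have := inner_cauchy_schwarz lg lw; lra.
Qed.

Lemma L2normB g w : L2 g -> L2 w -> L2norm (g - w) <= L2norm g + L2norm w.
Proof.
move=> lg lw; rewrite -(L2normN lw); apply: L2normD => //.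
by rewrite -scaleN1r; exact: L2Z.
Qed.

Lemma L2norm0 : L2norm (0 : vfield R d) = 0.
Proof. by rewrite /L2norm inner0l sqrtr0. Qed.

Lemma L2norm_sum I (r : seq I) (p : pred I) (F : I -> vfield R d) :
  (forall i, p i -> L2 (F i)) ->
  L2norm (\sum_(i <- r | p i) F i) <= \sum_(i <- r | p i) L2norm (F i).
Proof.
move=> Fi; suff [] : L2norm (\sum_(i <- r | p i) F i) <= \sum_(i <- r | p i) L2norm (F i)
  /\ L2 (\sum_(i <- r | p i) F i) by [].
elim/big_rec2 : _ => [|i y x pi [le ly]]; first by rewrite L2norm0; split => //; exact: L2_0.
split; last by apply: L2D => //; exact: Fi.
by apply: le_trans (L2normD (Fi _ pi) ly) _; rewrite lerD2l.
Qed.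

End FieldSpace.

(** * Derivatives and periodicity of sine and cosine *)

Section Calculus.
Context {R : realType}.

Lemma is_derive_affine (a b y : R) : is_derive y 1 (fun y => a * y + b) a.
Proof.
have h : is_derive y 1 (a \*: id + cst b) (a *: 1 + 0).
  by apply: is_deriveD.
by move: h; rewrite addr0 [X in is_derive _ _ _ X]mulr1.
Qed.

Lemma is_derive_sin_affine (a b y : R) :
  is_derive y 1 (fun y => sin (a * y + b)) (a * cos (a * y + b)).
Proof.
rewrite mulrC.
exact: (@is_derive1_comp _ sin _ _ _ _ (is_derive_sin _) (is_derive_affine a b y)).
Qed.

Lemma is_derive_cos_affine (a b y : R) :
  is_derive y 1 (fun y => cos (a * y + b)) (- a * sin (a * y + b)).
Proof.
rewrite mulrC mulrN -mulNr.
exact: (@is_derive1_comp _ cos _ _ _ _ (is_derive_cos _) (is_derive_affine a b y)).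
Qed.

Lemma sinD2pi_int (k : int) (c : R) : sin (2 * pi * k%:~R + c) = sin c.
Proof.
have per n (a : R) : sin (a + 2 * pi * n%:R) = sin a.
  by rewrite -(periodicn (@sinD2pi R) n a) mulr_natr mulr_natl.
case: k => n; first by rewrite addrC per.
(* A negative integer is -(n + 1): adding n + 1 periods cancels the shift. *)
by rewrite NegzE mulrNz mulrN addrC -[LHS](per n.+1) subrK.
Qed.

End Calculus.

(** * Integrals of the characters over the torus *)

Section TorusIntegral.
Context {R : realType}.

Lemma dotk_cons n (k : 'I_n.+1 -> int) (y : R) (x : n.-tuple R) :
  dotk k [the n.+1.-tuple R of y :: x] = (k ord0)%:~R * y + dotk (fun i => k (lift ord0 i)) x.
Proof.
rewrite /dotk big_ord_recl; congr (_ + _).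
by apply: eq_bigr => i _; rewrite tnthS.
Qed.

Lemma measurable_dotk n (k : 'I_n -> int) :
  measurable_fun [set: n.-tuple R] (@dotk R n k).
Proof.
rewrite /dotk; apply: measurable_sum => i.
by apply: measurable_funM => //; exact: measurable_tnth.
Qed.

Lemma measurable_cos_dotk n (k : 'I_n -> int) (c : R) :
  measurable_fun [set: n.-tuple R] (fun x => cos (2 * pi * dotk k x + c)).
Proof.
apply: (@measurableT_comp _ _ _ _ _ _ cos).
  by apply: continuous_measurable_fun; exact: continuous_cos.
apply: measurable_funD => //; apply: measurable_funM => //.
exact: measurable_dotk.
Qed.

Lemma integral_interval_cos (k : int) (c : R) :
  (\int[lebesgue_measure]_(y in `[0%R, 1%R]) (1 + cos (2 * pi * k%:~R * y + c))%:E
   = (1 + (if k == 0 then cos c else 0))%:E)%E.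
Proof.
have [->|k0] := eqVneq k 0.
  under eq_integral do rewrite mulr0 mul0r add0r.
  by rewrite integral_cst//= lebesgue_measure_itv/= lte_fin ltr01 sube0 mule1.
set a := 2 * pi * k%:~R.
pose F (y : R) : R := y + a^-1 * sin (a * y + c).
have a0 : a != 0.
  by rewrite !mulf_neq0 ?intr_eq0// gt_eqF// pi_gt0.
have dF (y : R) : is_derive y 1 F (1 + cos (a * y + c)).
  have h : is_derive y 1 (id + a^-1 \*: (fun y => sin (a * y + c)))
      (1 + a^-1 *: (a * cos (a * y + c))).
    by apply: is_deriveD; apply: is_deriveZ; exact: is_derive_sin_affine.
  by move: h; rewrite /GRing.scale/= mulKf.
have cF : continuous F.
  by move=> y; apply/differentiable_continuous/derivable1_diffP; have [] := dF y.
rewrite (@continuous_FTC2 _ _ F)//.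
- rewrite -EFinD /F mulr1 mulr0 add0r sinD2pi_int add0r; congr (_%:E); ring.
- apply: continuous_subspaceT => y.
  apply: cvgD; first exact: cvg_cst.
  apply/differentiable_continuous/derivable1_diffP.
  by have [] := is_derive_cos_affine a c y.
- split.
  + by move=> y _; have [] := dF y.
  + by apply: cvg_at_right_filter; exact: cF.
  + by apply: cvg_at_left_filter; exact: cF.
- by move=> y _; rewrite derive1E; exact: derive_val.
Qed.

(* The phase [c] makes the induction on the dimension go through; adding 1
   keeps the integrand nonnegative, so that Tonelli's theorem applies. *)
Lemma integral_torus_cos n (k : 'I_n -> int) (c : R) :
  (\int[@torus_measure R n]_x (1 + cos (2 * pi * dotk k x + c))%:E
   = (1 + (if [forall i, k i == 0] then cos c else 0))%:E)%E.
Proof.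
elim: n => [|n IH] in k c *.
  rewrite integral_dirac//=.
    rewrite diracT mul1e /dotk big_ord0 mulr0 add0r.
    by case: forallP => // -[] [].
  apply/measurable_EFinP; apply: measurable_funD => //.
  exact: measurable_cos_dotk.
have mcos : measurable_fun setT
    (fun x : n.+1.-tuple R => (1 + cos (2 * pi * dotk k x + c))%:E).
  by apply/measurable_EFinP; apply: measurable_funD => //; exact: measurable_cos_dotk.
rewrite /= ge0_integral_distribution//=.
rewrite fubini_tonelli1//=; last by apply: (measurableT_comp mcos); exact: measurable_consT.
rewrite /fubini_F/=.
transitivity (\int[uniform_prob (@ltr01 R)]_y
   (1 + (if [forall i, k (lift ord0 i) == 0] then cos (2 * pi * (k ord0)%:~R * y + c) else 0))%:E)%E.
  apply: eq_integral => y _; rewrite -IH; apply: eq_integral => x _.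
  rewrite dotk_cons; congr ((1 + cos _)%:E).
  by rewrite mulrDr (mulrA (2 * pi)) [X in X + c]addrC -addrA.
have -> : [forall i, k i == 0] = (k ord0 == 0) && [forall i, k (lift ord0 i) == 0].
  apply/forallP/andP => [h|[h0 /forallP h] i]; first by split=> //; apply/forallP.
  by case: (unliftP ord0 i) => [j ->|->//]; exact: h.
have [h|h] := boolP [forall i, k (lift ord0 i) == 0].
  rewrite andbT integral_uniform//=; last first.
    apply/measurable_EFinP; apply: measurable_funD => //.
    apply: continuous_measurable_fun => y.
    apply/differentiable_continuous/derivable1_diffP.
    by have [] := is_derive_cos_affine (2 * pi * (k ord0)%:~R) c y.
  by rewrite subr0 invr1 mul1e integral_interval_cos.
rewrite andbF addr0 integral_cst//=.
by rewrite [X in (_ * X)%E](@probability_setT _ _ _ (uniform_prob (@ltr01 R))) mul1e.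
Qed.

Lemma Rintegral_torus_cos n (k : 'I_n -> int) (c : R) :
  \int[@torus_measure R n]_x cos (2 * pi * dotk k x + c)
   = if [forall i, k i == 0] then cos c else 0.
Proof.
have /(congr1 fine) /= := integral_torus_cos k c.
(* The constant 1, added for the sake of nonnegativity, is now split off and cancelled. *)
rewrite -/(Rintegral _ _ _) RintegralD//.
- rewrite Rintegral_cst// [X in fine X]probability_setT/= mulr1.
  by move/addrI.
- exact: finite_measure_integrable_cst.
- apply: measurable_bounded_integrable => //.
  + by rewrite [X in (X < _)%E]probability_setT ltry.
  + exact: measurable_cos_dotk.
  + exists 1; split; first by rewrite num_real.
    by move=> y y1 x _ /=; rewrite (le_trans (cos_max _))// ltW.
Qed.

End TorusIntegral.

(** * Boxes of frequencies and changes of box *)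

Section Frequencies.
Context {d : nat}.
Implicit Types (k l : 'I_d -> int) (N M : nat).

Definition inbox N k := [forall i, `|k i| <= N%:Z].

Lemma inboxN N k : inbox N (- k) = inbox N k.
Proof. by apply: eq_forallb => i; rewrite normrN. Qed.

Lemma inbox_freq N M (m : {ffun 'I_d -> 'I_(N.*2.+1)}) : (N <= M)%N -> inbox M (freq m).
Proof.
move=> NM; apply/forallP => i; rewrite /freq.
have := ltn_ord (m i); move: (m i : nat) => {m} m; rewrite ltnS -addnn => mN; lia.
Qed.

Lemma freq_inj N : injective (@freq d N).
Proof.
move=> m n mn; apply/ffunP => i; apply/val_inj/eqP => /=.
by have /(congr1 (fun f => f i)) := mn; rewrite /freq => /addIr/eqP.
Qed.

(** Inverse of [freq] on the box; outside the box [inord] makes the value meaningless, and [unfreqK]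
    is restricted accordingly. *)
Definition unfreq N k : {ffun 'I_d -> 'I_(N.*2.+1)} :=
  [ffun i => inord (absz (k i + N%:Z))].

Lemma unfreqK N k : inbox N k -> freq (unfreq N k) = k.
Proof.
move=> /forallP kN; apply/funext => i; rewrite /freq ffunE inordK.
  by have := kN i; lia.
by have := kN i; lia.
Qed.

Lemma sum_box (V : nmodType) (F : ('I_d -> int) -> V) N M : (N <= M)%N ->
  \sum_(m : {ffun 'I_d -> 'I_(M.*2.+1)} | inbox N (freq m)) F (freq m)
  = \sum_(m : {ffun 'I_d -> 'I_(N.*2.+1)}) F (freq m).
Proof.
move=> NM; rewrite (reindex_onto (fun m => unfreq M (@freq d N m)) (fun m => unfreq N (@freq d M m))).
  apply: eq_big => [m|m _]; last by rewrite unfreqK// inbox_freq.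
  rewrite unfreqK ?inbox_freq//=; apply/eqP/freq_inj.
  by rewrite unfreqK// inbox_freq.
by move=> m mN; apply: freq_inj; rewrite !unfreqK// inbox_freq.
Qed.

Lemma sum_box_delta (R : pzRingType) (F : ('I_d -> int) -> R) N k :
  \sum_(m : {ffun 'I_d -> 'I_(N.*2.+1)}) F (freq m) * (freq m == k)%:R
  = if inbox N k then F k else 0.
Proof.
case: ifPn => kN.
  rewrite (bigD1 (unfreq N k))//= unfreqK// eqxx mulr1 big1 ?addr0// => m mk.
  have /negbTE-> : freq m != k; last by rewrite mulr0.
  by apply: contra mk => /eqP mk; apply/eqP/freq_inj; rewrite unfreqK.
rewrite big1// => m _; case: eqP => [mk|]; last by rewrite mulr0.
by move: kN; rewrite -mk inbox_freq.
Qed.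

End Frequencies.

(** * Real trigonometric sums, orthogonality and Parseval *)

Section TrigonometricSums.
Context {R : realType} {d : nat}.
Local Notation T := (d.-tuple R).
Local Notation mu := (@torus_measure R d).
Implicit Types (k l : 'I_d -> int) (N M : nat) (f g : T -> R).

Definition cosk k (x : T) : R := cos (2 * pi * dotk k x).
Definition sink k (x : T) : R := sin (2 * pi * dotk k x).

Lemma cosk_le1 k x : `|cosk k x| <= 1. Proof. exact: cos_max. Qed.
Lemma sink_le1 k x : `|sink k x| <= 1. Proof. exact: sin_max. Qed.

Lemma measurable_cosk k : measurable_fun setT (cosk k).
Proof.
apply: eq_measurable_fun (measurable_cos_dotk k 0) => x _.
by rewrite /cosk addr0.
Qed.

Lemma measurable_sink k : measurable_fun setT (sink k).
Proof.
apply: eq_measurable_fun (measurable_cos_dotk k (- (pi / 2))) => x _.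
by rewrite /sink cosBpihalf.
Qed.

Lemma cosk_Lfun k : cosk k \in Lfun mu 2%:E.
Proof. exact: Lfun2_bounded (measurable_cosk k) (cosk_le1 k). Qed.

Lemma sink_Lfun k : sink k \in Lfun mu 2%:E.
Proof. exact: Lfun2_bounded (measurable_sink k) (sink_le1 k). Qed.

Lemma dotkD k l x : dotk (k + l) x = dotk k x + dotk l x :> R.
Proof. by rewrite /dotk -big_split/=; apply: eq_bigr => i _; rewrite -mulrDl -rmorphD. Qed.

Lemma dotkN k x : dotk (- k) x = - dotk k x :> R.
Proof. by rewrite /dotk -sumrN; apply: eq_bigr => i _; rewrite -mulNr -rmorphN. Qed.

Lemma coskN k : cosk (- k) = cosk k.
Proof. by apply/funext => x; rewrite /cosk dotkN mulrN cosN. Qed.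

Lemma sinkN k : sink (- k) = - sink k.
Proof. by apply/funext => x; rewrite /sink dotkN mulrN sinN. Qed.

Lemma Rintegral_cosk k : \int[mu]_x cosk k x = (k == 0)%:R.
Proof.
transitivity (\int[mu]_x cos (2 * pi * dotk k x + 0)).
  by apply: eq_Rintegral => x _; rewrite addr0.
rewrite Rintegral_torus_cos cos0; case: eqVneq => [->|k0].
  by case: forallP => // -[].
case: forallP => // h; case/eqP: k0; apply/funext => i; exact/eqP.
Qed.

Lemma Rintegral_sink k : \int[mu]_x sink k x = 0.
Proof.
transitivity (\int[mu]_x cos (2 * pi * dotk k x + - (pi / 2))).
  by apply: eq_Rintegral => x _; rewrite cosBpihalf.
by rewrite Rintegral_torus_cos cosN cos_pihalf if_same.
Qed.

Lemma integrable_Lfun2 f : f \in Lfun mu 2%:E -> mu.-integrable setT (EFin \o f).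
Proof.
move=> lf; apply/Lfun1_integrable; apply: Lfun_subset12 => //.
by rewrite [X in X \is a fin_num]probability_setT.
Qed.

Lemma Rintegral_lin2 (a b : R) f g : f \in Lfun mu 2%:E -> g \in Lfun mu 2%:E ->
  \int[mu]_x (a * f x + b * g x) = a * \int[mu]_x f x + b * \int[mu]_x g x.
Proof.
move=> lf lg; rewrite RintegralD//.
- by rewrite !RintegralZl//; exact: integrable_Lfun2.
- by apply: (@integrable_Lfun2 (a *: f)); exact: Lfun2Z.
- by apply: (@integrable_Lfun2 (b *: g)); exact: Lfun2Z.
Qed.

(** Product-to-sum formula. Since [cosk] is even in k, the frequencies l and - l both contribute; at
    k = l = 0 the two halves add up to 1. *)
Lemma ip_cosk_cosk k l : ip mu (cosk k) (cosk l) = ((k == l)%:R + (k == - l)%:R) / 2.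
Proof.
have -> : ip mu (cosk k) (cosk l) = \int[mu]_x (2^-1 * cosk (k - l) x + 2^-1 * cosk (k + l) x).
  apply: eq_Rintegral => x _.
  by rewrite /cosk !dotkD dotkN !mulrDr mulrN !cosD cosN sinN; field.
rewrite Rintegral_lin2 ?cosk_Lfun// !Rintegral_cosk subr_eq0 addr_eq0; by field.
Qed.

Lemma ip_sink_sink k l : ip mu (sink k) (sink l) = ((k == l)%:R - (k == - l)%:R) / 2.
Proof.
have -> : ip mu (sink k) (sink l) = \int[mu]_x (2^-1 * cosk (k - l) x + (- 2^-1) * cosk (k + l) x).
  apply: eq_Rintegral => x _.
  by rewrite /cosk /sink !dotkD dotkN !mulrDr mulrN !cosD cosN sinN; field.
rewrite Rintegral_lin2 ?cosk_Lfun// !Rintegral_cosk subr_eq0 addr_eq0; by field.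
Qed.

Lemma ip_sink_cosk k l : ip mu (sink k) (cosk l) = 0.
Proof.
have -> : ip mu (sink k) (cosk l) = \int[mu]_x (2^-1 * sink (k - l) x + 2^-1 * sink (k + l) x).
  apply: eq_Rintegral => x _.
  by rewrite /cosk /sink !dotkD dotkN !mulrDr mulrN !sinD cosN sinN; field.
by rewrite Rintegral_lin2 ?sink_Lfun// !Rintegral_sink !mulr0 addr0.
Qed.

(* [ac f k - i bs f k] is the k-th Fourier coefficient of [f]. *)
Definition ac f k := ip mu f (cosk k).
Definition bs f k := ip mu f (sink k).

Lemma acN f k : ac f (- k) = ac f k. Proof. by rewrite /ac coskN. Qed.

Lemma bsN f k : f \in Lfun mu 2%:E -> bs f (- k) = - bs f k.
Proof.
move=> lf; rewrite /bs sinkN -scaleN1r ipC ipZl ?mulN1r 1?ipC//.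
exact: sink_Lfun.
Qed.

Lemma fcoefE f k : fcoef f k = Complex (ac f k) (- bs f k).
Proof. by []. Qed.

Implicit Types (c s : ('I_d -> int) -> R).

(** Each real mode occurs twice, at k and at - k. The sum therefore determines only the even part of
    c and the odd part of s, and [hermitian] below is what makes the coefficients readable from
    it. *)
Definition tp N c s : T -> R := \sum_(m : {ffun 'I_d -> 'I_(N.*2.+1)})
  (c (freq m) *: cosk (freq m) + s (freq m) *: sink (freq m)).

Lemma tpE N c s x : tp N c s x = \sum_(m : {ffun 'I_d -> 'I_(N.*2.+1)})
  (c (freq m) * cosk (freq m) x + s (freq m) * sink (freq m) x).
Proof. by rewrite /tp fct_sumE. Qed.

Lemma mode_Lfun (a b : R) k : a *: cosk k + b *: sink k \in Lfun mu 2%:E.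
Proof. by apply: Lfun2D; apply: Lfun2Z; [exact: cosk_Lfun|exact: sink_Lfun]. Qed.

Lemma tp_Lfun N c s : tp N c s \in Lfun mu 2%:E.
Proof. by apply: Lfun2_sum => m _; exact: mode_Lfun. Qed.

Lemma ip_mode f (a b : R) k : f \in Lfun mu 2%:E ->
  ip mu (a *: cosk k + b *: sink k) f = a * ac f k + b * bs f k.
Proof.
move=> lf; rewrite ipDl//; [|apply: Lfun2Z; exact: cosk_Lfun|apply: Lfun2Z; exact: sink_Lfun].
by rewrite !ipZl//; [rewrite /ac /bs !(ipC _ f)|exact: sink_Lfun|exact: cosk_Lfun].
Qed.

Lemma ip_tp f N c s : f \in Lfun mu 2%:E -> ip mu (tp N c s) f =
  \sum_(m : {ffun 'I_d -> 'I_(N.*2.+1)}) (c (freq m) * ac f (freq m) + s (freq m) * bs f (freq m)).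
Proof.
move=> lf; rewrite ip_suml//; last by move=> m _; exact: mode_Lfun.
by apply: eq_bigr => m _; exact: ip_mode.
Qed.

Lemma ac_tp_gen N c s k : ac (tp N c s) k =
  ((if inbox N k then c k else 0) + (if inbox N k then c (- k) else 0)) / 2.
Proof.
rewrite /ac ip_tp ?cosk_Lfun//.
rewrite -{2}(inboxN N k) -!sum_box_delta -big_split/= mulr_suml; apply: eq_bigr => m _.
rewrite /ac /bs ip_cosk_cosk (ipC _ _ (sink _)) ip_sink_cosk mulr0 addr0.
by rewrite mulrA mulrDr (eq_sym k (freq m)) (eq_sym k (- _)) eqr_oppLR.
Qed.

Lemma bs_tp_gen N c s k : bs (tp N c s) k =
  ((if inbox N k then s k else 0) - (if inbox N k then s (- k) else 0)) / 2.
Proof.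
rewrite /bs ip_tp ?sink_Lfun//.
rewrite -{2}(inboxN N k) -!sum_box_delta -sumrB mulr_suml; apply: eq_bigr => m _.
rewrite /ac /bs ip_sink_sink ip_sink_cosk mulr0 add0r.
by rewrite mulrA mulrBr (eq_sym k (freq m)) (eq_sym k (- _)) eqr_oppLR.
Qed.

Definition hermitian c s := (forall k, c (- k) = c k) /\ (forall k, s (- k) = - s k).

Lemma ac_tp N c s k : hermitian c s -> ac (tp N c s) k = if inbox N k then c k else 0.
Proof. by move=> [ce _]; rewrite ac_tp_gen ce; case: ifP => _; field. Qed.

Lemma bs_tp N c s k : hermitian c s -> bs (tp N c s) k = if inbox N k then s k else 0.
Proof. by move=> [_ so]; rewrite bs_tp_gen so; case: ifP => _; field. Qed.

(** Parseval: the factor 1/2 in the orthogonality relations is compensated by the double occurrence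
    of every mode. *)
Lemma ip_tp_tp N c s : hermitian c s -> ip mu (tp N c s) (tp N c s) =
  \sum_(m : {ffun 'I_d -> 'I_(N.*2.+1)}) (c (freq m) ^+ 2 + s (freq m) ^+ 2).
Proof.
move=> h; rewrite ip_tp ?tp_Lfun//; apply: eq_bigr => m _.
by rewrite ac_tp// bs_tp// inbox_freq// !expr2.
Qed.

End TrigonometricSums.

(** * Real sequences tending to 0 *)

Section NullSequences.
Context {R : realType}.
Implicit Types u v : R^nat.

Lemma cvg0D u v : u @ \oo --> (0 : R) -> v @ \oo --> (0 : R) ->
  (fun n => u n + v n) @ \oo --> (0 : R).
Proof. by move=> cu cv; rewrite -[X in _ --> X](addr0 0); exact: cvgD. Qed.

Lemma cvg0_sqr u : u @ \oo --> (0 : R) -> (fun n => u n ^+ 2) @ \oo --> (0 : R).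
Proof.
move=> cu; rewrite -[X in _ --> X](mulr0 0).
rewrite (_ : (fun n => u n ^+ 2) = (fun n => u n * u n)); last by apply/funext => n; rewrite expr2.
exact: cvgM.
Qed.

End NullSequences.

(** * Fractional Laplacians and V^s norms in Fourier coefficients *)

Section FourierMultipliers.
Context {R : realType} {d : nat}.
Local Notation T := (d.-tuple R).
Local Notation mu := (@torus_measure R d).
Local Notation Box N := {ffun 'I_d -> 'I_(N.*2.+1)}.
Implicit Types (k l : 'I_d -> int) (N M : nat) (f : T -> R) (g w : vfield R d) (s : R).

(** The symbol of (-Delta)^(1/2). *)
Definition Lam k : R := 2 * pi * normk k.

Lemma Lam_ge0 k : 0 <= Lam k.
Proof. by rewrite !mulr_ge0 ?sqrtr_ge0// pi_ge0. Qed.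

Lemma normkN k : normk (- k) = normk k :> R.
Proof. by rewrite /normk; congr Num.sqrt; apply: eq_bigr => i _; rewrite rmorphN sqrrN. Qed.

Lemma LamN k : Lam (- k) = Lam k.
Proof. by rewrite /Lam normkN. Qed.

Lemma normk0 : normk (0 : 'I_d -> int) = 0 :> R.
Proof. by rewrite /normk big1 ?sqrtr0// => i _; rewrite expr0n. Qed.

Lemma Lam0 : Lam 0 = 0.
Proof. by rewrite /Lam normk0 mulr0. Qed.

Lemma normk_sqr k : normk k ^+ 2 = \sum_(i < d) (k i)%:~R ^+ 2 :> R.
Proof. by rewrite sqr_sqrtr// sumr_ge0// => i _; exact: sqr_ge0. Qed.

Lemma intr_sqr_ge1 (z : int) : z != 0 -> 1 <= (z%:~R : R) ^+ 2.
Proof.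
move=> z0; rewrite -real_normK ?num_real// -intr_norm -rmorphXn/= ler1z.
by rewrite -[1](expr1n _ 2) lerXn2r ?nnegrE//; lia.
Qed.

Lemma normk_ge1 k : k != 0 -> 1 <= normk k :> R.
Proof.
move=> k0; have [i ki] : exists i, k i != 0.
  apply/existsP; rewrite -negb_forall; apply: contra k0 => /forallP h.
  by apply/eqP/funext => i; exact/eqP.
rewrite -[1]sqrtr1; apply: ler_wsqrtr; rewrite (bigD1 i)//=.
by rewrite ler_wpDr ?intr_sqr_ge1// sumr_ge0// => j _; exact: sqr_ge0.
Qed.

(** From pi >= 2; the factor 4 leaves room for the shift by 2 in [Lam_ge_coord]. *)
Lemma Lam_ge_4normk k : 4 * normk k <= Lam k.
Proof. by rewrite /Lam ler_wpM2r ?sqrtr_ge0//; have := pi_ge2 R; lra. Qed.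

Lemma Lam_ge1 k : k != 0 -> 1 <= Lam k.
Proof. by move=> /normk_ge1; have := Lam_ge_4normk k; lra. Qed.

Lemma Lam_gt0 k : k != 0 -> 0 < Lam k.
Proof. by move=> /Lam_ge1; exact: lt_le_trans. Qed.

Lemma sum_Complex (I : Type) (r : seq I) (p : pred I) (a b : I -> R) :
  \sum_(i <- r | p i) Complex (a i) (b i) =
  Complex (\sum_(i <- r | p i) a i) (\sum_(i <- r | p i) b i).
Proof. by elim/big_rec3 : _ => // i x y z _ ->. Qed.

Lemma Complex_mul (a b a' b' : R) :
  Complex a b * Complex a' b' = Complex (a * a' - b * b') (a * b' + b * a').
Proof. by []. Qed.

Lemma fraclap_sumE s g N i : fraclap_sum s g N i =
  tp N (fun k => Lam k `^ (2 * s) * ac (g i) k) (fun k => Lam k `^ (2 * s) * bs (g i) k).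
Proof.
apply/funext => x; rewrite tpE /fraclap_sum.
transitivity (complex.Re (\sum_(m : Box N) Complex
    (Lam (freq m) `^ (2 * s) * ac (g i) (freq m) * cosk (freq m) x +
     Lam (freq m) `^ (2 * s) * bs (g i) (freq m) * sink (freq m) x)
    (Lam (freq m) `^ (2 * s) * ac (g i) (freq m) * sink (freq m) x -
     Lam (freq m) `^ (2 * s) * bs (g i) (freq m) * cosk (freq m) x))).
  congr complex.Re; apply: eq_bigr => m _; rewrite fcoefE /fexp.
  rewrite !Complex_mul -/(cosk _ _) -/(sink _ _) -/(Lam _).
  by congr Complex; ring.
by rewrite sum_Complex.
Qed.

Lemma hermitian_multiplier (F : ('I_d -> int) -> R) f : (forall k, F (- k) = F k) ->
  f \in Lfun mu 2%:E -> hermitian (fun k => F k * ac f k) (fun k => F k * bs f k).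
Proof. by move=> FN lf; split=> k; rewrite FN ?acN// bsN// mulrN. Qed.

Lemma L2_fraclap_sum s g N : L2 (fraclap_sum s g N).
Proof. by move=> i; rewrite fraclap_sumE; exact: tp_Lfun. Qed.

Lemma inner_fraclap_sum s g w N : L2 w -> inner (fraclap_sum s g N) w =
  \sum_(m : Box N) Lam (freq m) `^ (2 * s) *
    \sum_i (ac (g i) (freq m) * ac (w i) (freq m) + bs (g i) (freq m) * bs (w i) (freq m)).
Proof.
move=> lw; rewrite innerE.
under eq_bigr => i _ do rewrite fraclap_sumE (ip_tp _ _ _ (lw i)).
rewrite exchange_big/=; apply: eq_bigr => m _; rewrite mulr_sumr.
by apply: eq_bigr => i _; rewrite mulrDr !mulrA.
Qed.

Lemma ac_fraclap_sum s g N i k : L2 g -> ac (fraclap_sum s g N i) k =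
  if inbox N k then Lam k `^ (2 * s) * ac (g i) k else 0.
Proof.
move=> lg; rewrite fraclap_sumE ac_tp//; apply: hermitian_multiplier (lg i) => k'.
by rewrite LamN.
Qed.

Lemma bs_fraclap_sum s g N i k : L2 g -> bs (fraclap_sum s g N i) k =
  if inbox N k then Lam k `^ (2 * s) * bs (g i) k else 0.
Proof.
move=> lg; rewrite fraclap_sumE bs_tp//; apply: hermitian_multiplier (lg i) => k'.
by rewrite LamN.
Qed.

(* [pw g k] is |g_k|^2 and [Q s g N] is the part of ||g||_{V^s}^2 carried by the
   frequencies of sup-norm at most [N]. *)
Definition pw g k : R := \sum_i (ac (g i) k ^+ 2 + bs (g i) k ^+ 2).

Lemma pw_ge0 g k : 0 <= pw g k.
Proof. by apply: sumr_ge0 => i _; rewrite addr_ge0 ?sqr_ge0. Qed.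

Definition Q s g N : R := \sum_(m : Box N) Lam (freq m) `^ (2 * s) * pw g (freq m).

Lemma Q_ge0 s g N : 0 <= Q s g N.
Proof. by apply: sumr_ge0 => m _; rewrite mulr_ge0 ?powR_ge0 ?pw_ge0. Qed.

Lemma powR_sqr (x a : R) : (x `^ a) ^+ 2 = x `^ (2 * a).
Proof. by rewrite mulrC powRrM powR_mulrn// powR_ge0. Qed.

Lemma le_sum_box (F : ('I_d -> int) -> R) N M : (forall k, 0 <= F k) -> (N <= M)%N ->
  \sum_(m : Box N) F (freq m) <= \sum_(m : Box M) F (freq m).
Proof.
move=> F0 NM; rewrite -(sum_box _ NM) big_mkcond/=; apply: ler_sum => m _.
by case: ifP => // _; exact: F0.
Qed.

Lemma le_Q s g N M : (N <= M)%N -> Q s g N <= Q s g M.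
Proof.
move=> NM; apply: (@le_sum_box (fun k => Lam k `^ (2 * s) * pw g k)) => // k.
by rewrite mulr_ge0 ?powR_ge0 ?pw_ge0.
Qed.

(** Pairing with a sum over the box sees the coefficients of w in the box only, so this serves both
    for the partial sum itself and for the full fractional Laplacian. *)
Lemma inner_fraclap_sum_self s g w N : L2 g -> L2 w ->
  (forall i k, inbox N k -> ac (w i) k = Lam k `^ (2 * s) * ac (g i) k) ->
  (forall i k, inbox N k -> bs (w i) k = Lam k `^ (2 * s) * bs (g i) k) ->
  inner (fraclap_sum s g N) w = Q (2 * s) g N.
Proof.
move=> lg lw acw bsw; rewrite inner_fraclap_sum//; apply: eq_bigr => m _.
rewrite -[in RHS]powR_sqr expr2 -mulrA; congr (_ * _); rewrite [RHS]mulr_sumr.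
apply: eq_bigr => i _; rewrite acw ?bsw ?inbox_freq//; by ring.
Qed.

Lemma inner_fraclap_sum_sqr s g N : L2 g ->
  inner (fraclap_sum s g N) (fraclap_sum s g N) = Q (2 * s) g N.
Proof.
move=> lg; apply: inner_fraclap_sum_self => // [|i k kN|i k kN]; first exact: L2_fraclap_sum.
- by rewrite ac_fraclap_sum// kN.
- by rewrite bs_fraclap_sum// kN.
Qed.

Definition field1 (i : 'I_d) f : vfield R d := fun j => if j == i then f else 0.

Lemma L2_field1 i f : f \in Lfun mu 2%:E -> L2 (field1 i f).
Proof. by move=> lf j; rewrite /field1; case: ifP => // _; exact: Lfun2_0. Qed.

Lemma inner_field1 g i f : inner g (field1 i f) = ip mu (g i) f.
Proof.
rewrite innerE (bigD1 i)//= /field1 eqxx big1 ?addr0// => j /negbTE ->.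
by rewrite ipC ip0l.
Qed.

Lemma ip_le1 f : measurable_fun setT f -> (forall x, `|f x| <= 1) -> ip mu f f <= 1.
Proof.
move=> mf f1.
have l1 : cst 1 \in Lfun mu 2%:E by exact: Lfun_cst.
have := le_ip_sqr mf f1 l1.
rewrite expr1n mul1r.
have -> : (fun x => f x * cst 1 x) = f by apply/funext => x; rewrite /= mulr1.
move=> /le_trans; apply; rewrite /ip /=.
by rewrite Rintegral_cst// [X in fine X]probability_setT !mulr1.
Qed.

Lemma ip_component_le g i f : L2 g -> measurable_fun setT f -> (forall x, `|f x| <= 1) ->
  `|ip mu (g i) f| <= L2norm g.
Proof.
move=> lg mf f1; have lf := Lfun2_bounded mu mf f1.
rewrite -inner_field1; apply: le_trans (inner_cauchy_schwarz_norm lg (L2_field1 i lf)) _.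
rewrite ler_piMr ?L2norm_ge0// /L2norm -[leRHS]sqrtr1 ler_wsqrtr// inner_field1.
by rewrite /field1 eqxx ip_le1.
Qed.

Lemma ac_le g i k : L2 g -> `|ac (g i) k| <= L2norm g.
Proof. by move=> lg; exact: ip_component_le lg (measurable_cosk k) (cosk_le1 k). Qed.

Lemma bs_le g i k : L2 g -> `|bs (g i) k| <= L2norm g.
Proof. by move=> lg; exact: ip_component_le lg (measurable_sink k) (sink_le1 k). Qed.

Lemma acB g w i k : L2 g -> L2 w -> ac ((g - w) i) k = ac (g i) k - ac (w i) k.
Proof. by move=> lg lw; exact: ipBl (lg i) (lw i) (cosk_Lfun k). Qed.

Lemma bsB g w i k : L2 g -> L2 w -> bs ((g - w) i) k = bs (g i) k - bs (w i) k.
Proof. by move=> lg lw; exact: ipBl (lg i) (lw i) (sink_Lfun k). Qed.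

Lemma inbox_exists k : exists N, forall M, (N <= M)%N -> inbox M k.
Proof.
exists (\sum_i `|k i|)%N => M NM; apply/forallP => i.
by rewrite -abszE lez_nat (leq_trans _ NM)// (bigD1 i)//= leq_addr.
Qed.

Lemma cvg_eventually_cst_le (u : R^nat) (a : R) N :
  u @ \oo --> (0 : R) -> (forall n, (N <= n)%N -> `|a| <= u n) -> a = 0.
Proof.
move=> u0 au; apply/eqP; rewrite -normr_le0.
rewrite -(cvg_lim _ u0)//; apply: limr_ge; first by apply/cvg_ex; exists 0.
by near=> n; apply: au; near: n; exact: nbhs_infty_ge.
Unshelve. all: by end_near. Qed.

(** Once the box contains k, the k-th coefficient of the partial sum no longer changes; a
    coefficient is bounded by the L^2 norm, so the limit inherits this value. *)
Lemma ac_fraclap s g w i k : is_fraclap s g w -> ac (w i) k = Lam k `^ (2 * s) * ac (g i) k.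
Proof.
move=> [lg lw cv]; have [N kN] := inbox_exists k.
apply/eqP; rewrite -subr_eq0; apply/eqP.
apply: (cvg_eventually_cst_le cv (N := N)) => n /kN kn.
have := @ac_le (w - fraclap_sum s g n) i k (L2B lw (L2_fraclap_sum s g n)).
by rewrite acB//; [rewrite ac_fraclap_sum// kn|exact: L2_fraclap_sum].
Qed.

Lemma bs_fraclap s g w i k : is_fraclap s g w -> bs (w i) k = Lam k `^ (2 * s) * bs (g i) k.
Proof.
move=> [lg lw cv]; have [N kN] := inbox_exists k.
apply/eqP; rewrite -subr_eq0; apply/eqP.
apply: (cvg_eventually_cst_le cv (N := N)) => n /kN kn.
have := @bs_le (w - fraclap_sum s g n) i k (L2B lw (L2_fraclap_sum s g n)).
by rewrite bsB//; [rewrite bs_fraclap_sum// kn|exact: L2_fraclap_sum].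
Qed.

Lemma inner_fraclap s g w N : is_fraclap s g w -> inner (fraclap_sum s g N) w = Q (2 * s) g N.
Proof.
move=> fl; have [lg lw _] := fl; apply: inner_fraclap_sum_self => // i k _.
  exact: ac_fraclap fl.
exact: bs_fraclap fl.
Qed.

(** Pythagoras: the partial sum is the orthogonal projection of w onto the modes of the box. *)
Lemma fraclap_dist s g w N : is_fraclap s g w ->
  L2norm (w - fraclap_sum s g N) ^+ 2 = L2norm w ^+ 2 - Q (2 * s) g N.
Proof.
move=> fl; have [lg lw _] := fl; have lS := L2_fraclap_sum s g N.
rewrite !L2norm_sqr innerBl ?innerBr//; try exact: L2B.
by rewrite (innerC w) (inner_fraclap N fl) inner_fraclap_sum_sqr//; ring.
Qed.

Lemma Q_le_fraclap s g w N : is_fraclap s g w -> Q (2 * s) g N <= L2norm w ^+ 2.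
Proof. by move=> fl; rewrite -subr_ge0 -fraclap_dist// sqr_ge0. Qed.

Lemma Q_cvg_fraclap s g w : is_fraclap s g w -> Q (2 * s) g @ \oo --> L2norm w ^+ 2.
Proof.
move=> fl; have [_ _ cv] := fl.
have -> : Q (2 * s) g = fun N => L2norm w ^+ 2 - L2norm (w - fraclap_sum s g N) ^+ 2.
  by apply/funext => N; rewrite fraclap_dist// opprB addrC subrK.
rewrite -[X in _ --> X]subr0; apply: cvgB; first exact: cvg_cst.
exact: cvg0_sqr cv.
Qed.

Lemma fraclap_norm_unique s g w w' : is_fraclap s g w -> is_fraclap s g w' ->
  L2norm w = L2norm w'.
Proof.
move=> /Q_cvg_fraclap h /Q_cvg_fraclap h'.
apply/eqP; rewrite -(@eqrXn2 _ 2) ?L2norm_ge0//; apply/eqP.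
exact: (cvg_unique _ h h').
Qed.

(** All candidates for the fractional Laplacian have the same norm, so the infimum is over one
    value. *)
Lemma VnormE s g w : is_fraclap (s / 2) g w -> Vnorm s g = (L2norm w)%:E.
Proof.
move=> fl; rewrite /Vnorm [X in ereal_inf X](_ : _ = [set (L2norm w)%:E]) ?ereal_inf1//.
apply/seteqP; split => [_ [w' fl' <-]|_ ->]/=; last by exists w.
by rewrite (fraclap_norm_unique fl fl').
Qed.

(** The infimum of the empty set is +oo, so a finite norm yields an actual fractional Laplacian. *)
Lemma Vnorm_lty s g : (Vnorm s g < +oo)%E -> exists w, is_fraclap (s / 2) g w.
Proof.
rewrite /Vnorm; have [->|/set0P[w fl]] := eqVneq [set w | is_fraclap (s / 2) g w] set0.
  by rewrite image_set0 ereal_inf0 ltxx.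
by exists w.
Qed.

Lemma Vnorm_le_fraclap s g (M : R) : (Vnorm s g <= M%:E)%E ->
  exists2 w, is_fraclap (s / 2) g w & L2norm w <= M.
Proof.
move=> gM; have [w fl] := Vnorm_lty (le_lt_trans gM (ltry _)).
by exists w => //; rewrite -lee_fin -(VnormE fl).
Qed.

Lemma mul2div2 s : 2 * (s / 2) = s. Proof. by rewrite mulrCA divff// mulr1. Qed.

Lemma Q_le_Vnorm s g N : ((Q s g N)%:E <= Vnorm s g ^+ 2)%E.
Proof.
have [h|] := ltP (Vnorm s g) +oo%E.
  have [w fl] := Vnorm_lty h; rewrite (VnormE fl) -EFin_expe lee_fin.
  by have := Q_le_fraclap N fl; rewrite mul2div2.
by rewrite leye_eq => /eqP ->; rewrite expe2 leey.
Qed.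

Lemma fraclap_sumB s g g' N : L2 g -> L2 g' ->
  fraclap_sum s (g - g') N = fraclap_sum s g N - fraclap_sum s g' N.
Proof.
move=> lg lg'; apply/funext => i; rewrite -[RHS]/(fraclap_sum s g N i - fraclap_sum s g' N i).
rewrite !fraclap_sumE; apply/funext => x; rewrite -[RHS]/(tp _ _ _ x - tp _ _ _ x) !tpE -sumrB.
by apply: eq_bigr => m _; rewrite acB ?bsB//; ring.
Qed.

Lemma is_fraclapB s g g' w w' : is_fraclap s g w -> is_fraclap s g' w' ->
  is_fraclap s (g - g') (w - w').
Proof.
move=> [lg lw cv] [lg' lw' cv']; split; [exact: L2B..|].
have cvS : (fun N => L2norm (w - fraclap_sum s g N) + L2norm (w' - fraclap_sum s g' N)) @ \oo --> (0 : R).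
  exact: cvg0D cv cv'.
apply: (squeeze_cvgr _ (cvg_cst (0:R)) cvS); near=> N.
rewrite L2norm_ge0/= fraclap_sumB//.
rewrite [X in L2norm X](_ : _ = (w - fraclap_sum s g N) - (w' - fraclap_sum s g' N)).
  by apply: L2normB; apply: L2B => //; exact: L2_fraclap_sum.
by rewrite !opprB addrACA [RHS]addrACA; congr (_ + _); rewrite addrC.
Unshelve. all: by end_near. Qed.

(** For s = 0 the multiplier is 1 at every frequency, k = 0 included, because a power with exponent
    0 is 1: this is plain Fourier truncation. *)
Definition trunc g N := fraclap_sum 0 g N.

Lemma ac_trunc g N i k : L2 g -> ac (trunc g N i) k = if inbox N k then ac (g i) k else 0.
Proof. by move=> lg; rewrite ac_fraclap_sum// mulr0 powRr0 mul1r. Qed.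

Lemma bs_trunc g N i k : L2 g -> bs (trunc g N i) k = if inbox N k then bs (g i) k else 0.
Proof. by move=> lg; rewrite bs_fraclap_sum// mulr0 powRr0 mul1r. Qed.

Lemma fraclap_sum_trunc s g N M : L2 g -> (N <= M)%N ->
  fraclap_sum s (trunc g N) M = fraclap_sum s g N.
Proof.
move=> lg NM; apply/funext => i; rewrite !fraclap_sumE; apply/funext => x; rewrite !tpE.
rewrite -(sum_box (fun k => Lam k `^ (2 * s) * ac (g i) k * cosk k x +
  Lam k `^ (2 * s) * bs (g i) k * sink k x) NM) [RHS]big_mkcond/=.
apply: eq_bigr => m _; rewrite ac_trunc// bs_trunc//.
by case: ifP => // _; rewrite !mulr0 !mul0r addr0.
Qed.

Lemma is_fraclap_trunc s g N : L2 g -> is_fraclap s (trunc g N) (fraclap_sum s g N).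
Proof.
move=> lg; split; [exact: L2_fraclap_sum..|].
apply/cvgrPdist_lt => e e0; near=> M.
rewrite fraclap_sum_trunc//; last by near: M; exact: nbhs_infty_ge.
by rewrite subrr L2norm0 subrr normr0.
Unshelve. all: by end_near. Qed.

Lemma Vnorm_sub_trunc s g w N : is_fraclap (s / 2) g w ->
  Vnorm s (g - trunc g N) = (L2norm (w - fraclap_sum (s / 2) g N))%:E.
Proof.
move=> fl; apply: VnormE; apply: is_fraclapB; first exact: fl.
by apply: is_fraclap_trunc; case: fl.
Qed.

Lemma dist_trunc g N : L2 g -> L2norm (g - trunc g N) <= L2norm g.
Proof.
move=> lg; rewrite -(@ler_pXn2r _ 2) ?nnegrE ?L2norm_ge0//.
have lS : L2 (trunc g N) := L2_fraclap_sum 0 g N.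
rewrite !L2norm_sqr innerBl ?innerBr//; try exact: L2B.
have e : inner (trunc g N) g = inner (trunc g N) (trunc g N).
  rewrite inner_fraclap_sum_self//; last 2 first.
  - by move=> i k _; rewrite mulr0 powRr0 mul1r.
  - by move=> i k _; rewrite mulr0 powRr0 mul1r.
  by rewrite inner_fraclap_sum_sqr.
by rewrite (innerC g) e; have := inner_ge0 (trunc g N); lra.
Qed.

End FourierMultipliers.

(** * The space H in Fourier coefficients, and test fields isolating one coefficient *)

Section DivergenceFree.
Context {R : realType} {d : nat}.
Local Notation T := (d.-tuple R).
Local Notation mu := (@torus_measure R d).
Local Notation Box N := {ffun 'I_d -> 'I_(N.*2.+1)}.
Implicit Types (k n : 'I_d -> int) (N M : nat) (f : T -> R) (g w phi : vfield R d) (s : R).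

Lemma dotk_replace k (x : T) j (y : R) :
  dotk k (replace_coord x j y) = (k j)%:~R * y + (dotk k x - (k j)%:~R * tnth x j).
Proof.
rewrite /dotk (bigD1 j)//= [in RHS](bigD1 j)//= tnth_mktuple eqxx.
rewrite (addrC (_ * tnth x j)) addrK; congr (_ + _); apply: eq_bigr => i /negbTE ij.
by rewrite tnth_mktuple ij.
Qed.

Lemma partial_tp j N (c s : ('I_d -> int) -> R) : partial j (tp N c s) =
  tp N (fun k => 2 * pi * (k j)%:~R * s k) (fun k => - (2 * pi * (k j)%:~R * c k)).
Proof.
apply/funext => x; rewrite /partial derive1E.
(* On the line through x in direction j, the phase of mode k is the affine function a k * y + b
   k. *)
pose a k : R := 2 * pi * (k j)%:~R.
pose b k : R := 2 * pi * (dotk k x - (k j)%:~R * tnth x j).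
have abE k y : 2 * pi * dotk k (replace_coord x j y) = a k * y + b k.
  by rewrite dotk_replace mulrDr mulrA.
have abx k : a k * tnth x j + b k = 2 * pi * dotk k x by rewrite /a /b; ring.
pose h k : R -> R := c k \*: (fun y => cos (a k * y + b k)) + s k \*: (fun y => sin (a k * y + b k)).
have dh k : is_derive (tnth x j) 1 (h k)
    (c k *: (- a k * sin (2 * pi * dotk k x)) + s k *: (a k * cos (2 * pi * dotk k x))).
  rewrite -abx; apply: is_deriveD; apply: is_deriveZ.
  - exact: is_derive_cos_affine.
  - exact: is_derive_sin_affine.
have -> : (fun y => tp N c s (replace_coord x j y)) = \sum_(m : Box N) h (freq m).
  apply/funext => y; rewrite tpE fct_sumE; apply: eq_bigr => m _.
  by rewrite /cosk /sink abE.
have ds : is_derive (tnth x j) 1 (\sum_(m : Box N) h (freq m)) (\sum_(m : Box N)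
    (c (freq m) *: (- a (freq m) * sin (2 * pi * dotk (freq m) x)) +
     s (freq m) *: (a (freq m) * cos (2 * pi * dotk (freq m) x)))).
  by elim/big_ind2 : _ => // [|h1 d1 h2 d2 ? ?]; [exact: is_derive_cst|exact: is_deriveD].
rewrite derive_val tpE; apply: eq_bigr => m _.
by rewrite /GRing.scale/= /a -/(cosk _ _) -/(sink _ _); ring.
Qed.

Definition vtp N (c s : 'I_d -> ('I_d -> int) -> R) : vfield R d := fun i => tp N (c i) (s i).

Definition negfreq N (m : Box N) : Box N := unfreq N (- freq m).

Lemma freq_negfreq N (m : Box N) : freq (negfreq m) = - freq m.
Proof. by rewrite unfreqK// inboxN inbox_freq. Qed.

Lemma negfreqK N : involutive (@negfreq N).
Proof. by move=> m; apply: freq_inj; rewrite !freq_negfreq opprK. Qed.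

Lemma sum_odd_box N (F : ('I_d -> int) -> R) : (forall k, F (- k) = - F k) ->
  \sum_(m : Box N) F (freq m) = 0.
Proof.
move=> Fodd; set S := \sum_(m : Box N) _.
have : S = - S.
  rewrite {1}/S (reindex_inj (inv_inj (@negfreqK N))) -sumrN.
  by apply: eq_bigr => m _; rewrite freq_negfreq Fodd.
lra.
Qed.

Lemma trig_poly_vtp N (c s : 'I_d -> ('I_d -> int) -> R) :
  (forall i, hermitian (c i) (s i)) -> trig_poly (vtp N c s).
Proof.
move=> cs; exists N, (fun k i => Complex (c i k) (- s i k)) => i x.
have [ce so] := cs i.
(* With coefficients c - i s, the imaginary part of the complex sum is odd under k -> - k, hence
   zero. *)
transitivity (Complex (tp N (c i) (s i) x) (\sum_(m : Box N)
   (c i (freq m) * sink (freq m) x - s i (freq m) * cosk (freq m) x))).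
  congr Complex; apply/esym.
  apply: (@sum_odd_box N (fun k => c i k * sink k x - s i k * cosk k x)) => k.
  by rewrite ce so coskN sinkN -[(- sink k) x]/(- sink k x); ring.
rewrite tpE -sum_Complex; apply: eq_bigr => m _.
rewrite /fexp Complex_mul -/(cosk _ _) -/(sink _ _).
by congr Complex; ring.
Qed.

Lemma trig_poly_inv phi : trig_poly phi ->
  exists N (c s : 'I_d -> ('I_d -> int) -> R), phi = vtp N c s.
Proof.
move=> [N [C phiE]]; exists N, (fun i k => complex.Re (C k i)), (fun i k => - complex.Im (C k i)).
apply/funext => i; apply/funext => x; rewrite /vtp tpE.
have /(congr1 (@complex.Re R)) /= -> := phiE i x.
transitivity (complex.Re (\sum_(m : Box N) Complex
   (complex.Re (C (freq m) i) * cosk (freq m) x + - complex.Im (C (freq m) i) * sink (freq m) x)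
   (complex.Re (C (freq m) i) * sink (freq m) x + complex.Im (C (freq m) i) * cosk (freq m) x))).
  congr complex.Re; apply: eq_bigr => m _; case: (C _ _) => a b.
  by rewrite /fexp Complex_mul -/(cosk _ _) -/(sink _ _) mulNr.
by rewrite sum_Complex.
Qed.

Lemma ac0 f : ac f 0 = \int[mu]_x f x.
Proof.
by apply: eq_Rintegral => x _; rewrite /cosk /dotk big1 ?mulr0 ?cos0 ?mulr1// => i _; rewrite mul0r.
Qed.

Lemma bs0 f : bs f 0 = 0.
Proof.
rewrite /bs (_ : sink 0 = 0); first by rewrite ipC ip0l.
apply/funext => x; rewrite /sink /dotk big1 ?mulr0 ?sin0// => i _; by rewrite mul0r.
Qed.

Lemma Vtrig_vtp N (c s : 'I_d -> ('I_d -> int) -> R) :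
  (forall i, hermitian (c i) (s i)) ->
  (forall k, \sum_i (k i)%:~R * c i k = 0) -> (forall k, \sum_i (k i)%:~R * s i k = 0) ->
  (forall i, c i 0 = 0) -> Vtrig (vtp N c s).
Proof.
move=> cs divc divs c0; split; first exact: trig_poly_vtp.
- move=> x; rewrite /divergence.
  under eq_bigr => j _ do rewrite /vtp partial_tp tpE.
  rewrite exchange_big/= big1// => m _.
  transitivity (2 * pi * (cosk (freq m) x * (\sum_i (freq m i)%:~R * s i (freq m)) -
    sink (freq m) x * (\sum_i (freq m i)%:~R * c i (freq m)))).
    rewrite !mulr_sumr -sumrB mulr_sumr; apply: eq_bigr => i _; ring.
  by rewrite divc divs !mulr0 subr0 mulr0.
- by move=> i; rewrite -ac0 ac_tp// c0 if_same.
Qed.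

(** Fourier form of membership in H: zero mean, and k orthogonal to the k-th coefficient. The sine
    coefficients at 0 vanish anyway, by [bs0]. *)
Definition divfree g := [/\ L2 g, forall i, ac (g i) 0 = 0,
  forall k, \sum_j (k j)%:~R * ac (g j) k = 0 &
  forall k, \sum_j (k j)%:~R * bs (g j) k = 0].

Lemma L2_vtp N (c s : 'I_d -> ('I_d -> int) -> R) : L2 (vtp N c s).
Proof. by move=> i; exact: tp_Lfun. Qed.

Lemma Vtrig_L2 phi : Vtrig phi -> L2 phi.
Proof. by move=> [/trig_poly_inv[N [c [s ->]]] _ _]; exact: L2_vtp. Qed.

Lemma two_pi_neq0 : 2 * pi != 0 :> R.
Proof. by rewrite mulf_neq0// gt_eqF// pi_gt0. Qed.

Lemma Vtrig_divfree phi : Vtrig phi -> divfree phi.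
Proof.
move=> vphi; have lphi := Vtrig_L2 vphi.
move: vphi => [/trig_poly_inv[N [c [s phiE]]] div0 int0]; split=> //.
- by move=> i; rewrite ac0.
- move=> k; apply: (mulfI two_pi_neq0); rewrite mulr0.
  (* The divergence is a trigonometric sum vanishing identically. Its sine coefficient at k is - 2
     pi times the sum to be computed; below, its cosine coefficient plays the same role for [bs]. *)
  have div0' : \sum_j tp N (fun k => 2 * pi * (k j)%:~R * s j k)
      (fun k => - (2 * pi * (k j)%:~R * c j k)) = 0.
    apply/funext => x; rewrite fct_sumE -[RHS](div0 x) /divergence.
    by apply: eq_bigr => j _; rewrite phiE /vtp partial_tp.
  have : bs (\sum_j tp N (fun k => 2 * pi * (k j)%:~R * s j k)
      (fun k => - (2 * pi * (k j)%:~R * c j k))) k = 0.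
    by rewrite div0' /bs ip0l.
  rewrite /bs ip_suml ?sink_Lfun//; last by move=> j _; exact: tp_Lfun.
  move=> h; apply: (@oppr_inj R); rewrite oppr0 -[RHS]h mulr_sumr -sumrN; apply: eq_bigr => j _.
  rewrite -/(bs _ _) bs_tp_gen phiE /vtp ac_tp_gen -[(- k) j]/(- (k j)) rmorphN/=.
  by case: ifP => _; field.
- move=> k; apply: (mulfI two_pi_neq0); rewrite mulr0.
  have div0' : \sum_j tp N (fun k => 2 * pi * (k j)%:~R * s j k)
      (fun k => - (2 * pi * (k j)%:~R * c j k)) = 0.
    apply/funext => x; rewrite fct_sumE -[RHS](div0 x) /divergence.
    by apply: eq_bigr => j _; rewrite phiE /vtp partial_tp.
  have : ac (\sum_j tp N (fun k => 2 * pi * (k j)%:~R * s j k)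
      (fun k => - (2 * pi * (k j)%:~R * c j k))) k = 0.
    by rewrite div0' /ac ip0l.
  rewrite /ac ip_suml ?cosk_Lfun//; last by move=> j _; exact: tp_Lfun.
  move=> h; rewrite -[RHS]h mulr_sumr; apply: eq_bigr => j _.
  rewrite -/(ac _ _) ac_tp_gen phiE /vtp bs_tp_gen -[(- k) j]/(- (k j)) rmorphN/=.
  by case: ifP => _; field.
Qed.

Lemma H_L2 g : H g -> L2 g. Proof. by case. Qed.

Lemma small_eq0 (a K : R) : 0 <= K -> (forall e, 0 < e -> `|a| <= K * e) -> a = 0.
Proof.
move=> K0 h; apply/eqP; rewrite -normr_le0; apply/ler_addgt0Pr => e e0.
rewrite add0r; apply: le_trans (h (e / (K + 1)) _) _; first by rewrite divr_gt0//; lra.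
by rewrite mulrA ler_pdivrMr; [rewrite mulrC ler_wpM2l; lra|lra].
Qed.

(** Each condition is linear in finitely many coefficients, which are continuous in L^2, and it
    holds for the approximating trigonometric fields. *)
Lemma H_divfree g : H g -> divfree g.
Proof.
move=> [lg gH]; split=> //.
- move=> i; apply: (@small_eq0 _ 1) => // e e0; have [phi vphi dphi] := gH e e0.
  have [lphi phi0 _ _] := Vtrig_divfree vphi.
  rewrite mul1r -[ac _ _]subr0 -(phi0 i) -acB//.
  by apply: le_trans (ac_le _ _ (L2B lg lphi)) (ltW dphi).
- move=> k; apply: (@small_eq0 _ (\sum_j `|(k j)%:~R|)) => [|e e0]; first exact: sumr_ge0.
  have [phi vphi dphi] := gH e e0.
  have [lphi _ phi0 _] := Vtrig_divfree vphi.
  have -> : \sum_j (k j)%:~R * ac (g j) k = \sum_j (k j)%:~R * ac ((g - phi) j) k.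
    by under [RHS]eq_bigr do rewrite acB// mulrBr; rewrite sumrB phi0 subr0.
  rewrite mulr_suml.
  apply: le_trans (ler_norm_sum _ _ _) _; apply: ler_sum => j _.
  rewrite normrM ler_wpM2l//.
  by apply: le_trans (ac_le _ _ (L2B lg lphi)) (ltW dphi).
- move=> k; apply: (@small_eq0 _ (\sum_j `|(k j)%:~R|)) => [|e e0]; first exact: sumr_ge0.
  have [phi vphi dphi] := gH e e0.
  have [lphi _ _ phi0] := Vtrig_divfree vphi.
  have -> : \sum_j (k j)%:~R * bs (g j) k = \sum_j (k j)%:~R * bs ((g - phi) j) k.
    by under [RHS]eq_bigr do rewrite bsB// mulrBr; rewrite sumrB phi0 subr0.
  rewrite mulr_suml.
  apply: le_trans (ler_norm_sum _ _ _) _; apply: ler_sum => j _.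
  rewrite normrM ler_wpM2l//.
  by apply: le_trans (bs_le _ _ (L2B lg lphi)) (ltW dphi).
Qed.

Lemma Vtrig_H phi : Vtrig phi -> H phi.
Proof.
move=> vphi; split; first exact: Vtrig_L2.
by move=> e e0; exists phi => //; rewrite subrr L2norm0.
Qed.

(** A scalar multiplier preserves orthogonality to k. This makes the truncations of (-Delta)^alpha w
    admissible as test fields. *)
Lemma Vtrig_fraclap_sum s g N : divfree g -> Vtrig (fraclap_sum s g N).
Proof.
move=> [lg g0 gc gs].
have -> : fraclap_sum s g N = vtp N (fun i k => Lam k `^ (2 * s) * ac (g i) k)
    (fun i k => Lam k `^ (2 * s) * bs (g i) k).
  by apply/funext => i; rewrite fraclap_sumE.
apply: Vtrig_vtp.
- by move=> i; apply: hermitian_multiplier (lg i) => k; rewrite LamN.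
- move=> k; under eq_bigr do rewrite mulrCA.
  by rewrite -mulr_sumr gc mulr0.
- move=> k; under eq_bigr do rewrite mulrCA.
  by rewrite -mulr_sumr gs mulr0.
- by move=> i; rewrite g0 mulr0.
Qed.

(** The difference has no coefficient in the larger box, while both fields have frequencies only
    there; it is orthogonal to both and so to itself. *)
Lemma trunc_vtp N M (c s : 'I_d -> ('I_d -> int) -> R) :
  (N <= M)%N -> L2norm (vtp N c s - trunc (vtp N c s) M) = 0.
Proof.
move=> NM; set phi := vtp N c s; have lphi : L2 phi := L2_vtp N c s.
have lt : L2 (trunc phi M) := L2_fraclap_sum 0 phi M.
have lD := L2B lphi lt.
have z i k : inbox M k -> ac ((phi - trunc phi M) i) k = 0 /\ bs ((phi - trunc phi M) i) k = 0.
  by move=> kM; rewrite acB// bsB// ac_trunc// bs_trunc// kM !subrr.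
rewrite /L2norm innerBl//.
have -> : inner phi (phi - trunc phi M) = 0.
  rewrite innerE big1// => i _; rewrite ip_tp; last exact: lD.
  rewrite big1// => m _.
  by have [-> ->] := z i _ (inbox_freq m NM); rewrite !mulr0 addr0.
have -> : inner (trunc phi M) (phi - trunc phi M) = 0.
  rewrite inner_fraclap_sum// big1// => m _; rewrite big1 ?mulr0// => i _.
  by have [-> ->] := z i _ (inbox_freq m (leqnn M)); rewrite !mulr0 addr0.
by rewrite subrr sqrtr0.
Qed.

Lemma truncB g w N : L2 g -> L2 w -> trunc (g - w) N = trunc g N - trunc w N.
Proof. exact: fraclap_sumB. Qed.

Lemma L2_trunc g N : L2 (trunc g N). Proof. exact: L2_fraclap_sum. Qed.

(** Large truncations leave the approximant phi unchanged, and g - phi loses norm when its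
    truncation is removed ([dist_trunc]). *)
Lemma H_trunc_near g (e : R) : H g -> 0 < e ->
  exists N, forall M, (N <= M)%N -> L2norm (g - trunc g M) < e.
Proof.
move=> [lg gH] e0; have [phi vphi dphi] := gH e e0.
have [/trig_poly_inv[N [c [s phiE]]] _ _] := vphi.
have lphi := Vtrig_L2 vphi.
exists N => M NM; apply: le_lt_trans dphi.
have -> : g - trunc g M = (g - phi - trunc (g - phi) M) + (phi - trunc phi M).
  by rewrite truncB// [RHS]addrACA subrK -opprD subrK.
apply: le_trans (L2normD _ _) _.
- by apply: L2B; [exact: L2B|exact: L2_trunc].
- by apply: L2B => //; exact: L2_trunc.
by rewrite phiE trunc_vtp// addr0 -phiE; apply: dist_trunc; exact: L2B.
Qed.

Lemma divfreeB g w : divfree g -> divfree w -> divfree (g - w).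
Proof.
move=> [lg g0 gc gs] [lw w0 wc ws]; split; first exact: L2B.
- by move=> i; rewrite acB// g0 w0 subr0.
- move=> k; under eq_bigr do rewrite acB// mulrBr.
  by rewrite sumrB gc wc subr0.
- move=> k; under eq_bigr do rewrite bsB// mulrBr.
  by rewrite sumrB gs ws subr0.
Qed.

(** The approximants are truncations of g - w at a common level, which lie in [Vtrig] by the Fourier
    characterization. *)
Lemma HB g w : H g -> H w -> H (g - w).
Proof.
move=> Hg Hw; have [lg lw] := (H_L2 Hg, H_L2 Hw); split; first exact: L2B.
move=> e e0; have e20 : 0 < e / 2 by rewrite divr_gt0.
have [N hN] := H_trunc_near Hg e20; have [M hM] := H_trunc_near Hw e20.
exists (trunc (g - w) (maxn N M)).
  by apply: Vtrig_fraclap_sum; apply: divfreeB; exact: H_divfree.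
have := hN _ (leq_maxl N M); have := hM _ (leq_maxr N M); set K := maxn N M.
rewrite truncB// => h1 h2.
have -> : g - w - (trunc g K - trunc w K) = (g - trunc g K) - (w - trunc w K).
  by rewrite !opprB addrACA [RHS]addrACA (addrC (- w)).
apply: le_lt_trans (L2normB _ _) _; try by apply: L2B => //; exact: L2_trunc.
by rewrite (splitr e); exact: ltrD h2 h1.
Qed.

Lemma V_of_fraclap s g w : H g -> is_fraclap (s / 2) g w -> V s g.
Proof.
move=> Hg fl; split=> // e e0; have [lg lw cv] := fl.
have /cvgrPdist_lt /(_ _ e0) [N _ hN] := cv.
exists (trunc g N); first by apply: Vtrig_fraclap_sum; exact: H_divfree.
rewrite (Vnorm_sub_trunc N fl) lte_fin.
have := hN N (leqnn N); rewrite /= sub0r normrN.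
by rewrite ger0_norm// L2norm_ge0.
Qed.

(* Entry (i, j) of the orthogonal projection of R^d onto the complement of n. *)
Definition perp n i j : R := (j == i)%:R - (n i)%:~R * (n j)%:~R / normk n ^+ 2.

Lemma sum_perp n i (X : 'I_d -> R) : \sum_j (n j)%:~R * X j = 0 ->
  \sum_j perp n i j * X j = X i.
Proof.
move=> nX; under eq_bigr do rewrite mulrBl.
rewrite sumrB (bigD1 i)//= eqxx mul1r big1 ?addr0; last by move=> j /negbTE ->; rewrite mul0r.
rewrite [X in _ - X](_ : _ = (n i)%:~R / normk n ^+ 2 * (\sum_j (n j)%:~R * X j)).
  by rewrite nX mulr0 subr0.
by rewrite mulr_sumr; apply: eq_bigr => j _; ring.
Qed.

Lemma perp_orthogonal n i : n != 0 -> \sum_j (n j)%:~R * perp n i j = 0.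
Proof.
move=> n0; under eq_bigr do rewrite mulrBr.
rewrite sumrB (bigD1 i)//= eqxx mulr1 big1 ?addr0; last by move=> j /negbTE ->; rewrite mulr0.
rewrite [X in _ - X](_ : _ = (n i)%:~R / normk n ^+ 2 * (\sum_j (n j)%:~R ^+ 2)).
  by rewrite normk_sqr divfK ?subrr// -normk_sqr expf_neq0// gt_eqF// (lt_le_trans ltr01)// normk_ge1.
by rewrite mulr_sumr; apply: eq_bigr => j _; ring.
Qed.

Lemma sum_perp_pm n i k (c : R) : n != 0 -> (k != n -> k != - n -> c = 0) ->
  \sum_j (k j)%:~R * (perp n i j * c) = 0.
Proof.
move=> n0 c0; under eq_bigr do rewrite mulrA.
rewrite -mulr_suml.
have [->|kn] := eqVneq k n; first by rewrite perp_orthogonal// mul0r.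
have [->|kn'] := eqVneq k (- n); last by rewrite c0// mulr0.
under eq_bigr => j _ do rewrite -[(- n) j]/(- (n j)) rmorphN mulNr.
by rewrite sumrN perp_orthogonal// oppr0 mul0r.
Qed.

(** The test field is the Leray projection of e_i times [cosk n], its coefficient being shared
    equally between n and - n. Against a divergence-free field the projection is invisible, so the
    pairing isolates one coefficient. *)
Lemma test_ac n i : n != 0 ->
  exists2 phi, Vtrig phi & forall w, H w -> inner w phi = ac (w i) n.
Proof.
move=> n0; have [N /(_ N (leqnn N)) nN] := inbox_exists n.
pose c j k : R := perp n i j * (((k == n)%:R + (k == - n)%:R) / 2).
exists (vtp N c (fun _ _ => 0)).
  apply: Vtrig_vtp.
  - move=> j; split=> k; last by rewrite oppr0.
    by rewrite /c eqr_oppLR eqr_opp (addrC (_ == - n)%:R).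
  - move=> k; apply: sum_perp_pm => // /negbTE -> /negbTE ->.
    by rewrite addr0 mul0r.
  - by move=> k; rewrite big1// => j _; rewrite mulr0.
  - by move=> j; rewrite /c eq_sym (negbTE n0) eq_sym oppr_eq0 (negbTE n0) addr0 mul0r mulr0.
move=> w /H_divfree[lw _ wc _].
rewrite innerC innerE -[RHS](sum_perp i (wc n)); apply: eq_bigr => j _.
rewrite /vtp (ip_tp _ _ _ (lw j)).
transitivity (perp n i j / 2 * (\sum_(m : Box N) ac (w j) (freq m) * (freq m == n)%:R +
   \sum_(m : Box N) ac (w j) (freq m) * (freq m == - n)%:R)).
  rewrite -big_split mulr_sumr; apply: eq_bigr => m _ /=; rewrite /c; by field.
by rewrite !sum_box_delta inboxN nN acN; field.
Qed.

Lemma test_bs n i : n != 0 ->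
  exists2 phi, Vtrig phi & forall w, H w -> inner w phi = bs (w i) n.
Proof.
move=> n0; have [N /(_ N (leqnn N)) nN] := inbox_exists n.
pose c j k : R := perp n i j * (((k == n)%:R - (k == - n)%:R) / 2).
exists (vtp N (fun _ _ => 0) c).
  apply: Vtrig_vtp => //.
  - move=> j; split=> k //.
    by rewrite /c eqr_oppLR eqr_opp -mulrN -mulNr opprB.
  - by move=> k; rewrite big1// => j _; rewrite mulr0.
  - move=> k; apply: sum_perp_pm => // /negbTE -> /negbTE ->.
    by rewrite subr0 mul0r.
move=> w /H_divfree[lw _ _ wc].
rewrite innerC innerE -[RHS](sum_perp i (wc n)); apply: eq_bigr => j _.
rewrite /vtp (ip_tp _ _ _ (lw j)).
transitivity (perp n i j / 2 * (\sum_(m : Box N) bs (w j) (freq m) * (freq m == n)%:R -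
   \sum_(m : Box N) bs (w j) (freq m) * (freq m == - n)%:R)).
  rewrite -sumrB mulr_sumr; apply: eq_bigr => m _ /=; rewrite /c; by field.
by rewrite !sum_box_delta inboxN nN bsN ?(lw j)//; field.
Qed.

End DivergenceFree.

(** * Summability of negative powers of the frequency *)

Section LatticeSum.
Context {R : realType}.

(* The weight (n+2)^(-3/2) is summable, and the product of its values at the
   coordinates of k dominates (2 pi |k|)^(-3d/2). *)
Definition psi (n : nat) : R := (Num.sqrt n.+2%:R ^+ 3)^-1.

Lemma psi_ge0 n : 0 <= psi n.
Proof. by rewrite invr_ge0 exprn_ge0// sqrtr_ge0. Qed.

(** With r^2 = n + 1 and q^2 = n + 2, one has 1/r - 1/q = 1/((q + r) r q), and (q + r) r q <= 2
    q^3. *)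
Lemma psi_telescope n : psi n <= 2 * ((Num.sqrt n.+1%:R)^-1 - (Num.sqrt n.+2%:R)^-1).
Proof.
rewrite /psi; set r := Num.sqrt n.+1%:R; set q := Num.sqrt n.+2%:R.
have r0 : 0 < r by rewrite sqrtr_gt0 ltr0n.
have q0 : 0 < q by rewrite sqrtr_gt0 ltr0n.
have rq : r <= q by rewrite ler_wsqrtr// ler_nat.
have e : q ^+ 2 - r ^+ 2 = 1.
  by rewrite !sqr_sqrtr// -natrB// subSnn.
have -> : r^-1 - q^-1 = ((q + r) * (r * q))^-1.
  have qr0 : (q + r) * (r * q) != 0 by rewrite gt_eqF// !mulr_gt0// addr_gt0.
  apply: (mulIf qr0); rewrite mulVf// -e; field.
  by rewrite !gt_eqF.
rewrite -ler_pdivrMl// -invfM.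
rewrite lef_pV2 ?posrE ?mulr_gt0 ?addr_gt0 ?exprn_gt0//.
rewrite [leRHS](_ : _ = (2 * q) * (q * q)); last by ring.
apply: ler_pM => //.
- by rewrite addr_ge0// ltW.
- by rewrite mulr_ge0// ltW.
- by rewrite mulr_natl mulr2n lerD2l.
- by rewrite ler_wpM2r// ltW.
Qed.

(** Passing from N to N + 1 adds two end terms, both equal to psi (N + 1); each telescopes with
    factor 2, whence the 4. *)
Lemma sum_psi_le N : \sum_(j < N.*2.+1) psi `|j%:Z - N%:Z|%N <=
  4 * (1 - (Num.sqrt N.+2%:R)^-1).
Proof.
elim: N => [|N IH].
  rewrite big_ord1/=; have := psi_telescope 0; rewrite sqrtr1 invr1.
  have : 1 <= Num.sqrt 2 :> R by rewrite -[leLHS]sqrtr1 ler_wsqrtr// ler1n.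
  rewrite -invf_le1 ?sqrtr_gt0// -[psi (0 + 0)]/(psi 0); lra.
rewrite doubleS big_ord_recl big_ord_recr/=.
rewrite subn0.
have -> : `|(bump 0 N.*2.+1)%:Z - N.+1%:Z|%N = N.+1 by rewrite /bump/=; lia.
rewrite (eq_bigr (fun j : 'I_N.*2.+1 => psi `|j%:Z - N%:Z|%N)); last first.
  by move=> j _; congr psi; rewrite /bump/=; lia.
have := psi_telescope N.+1; move: IH; lra.
Qed.

Lemma sum_psi_le4 N : \sum_(j < N.*2.+1) psi `|j%:Z - N%:Z|%N <= 4.
Proof.
apply: le_trans (sum_psi_le N) _.
by rewrite ler_piMr// lerBlDr lerDl invr_ge0 sqrtr_ge0.
Qed.

Context {d : nat}.
Local Notation Box N := {ffun 'I_d -> 'I_(N.*2.+1)}.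

Lemma Lam_ge_coord (k : 'I_d -> int) i : k != 0 -> (`|k i|%N.+2)%:R <= Lam k :> R.
Proof.
move=> k0; apply: le_trans (Lam_ge_4normk k).
have n1 := @normk_ge1 R _ _ k0.
have : (`|k i|%N)%:R <= normk k :> R.
  rewrite -[leLHS]ger0_norm// -sqrtr_sqr; apply: ler_wsqrtr.
  rewrite natr_absz intr_norm real_normK ?num_real// (bigD1 i)//=.
  by rewrite lerDl sumr_ge0// => j _; exact: sqr_ge0.
rewrite -addn2 natrD; lra.
Qed.

(** Since 2p >= 3d/2 and Lam k >= 1, the left side is at most a product of d factors (Lam k)^(-3/2),
    one for each coordinate, and Lam k >= |k_i| + 2. *)
Lemma Lam_powR_le (k : 'I_d -> int) (p : R) : k != 0 -> 3 * d%:R / 4 <= p ->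
  Lam k `^ (- (2 * p)) <= \prod_i psi `|k i|%N.
Proof.
move=> k0 pd.
have L0 := @Lam_gt0 R _ _ k0.
apply: (@le_trans _ _ (\prod_(i < d) (Num.sqrt (Lam k) ^+ 3)^-1)).
  rewrite prodr_const card_ord exprVn -exprM -powR12_sqrt ?Lam_ge0//.
  rewrite -powR_mulrn ?powR_ge0// -powRrM -powRN.
  rewrite ler_powR ?Lam_ge1// natrM; lra.
apply: ler_prod => i _; rewrite invr_ge0 exprn_ge0 ?sqrtr_ge0//=.
rewrite lef_pV2 ?posrE ?exprn_gt0 ?sqrtr_gt0 ?ltr0n//.
by rewrite lerXn2r ?nnegrE ?sqrtr_ge0// ler_wsqrtr// Lam_ge_coord.
Qed.

(** By distributivity the sum of products over the box is a product of d one-dimensional sums, each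
    at most 4 whatever N is. *)
Lemma lattice_sum_le N (p : R) : 3 * d%:R / 4 <= p ->
  \sum_(m : Box N | freq m != 0) Lam (freq m) `^ (- (2 * p)) <= 4 ^+ d.
Proof.
move=> pd.
apply: (@le_trans _ _ (\sum_(m : Box N) \prod_i psi `|freq m i|%N)).
  rewrite big_mkcond; apply: ler_sum => m _; case: ifPn => m0.
    exact: Lam_powR_le.
  by apply: prodr_ge0 => i _; exact: psi_ge0.
rewrite -(bigA_distr_bigA (fun _ (j : 'I_(N.*2.+1)) => psi `|j%:Z - N%:Z|%N))/=.
rewrite -[in leRHS](card_ord d) -prodr_const; apply: ler_prod => i _.
by rewrite sum_psi_le4 andbT sumr_ge0// => j _; exact: psi_ge0.
Qed.

End LatticeSum.

(** * L^2 bound for a product of two trigonometric sums *)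

Section ProductEstimate.
Context {R : realType} {d : nat}.
Local Notation T := (d.-tuple R).
Local Notation mu := (@torus_measure R d).
Local Notation Box N := {ffun 'I_d -> 'I_(N.*2.+1)}.
Implicit Types (k n : 'I_d -> int) (N M : nat) (f g : T -> R)
  (c s : ('I_d -> int) -> R) (i : 'I_d).

Lemma L2norm_field1 i f : L2norm (field1 i f) = Num.sqrt (ip mu f f).
Proof. by rewrite /L2norm inner_field1 /field1 eqxx. Qed.

Lemma field1D i f g : field1 i (f + g) = field1 i f + field1 i g.
Proof.
apply/funext => j; rewrite -[RHS]/(field1 i f j + field1 i g j) /field1.
by case: ifP => // _; rewrite addr0.
Qed.

Lemma field10 i : field1 i 0 = 0 :> vfield R d.
Proof. by apply/funext => j; rewrite /field1 if_same. Qed.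

Lemma field1_sum i I (r : seq I) (p : pred I) (F : I -> T -> R) :
  field1 i (\sum_(j <- r | p j) F j) = \sum_(j <- r | p j) field1 i (F j).
Proof. exact: (big_morph _ (field1D i) (field10 i)). Qed.

Definition coef_energy N (a : R) c s : R :=
  \sum_(m : Box N) Lam (freq m) `^ (2 * a) * (c (freq m) ^+ 2 + s (freq m) ^+ 2).

(** With P one of <= and <, this keeps the frequencies of one factor that dominate the frequency n
    of the other. *)
Definition keep (P : R -> R -> bool) n c : ('I_d -> int) -> R :=
  fun k => (P (Lam n) (Lam k))%:R * c k.

Lemma hermitian_keep P n c s : hermitian c s -> hermitian (keep P n c) (keep P n s).
Proof. by move=> [ce so]; split=> k; rewrite /keep LamN ?ce// so mulrN. Qed.

Lemma mode_le (a b : R) k x : `|(a *: cosk k + b *: sink k : T -> R) x| <= 2 * Num.sqrt (a ^+ 2 + b ^+ 2).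
Proof.
apply: le_trans (ler_normD _ _) _; rewrite mulr_natl mulr2n.
apply: lerD.
- rewrite [X in `|X| <= _](_ : _ = a * cosk k x)// normrM.
  apply: le_trans (ler_piMr (normr_ge0 _) (cosk_le1 k x)) _.
  by rewrite -sqrtr_sqr ler_wsqrtr// lerDl sqr_ge0.
- rewrite [X in `|X| <= _](_ : _ = b * sink k x)// normrM.
  apply: le_trans (ler_piMr (normr_ge0 _) (sink_le1 k x)) _.
  by rewrite -sqrtr_sqr ler_wsqrtr// lerDr sqr_ge0.
Qed.

Lemma measurable_mode (a b : R) k : measurable_fun setT (a *: cosk k + b *: sink k : T -> R).
Proof. exact: Lfun2_measurable (mode_Lfun a b k). Qed.

(* Only frequencies at least as large as n survive in the truncated sum, so
   each of them can afford the weight Lam n ^ b. *)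
Lemma norm_keep_le i (P : R -> R -> bool) n N (b : R) c s :
  (forall x y, P x y -> x <= y) -> hermitian c s -> 0 <= b -> n != 0 ->
  L2norm (field1 i (tp N (keep P n c) (keep P n s))) <=
  Lam n `^ (- b) * Num.sqrt (coef_energy N b c s).
Proof.
move=> Ple cs b0 n0; have L0 := @Lam_gt0 R _ _ n0.
rewrite L2norm_field1 ip_tp_tp; last exact: hermitian_keep.
rewrite -[X in X * _]ger0_norm ?powR_ge0// -sqrtr_sqr -sqrtrM ?sqr_ge0//.
apply: ler_wsqrtr; rewrite powR_sqr mulr_sumr; apply: ler_sum => m _.
rewrite /keep !exprMn -mulrDr; case: (boolP (P _ _)) => [/Ple le|_]; last first.
  by rewrite expr0n mul0r !mulr_ge0 ?powR_ge0 ?addr_ge0 ?sqr_ge0.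
rewrite expr1n mul1r mulrA ler_peMl ?addr_ge0 ?sqr_ge0//.
rewrite mulrN powRN mulrC ler_pdivlMr ?powR_gt0// mul1r.
by rewrite ge0_ler_powR ?nnegrE ?Lam_ge0 ?mulr_ge0.
Qed.

(** Triangle inequality over the modes of the first factor: mode k costs twice its amplitude in sup
    norm, and the surviving part of the other factor gains (Lam k)^(-b). Cauchy-Schwarz then
    separates (Lam k)^a times the amplitude from (Lam k)^(-(a+b)). *)
Lemma half_product i (P : R -> R -> bool) N (a b : R) c s c' s' :
  (forall x y, P x y -> x <= y) -> hermitian c' s' -> c 0 = 0 -> s 0 = 0 -> 0 <= b ->
  3 * d%:R / 4 <= a + b ->
  L2norm (field1 i (\sum_(m : Box N) (fun x : T =>
    (c (freq m) *: cosk (freq m) + s (freq m) *: sink (freq m) : T -> R) x *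
    tp N (keep P (freq m) c') (keep P (freq m) s') x))) <=
  2 * Num.sqrt (4 ^+ d) * (Num.sqrt (coef_energy N a c s) * Num.sqrt (coef_energy N b c' s')).
Proof.
move=> Ple cs' c0 s0 b0 abd; rewrite field1_sum.
have lF (m : Box N) := Lfun2_mul_bounded (measurable_mode (c (freq m)) (s (freq m)) (freq m))
  (mode_le (c (freq m)) (s (freq m)) (freq m))
  (tp_Lfun N (keep P (freq m) c') (keep P (freq m) s')).
apply: le_trans; first by apply: L2norm_sum => m _; exact: L2_field1 (lF m).
set B := Num.sqrt (coef_energy N b c' s').
pose x (m : Box N) : R := Lam (freq m) `^ a * Num.sqrt (c (freq m) ^+ 2 + s (freq m) ^+ 2).
(* The value 0 at frequency 0 matches the lattice sum over nonzero k; the amplitude there vanishes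
   by c 0 = s 0 = 0. *)
pose y (m : Box N) : R := if freq m != 0 then Lam (freq m) `^ (- (a + b)) else 0.
apply: (@le_trans _ _ (\sum_(m : Box N) 2 * B * (x m * y m))).
  apply: ler_sum => m _; rewrite L2norm_field1.
  apply: (@le_trans _ _ (2 * Num.sqrt (c (freq m) ^+ 2 + s (freq m) ^+ 2) *
     L2norm (field1 i (tp N (keep P (freq m) c') (keep P (freq m) s'))))).
    rewrite !L2norm_field1.
    rewrite -[X in _ <= X * _]ger0_norm ?mulr_ge0 ?sqrtr_ge0// -sqrtr_sqr -sqrtrM ?sqr_ge0//.
    apply: ler_wsqrtr; apply: le_ip_sqr; [exact: measurable_mode|exact: mode_le|exact: tp_Lfun].
  have [m0|m0] := eqVneq (freq m) 0.
    by rewrite /y m0 eqxx /= c0 s0 expr0n addr0 sqrtr0 !mulr0 mul0r.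
  apply: le_trans (ler_wpM2l _ (norm_keep_le i N Ple cs' b0 m0)) _.
    by rewrite mulr_ge0// sqrtr_ge0.
  rewrite /y /x m0 -/B opprD powRD; last first.
    by apply/implyP => _; rewrite gt_eqF// Lam_gt0.
  rewrite le_eqVlt; apply/orP; left; apply/eqP.
  rewrite !powRN; field.
  by rewrite !gt_eqF ?powR_gt0 ?Lam_gt0.
rewrite -mulr_sumr.
apply: le_trans (ler_wpM2l _ (sum_cauchy_schwarz _ _ _ _)) _.
  by rewrite mulr_ge0// sqrtr_ge0.
have -> : \sum_m x m ^+ 2 = coef_energy N a c s.
  apply: eq_bigr => m _; rewrite /x exprMn powR_sqr sqr_sqrtr//.
  by rewrite addr_ge0// sqr_ge0.
have yl : Num.sqrt (\sum_m y m ^+ 2) <= Num.sqrt (4 ^+ d).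
  apply: ler_wsqrtr; apply: le_trans (lattice_sum_le N abd); rewrite [leRHS]big_mkcond/=.
  apply: ler_sum => m _; rewrite /y; case: ifP => _; last by rewrite expr0n.
  by rewrite powR_sqr mulrN.
apply: (@le_trans _ _ (2 * B * (Num.sqrt (coef_energy N a c s) * Num.sqrt (4 ^+ d)))).
  by rewrite ler_wpM2l ?mulr_ge0 ?sqrtr_ge0// ler_wpM2l ?sqrtr_ge0.
by rewrite le_eqVlt; apply/orP; left; apply/eqP; ring.
Qed.

Lemma product_est i N (a b : R) c s c' s' :
  hermitian c s -> hermitian c' s' -> c 0 = 0 -> s 0 = 0 -> c' 0 = 0 -> s' 0 = 0 ->
  0 <= a -> 0 <= b -> 3 * d%:R / 4 <= a + b ->
  L2norm (field1 i (fun x => tp N c s x * tp N c' s' x)) <=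
  4 * Num.sqrt (4 ^+ d) * (Num.sqrt (coef_energy N a c s) * Num.sqrt (coef_energy N b c' s')).
Proof.
move=> cs cs' c0 s0 c0' s0' a0 b0 abd.
pose F c s (m : Box N) x : R := (c (freq m) *: cosk (freq m) + s (freq m) *: sink (freq m) : T -> R) x.
have FE c1 s1 x : tp N c1 s1 x = \sum_m F c1 s1 m x by rewrite tpE.
have keepE P (m : Box N) c1 s1 x : tp N (keep P (freq m) c1) (keep P (freq m) s1) x =
    \sum_(n : Box N) (P (Lam (freq m)) (Lam (freq n)))%:R * F c1 s1 n x.
  by rewrite tpE; apply: eq_bigr => n _; rewrite /keep mulrDr !mulrA.
(* Large inequality in one half and strict inequality in the other, so that pairs of frequencies of
   equal size are counted once. *)
set h1 := \sum_(m : Box N) (fun x : T => F c s m x * tp N (keep <=%R (freq m) c') (keep <=%R (freq m) s') x).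
set h2 := \sum_(m : Box N) (fun x : T => F c' s' m x * tp N (keep <%R (freq m) c) (keep <%R (freq m) s) x).
have -> : (fun x => tp N c s x * tp N c' s' x) = h1 + h2.
  apply/funext => x; rewrite -[RHS]/(h1 x + h2 x) /h1 /h2 !fct_sumE !FE mulr_suml.
  under [in RHS]eq_bigr do rewrite keepE mulr_sumr.
  under [X in _ = _ + X]eq_bigr do rewrite keepE mulr_sumr.
  rewrite [X in _ = _ + X]exchange_big/= -big_split/=; apply: eq_bigr => m _.
  rewrite mulr_sumr -big_split/=; apply: eq_bigr => n _.
  by rewrite ltNge; case: (Lam (freq m) <= Lam (freq n))%R => /=; ring.
rewrite field1D.
have lh (P : R -> R -> bool) c1 s1 c2 s2 : L2 (field1 i (\sum_(m : Box N) (fun x : T =>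
    F c1 s1 m x * tp N (keep P (freq m) c2) (keep P (freq m) s2) x))).
  apply: L2_field1; apply: Lfun2_sum => m _.
  apply: Lfun2_mul_bounded; [exact: measurable_mode|exact: mode_le|exact: tp_Lfun].
apply: le_trans (L2normD (lh _ _ _ _ _) (lh _ _ _ _ _)) _.
have e1 := half_product i N (P := <=%R) (fun _ _ => id) cs' c0 s0 b0 abd.
have bad : 3 * d%:R / 4 <= b + a by rewrite addrC.
have e2 := half_product i N (P := <%R) (@ltW _ _) cs c0' s0' a0 bad.
apply: le_trans (lerD e1 e2) _.
by rewrite le_eqVlt; apply/orP; left; apply/eqP; ring.
Qed.

End ProductEstimate.

(** * The advection term of truncated fields *)

Section AdvectionEstimate.
Context {R : realType} {d : nat}.
Local Notation T := (d.-tuple R).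
Local Notation mu := (@torus_measure R d).
Local Notation Box N := {ffun 'I_d -> 'I_(N.*2.+1)}.
Implicit Types (k n : 'I_d -> int) (N M : nat) (g h u v w phi : vfield R d) (i j : 'I_d).

Lemma trunc_tp g N i : trunc g N i = tp N (ac (g i)) (bs (g i)).
Proof.
rewrite /trunc fraclap_sumE mulr0; congr tp; apply/funext => k;
by rewrite powRr0 mul1r.
Qed.

Lemma field_sum_components g : g = \sum_i field1 i (g i).
Proof.
have E (r : seq 'I_d) j : (\sum_(i <- r) field1 i (g i)) j = \sum_(i <- r) (field1 i (g i) j).
  elim/big_rec2 : _ => //= i a b _ <-; by [].
apply/funext => j; rewrite E (bigD1 j)//= {1}/field1 eqxx big1 ?addr0// => i ij.
by rewrite /field1 eq_sym (negbTE ij).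
Qed.

Lemma tp_bounded N (c s : ('I_d -> int) -> R) : exists B : R, forall x : T, `|tp N c s x| <= B.
Proof.
exists (\sum_(m : Box N) 2 * Num.sqrt (c (freq m) ^+ 2 + s (freq m) ^+ 2)) => x.
rewrite tpE; apply: le_trans (ler_norm_sum _ _ _) _; apply: ler_sum => m _.
exact: mode_le.
Qed.

Lemma tp_mul_Lfun N (c s c' s' : ('I_d -> int) -> R) :
  (fun x : T => tp N c s x * tp N c' s' x) \in Lfun mu 2%:E.
Proof.
have [B hB] := tp_bounded N c s.
exact: Lfun2_mul_bounded (Lfun2_measurable (tp_Lfun N c s)) hB (tp_Lfun N c' s').
Qed.

Lemma partial_trunc g N i j : partial j (trunc g N i) =
  tp N (fun k => 2 * pi * (k j)%:~R * bs (g i) k) (fun k => - (2 * pi * (k j)%:~R * ac (g i) k)).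
Proof. by rewrite trunc_tp partial_tp. Qed.

Lemma L2_advect_trunc g h N : L2 (advect (trunc g N) (trunc h N)).
Proof.
move=> i; rewrite /advect.
rewrite (_ : (fun x => _) = \sum_(j < d) (fun x => trunc g N j x * partial j (trunc h N i) x)).
  by apply: Lfun2_sum => j _; rewrite partial_trunc trunc_tp; exact: tp_mul_Lfun.
by apply/funext => x; rewrite fct_sumE.
Qed.

(** There are d * d scalar products, one for each component and direction. The derivative uses up
    one power of Lam, so h enters [product_est] with weight b - 1. *)
Lemma advect_trunc_le g h N (a b : R) : divfree g -> divfree h -> 0 <= a -> 1 <= b ->
  3 * d%:R / 4 <= a + b - 1 ->
  L2norm (advect (trunc g N) (trunc h N)) <=
  d%:R * d%:R * (4 * Num.sqrt (4 ^+ d)) * (Num.sqrt (Q a g N) * Num.sqrt (Q b h N)).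
Proof.
move=> [lg g0 _ _] [lh h0 _ _] a0 b1 abd.
pose p (i j : 'I_d) (x : T) := trunc g N j x * partial j (trunc h N i) x.
have -> : advect (trunc g N) (trunc h N) = \sum_i \sum_j field1 i (p i j).
  rewrite [LHS]field_sum_components; apply: eq_bigr => i _.
  rewrite -field1_sum; congr field1; apply/funext => x; by rewrite fct_sumE.
have lp i j : L2 (field1 i (p i j)).
  by apply: L2_field1; rewrite /p partial_trunc trunc_tp; exact: tp_mul_Lfun.
apply: le_trans; first by apply: L2norm_sum => i _; apply: L2_sum => j _; exact: lp.
apply: (@le_trans _ _ (\sum_(i < d) \sum_(j < d)
   4 * Num.sqrt (4 ^+ d) * (Num.sqrt (Q a g N) * Num.sqrt (Q b h N)))); last first.
  have E (X : R) : \sum_(i < d) \sum_(j < d) X = d%:R * d%:R * X.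
    by rewrite !sumr_const !card_ord -mulrA !mulr_natl.
  by rewrite E !mulrA.
apply: ler_sum => i _; apply: le_trans; first by apply: L2norm_sum => j _; exact: lp.
apply: ler_sum => j _; rewrite /p partial_trunc trunc_tp.
have hg : hermitian (ac (g j)) (bs (g j)).
  by split=> k; rewrite ?acN// bsN//; exact: (lg j).
have hh : hermitian (fun k => 2 * pi * (k j)%:~R * bs (h i) k)
    (fun k => - (2 * pi * (k j)%:~R * ac (h i) k)).
  split=> k; rewrite -[(- k) j]/(- (k j)) rmorphN ?acN ?bsN; try exact: (lh i); by ring.
have b0 : 0 <= b - 1 by rewrite subr_ge0.
have abd' : 3 * d%:R / 4 <= a + (b - 1) by rewrite addrA.
apply: le_trans (product_est i N hg hh (g0 j) (bs0 _) _ _ a0 b0 abd') _.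
- by rewrite bs0 mulr0.
- by rewrite h0 mulr0 oppr0.
rewrite ler_wpM2l ?mulr_ge0 ?sqrtr_ge0//; apply: ler_pM; rewrite ?sqrtr_ge0//.
- apply: ler_wsqrtr; apply: ler_sum => m _; rewrite ler_wpM2l ?powR_ge0//.
  rewrite /pw (bigD1 j)//= lerDl sumr_ge0// => k _; by rewrite addr_ge0 ?sqr_ge0.
- apply: ler_wsqrtr; apply: ler_sum => m _.
  (* Powers of Lam can be added only where Lam is positive; at frequency 0 the coefficients
     vanish. *)
  have [m0|m0] := eqVneq (freq m) 0.
    rewrite m0 bs0 h0 !mulr0 oppr0 expr0n addr0 mulr0.
    by rewrite mulr_ge0 ?powR_ge0 ?pw_ge0.
  apply: (@le_trans _ _ (Lam (freq m) `^ (2 * (b - 1)) *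
    (Lam (freq m) ^+ 2 * (ac (h i) (freq m) ^+ 2 + bs (h i) (freq m) ^+ 2)))).
    rewrite ler_wpM2l ?powR_ge0// sqrrN !exprMn -mulrDr (addrC (bs _ _ ^+ 2)).
    apply: ler_wpM2r; first by rewrite addr_ge0 ?sqr_ge0.
    apply: ler_wpM2l; first by rewrite mulr_ge0 ?sqr_ge0.
    by rewrite normk_sqr (bigD1 j)//= lerDl sumr_ge0// => k _; exact: sqr_ge0.
  rewrite mulrA -powR_mulrn ?Lam_ge0// -powRD; last first.
    by apply/implyP => _; rewrite gt_eqF// Lam_gt0.
  rewrite (_ : 2 * (b - 1) + 2%:R = 2 * b); last by rewrite mulrBr mulr1 subrK.
  rewrite ler_wpM2l ?powR_ge0// /pw (bigD1 i)//= lerDl sumr_ge0// => k _; by rewrite addr_ge0 ?sqr_ge0.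
Qed.

(** Every term on the right contains u - v exactly once, the other factor being u or v, whose
    V^alpha norms are under control. *)
Lemma advect_truncB u v N : L2 u -> L2 v ->
  advect (trunc u N) (trunc u N) - advect (trunc v N) (trunc v N) =
  advect (trunc (u - v) N) (trunc u N) + advect (trunc v N) (trunc (u - v) N).
Proof.
move=> lu lv; apply/funext => i; apply/funext => x.
rewrite -[LHS]/(advect (trunc u N) (trunc u N) i x - advect (trunc v N) (trunc v N) i x).
rewrite -[RHS]/(advect (trunc (u - v) N) (trunc u N) i x + advect (trunc v N) (trunc (u - v) N) i x).
rewrite /advect -sumrB -big_split/=; apply: eq_bigr => j _.
have -> : partial j (trunc (u - v) N i) x = partial j (trunc u N i) x - partial j (trunc v N i) x.
  rewrite !partial_trunc !tpE -sumrB; apply: eq_bigr => m _.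
  by rewrite acB// bsB//; ring.
rewrite truncB// -[(trunc u N - trunc v N) j x]/(trunc u N j x - trunc v N j x).
have E (a b p q : R) : a * p - b * q = (a - b) * p + b * (p - q) by ring.
exact: E.
Qed.

End AdvectionEstimate.

(** * Weighted Young inequality with real exponents *)

Section YoungInequality.
Context {R : realType}.

(** With B = (A/eps)^(1/theta) the claim is B^theta t^(1-theta) <= t + B, and the weighted geometric
    mean is at most the larger of t and B. *)
Lemma young_powR (A eps t theta : R) : 0 <= A -> 0 < eps -> 0 <= t -> 0 < theta ->
  theta <= 1 ->
  A * t `^ (1 - theta) <= eps * t + eps * (A / eps) `^ (1 / theta).
Proof.
move=> A0 e0 t0 th0 th1; set B := (A / eps) `^ (1 / theta).
have Ae0 : 0 <= A / eps by rewrite divr_ge0// ltW.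
have B0 : 0 <= B by exact: powR_ge0.
have BA : B `^ theta = A / eps by rewrite -powRrM mul1r mulVf ?gt_eqF// powRr1.
have th1' : 0 <= 1 - theta by rewrite subr_ge0.
have -> : A = eps * B `^ theta by rewrite BA mulrC divfK// gt_eqF.
rewrite -mulrA -mulrDr ler_pM2l//.
have key x : 0 <= x -> x `^ theta * x `^ (1 - theta) = x.
  by move=> x0; rewrite -powRD addrC subrK ?powRr1// oner_eq0.
have [tB|/ltW Bt] := leP t B.
  apply: (@le_trans _ _ (B `^ theta * B `^ (1 - theta))).
    by rewrite ler_wpM2l ?powR_ge0// ge0_ler_powR.
  by rewrite key// lerDr.
apply: (@le_trans _ _ (t `^ theta * t `^ (1 - theta))).
  by rewrite ler_wpM2r ?powR_ge0// ge0_ler_powR ?nnegrE// ltW.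
by rewrite key// lerDl.
Qed.

End YoungInequality.

(** * The energy inequality at a fixed time *)

Section EnergyInequality.
Context {R : realType} {d : nat}.
Local Notation T := (d.-tuple R).
Local Notation mu := (@torus_measure R d).
Local Notation Box N := {ffun 'I_d -> 'I_(N.*2.+1)}.
Implicit Types (k n : 'I_d -> int) (N M : nat) (g h u v w phi p : vfield R d) (i j : 'I_d).

Lemma is_lerayB g g' p p' : is_leray g p -> is_leray g' p' -> is_leray (g - g') (p - p').
Proof.
move=> [lg Hp gp] [lg' Hp' gp']; split; [exact: L2B|exact: HB|move=> phi Hphi].
have [[lp lp'] lphi] := (H_L2 Hp, H_L2 Hp', H_L2 Hphi).
have := gp _ Hphi; have := gp' _ Hphi.
rewrite !innerBl//; try exact: L2B.
move: (inner g phi) (inner g' phi) (inner p phi) (inner p' phi) => a b c e; lra.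
Qed.

Lemma leray_norm_le g p : is_leray g p -> L2norm p <= L2norm g.
Proof.
move=> [lg Hp gp]; have lp := H_L2 Hp.
have := gp _ Hp; rewrite innerBl// => /eqP; rewrite subr_eq0 => /eqP e.
have := inner_cauchy_schwarz lg lp; rewrite e -L2norm_sqr expr2.
have [-> _|p0] := eqVneq (L2norm p) 0; first exact: L2norm_ge0.
by rewrite ler_pM2r// lt0r p0 L2norm_ge0.
Qed.

Lemma Vnorm_sub_trunc_near (s r : R) g w : is_fraclap (s / 2) g w -> 0 < r ->
  \forall N \near \oo, (Vnorm s (g - trunc g N) < r%:E)%E.
Proof.
move=> fl r0; have [_ _ cv] := fl.
have /cvgrPdist_lt /(_ _ r0) := cv; apply: filterS => N.
by rewrite sub0r normrN ger0_norm ?L2norm_ge0// (Vnorm_sub_trunc N fl) lte_fin.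
Qed.

(** B is defined by continuity from trigonometric fields; truncations serve as approximants, and the
    Leray projection does not increase the norm, so a bound uniform in N survives. *)
Lemma B_diff_le (s M : R) u v wu wv bu bv :
  is_fraclap (s / 2) u wu -> is_fraclap (s / 2) v wv ->
  is_B s u u bu -> is_B s v v bv ->
  (forall N, L2norm (advect (trunc u N) (trunc u N) - advect (trunc v N) (trunc v N)) <= M) ->
  L2norm (bu - bv) <= M.
Proof.
move=> flu flv [[Hu _] _ Hbu apu] [[Hv _] _ Hbv apv] advM.
apply/ler_addgt0Pr => e e0; have e20 : 0 < e / 2 by rewrite divr_gt0.
have [ru ru0 hu] := apu _ e20; have [rv rv0 hv] := apv _ e20.
near \oo => N.
have uN : (Vnorm s (u - trunc u N) < ru%:E)%E.
  by near: N; exact: Vnorm_sub_trunc_near flu ru0.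
have vN : (Vnorm s (v - trunc v N) < rv%:E)%E.
  by near: N; exact: Vnorm_sub_trunc_near flv rv0.
have Vu := Vtrig_fraclap_sum 0 N (H_divfree Hu).
have Vv := Vtrig_fraclap_sum 0 N (H_divfree Hv).
have [pu lepu dpu] := hu _ _ Vu Vu uN uN.
have [pv lepv dpv] := hv _ _ Vv Vv vN vN.
have le1 := le_trans (leray_norm_le (is_lerayB lepu lepv)) (advM N).
have [_ Hpu _] := lepu; have [_ Hpv _] := lepv.
have [[lpu lpv] [lbu lbv]] := ((H_L2 Hpu, H_L2 Hpv), (H_L2 Hbu, H_L2 Hbv)).
have -> : bu - bv = (pu - pv) - ((pu - bu) - (pv - bv)).
  by rewrite opprB addrA subrKA opprB addrC subrKA.
apply: le_trans (L2normB (L2B lpu lpv) (L2B (L2B lpu lbu) (L2B lpv lbv))) _.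
apply: lerD le1 _.
apply: le_trans (L2normB (L2B lpu lbu) (L2B lpv lbv)) _.
by rewrite (splitr e); exact: lerD (ltW dpu) (ltW dpv).
Unshelve. all: by end_near. Qed.

Definition Kadv : R := d%:R * d%:R * (4 * Num.sqrt (4 ^+ d)).

Lemma Kadv_ge0 : 0 <= Kadv.
Proof. by rewrite !mulr_ge0 ?sqrtr_ge0. Qed.

Context (alpha : R) (halpha : d%:R / 4 + 1 / 2 <= alpha) (hd2 : (2 <= d)%N).

Let d2 : 2 <= d%:R :> R. Proof. by rewrite ler_nat. Qed.

Let alpha1 : 1 <= alpha.
Proof. by apply: le_trans halpha; move: d2; move: (d%:R : R) => D D2; lra. Qed.

Let d0 : 0 <= d%:R / 4 :> R. Proof. by rewrite divr_ge0. Qed.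

(** Equivalent to 3d/4 <= alpha + (alpha + d/4) - 1, the exponent condition of [advect_trunc_le]; it
    also gives theta > 0. *)
Let dalpha : d%:R <= 4 * alpha - 2.
Proof. by move: halpha; move: (d%:R : R) => D D2; lra. Qed.

Lemma sqrt_Q_le (sigma : R) g N : (Vnorm alpha g <= sigma%:E)%E ->
  Num.sqrt (Q alpha g N) <= sigma.
Proof.
move=> /Vnorm_le_fraclap[w fl ws]; apply: le_trans ws.
rewrite -[leRHS]ger0_norm ?L2norm_ge0// -sqrtr_sqr; apply: ler_wsqrtr.
by have := Q_le_fraclap N fl; rewrite mul2div2.
Qed.

Lemma advect_diff_le (sigma : R) u v N : divfree u -> divfree v ->
  (Vnorm alpha u <= sigma%:E)%E -> (Vnorm alpha v <= sigma%:E)%E ->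
  L2norm (advect (trunc u N) (trunc u N) - advect (trunc v N) (trunc v N)) <=
  2 * Kadv * sigma * Num.sqrt (Q (alpha + d%:R / 4) (u - v) N).
Proof.
move=> du dv us vs; have [[lu _ _ _] [lv _ _ _]] := (du, dv).
rewrite advect_truncB//.
apply: le_trans (L2normD (L2_advect_trunc _ _ _) (L2_advect_trunc _ _ _)) _.
have dw := divfreeB du dv.
have a0 : 0 <= alpha by exact: le_trans alpha1.
have b0 : 0 <= alpha + d%:R / 4 by rewrite addr_ge0.
have b1 : 1 <= alpha + d%:R / 4 by rewrite ler_wpDr.
have c1 : 3 * d%:R / 4 <= alpha + d%:R / 4 + alpha - 1.
  by move: dalpha; move: (d%:R : R) => D D2; lra.
have c2 : 3 * d%:R / 4 <= alpha + (alpha + d%:R / 4) - 1.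
  by move: dalpha; move: (d%:R : R) => D D2; lra.
have e1 := advect_trunc_le N dw du b0 alpha1 c1.
have e2 := advect_trunc_le N dv dw a0 b1 c2.
apply: le_trans (lerD e1 e2) _; rewrite -/Kadv.
set q := Num.sqrt (Q (alpha + d%:R / 4) (u - v) N).
have q0 : 0 <= q by exact: sqrtr_ge0.
have qu := sqrt_Q_le N us; have qv := sqrt_Q_le N vs.
have Kq0 : 0 <= Kadv * q by rewrite mulr_ge0// Kadv_ge0.
apply: (@le_trans _ _ (Kadv * q * sigma + Kadv * q * sigma)).
  apply: lerD.
    by rewrite mulrA; apply: ler_wpM2l.
  by rewrite (mulrC (Num.sqrt _)) mulrA; apply: ler_wpM2l.
by rewrite le_eqVlt; apply/orP; left; apply/eqP; ring.
Qed.

(** As (1 - theta) alpha = d/4, the space V^{alpha + d/4} sits at parameter 1 - theta between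
    V^alpha and V^{2 alpha}. *)
Let theta : R := 1 - d%:R / (4 * alpha).

Let theta_bound : 0 < theta /\ theta <= 1.
Proof.
have a0 : 0 < 4 * alpha by rewrite mulr_gt0// (lt_le_trans _ alpha1).
split; first by rewrite /theta subr_gt0 ltr_pdivrMr// mul1r (le_lt_trans dalpha)// ltrBlDr ltrDl.
by rewrite /theta lerBlDr lerDl divr_ge0// ltW.
Qed.

(** The last term of [young_powR] for A = (2 Kadv sigma)^2, with the factor sigma^(2/theta) taken
    out. *)
Definition Cyoung (eps : R) : R := eps * ((2 * Kadv) ^+ 2 / eps) `^ (1 / theta).

Lemma Cyoung_ge0 eps : 0 < eps -> 0 <= Cyoung eps.
Proof. by move=> e0; rewrite mulr_ge0 ?powR_ge0// ltW. Qed.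

Lemma Q_interpolation (sigma eps : R) w N : 0 <= sigma -> 0 < eps ->
  (2 * Kadv * sigma) ^+ 2 * Q (alpha + d%:R / 4) w N <=
  eps * Q (2 * alpha) w N + Cyoung eps * sigma `^ (2 / theta) * Q alpha w N.
Proof.
move=> s0 e0; rewrite !mulr_sumr -big_split/=; apply: ler_sum => m _.
rewrite (mulrA (_ ^+ 2)) (mulrA eps) (mulrA (Cyoung eps * _)) -mulrDl.
apply: ler_wpM2r; first exact: pw_ge0.
have [th0 th1] := theta_bound.
have a0 : 0 < alpha by exact: lt_le_trans alpha1.
(* At frequency 0 the weight on the left is 0, its exponent being nonzero. *)
have [m0|m0] := eqVneq (freq m) 0.
  rewrite m0 Lam0 powR0; last by rewrite mulf_neq0// gt_eqF// ltr_wpDr.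
  rewrite mulr0; apply: addr_ge0; apply: mulr_ge0; rewrite ?powR_ge0//; first exact: ltW.
  by rewrite mulr_ge0 ?powR_ge0 ?Cyoung_ge0.
have L0 := @Lam_gt0 R _ _ m0; set L := Lam (freq m).
(* In terms of t the three weights are t^(1-theta), t and 1, up to a common factor t: this is
   [young_powR]. *)
pose t := L `^ (2 * alpha).
have -> : L `^ (2 * (alpha + d%:R / 4)) = t * t `^ (1 - theta).
  rewrite -powRrM -powRD; last by apply/implyP => _; rewrite gt_eqF.
  by congr (_ `^ _); rewrite /theta; field; rewrite gt_eqF.
have -> : L `^ (2 * (2 * alpha)) = t * t.
  rewrite -powRD; last by apply/implyP => _; rewrite gt_eqF.
  by congr (_ `^ _); ring.
rewrite -/t mulrCA (mulrCA eps) (mulrC (Cyoung eps * _)) -mulrDr.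
rewrite ler_wpM2l ?powR_ge0//.
have A0 : 0 <= (2 * Kadv * sigma) ^+ 2 by exact: sqr_ge0.
apply: le_trans (young_powR A0 e0 (powR_ge0 _ _) th0 th1) _.
rewrite -/t lerD2l /Cyoung -[leRHS]mulrA; apply: ler_wpM2l; first exact: ltW.
have Ae0 : 0 <= (2 * Kadv) ^+ 2 / eps by rewrite divr_ge0 ?sqr_ge0// ltW.
rewrite exprMn mulrAC [in leLHS](powRM _ Ae0 (sqr_ge0 sigma)).
have -> : 2 / theta = 2%:R * (1 / theta) by rewrite mulrA mulr1.
by rewrite (powRrM sigma) powR_mulrn.
Qed.

Lemma B_diff_sqr_le (sigma eps X2 Z2 : R) u v Au Av Bu Bv : 0 <= sigma -> 0 < eps ->
  H u -> H v -> is_A alpha u Au -> is_A alpha v Av ->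
  is_B (2 * alpha) u u Bu -> is_B (2 * alpha) v v Bv ->
  (Vnorm alpha u <= sigma%:E)%E -> (Vnorm alpha v <= sigma%:E)%E ->
  (forall N, Q alpha (u - v) N <= X2) -> (forall N, Q (2 * alpha) (u - v) N <= Z2) ->
  L2norm (Bu - Bv) ^+ 2 <= eps * Z2 + Cyoung eps * sigma `^ (2 / theta) * X2.
Proof.
move=> s0 e0 Hu Hv [wu flu _] [wv flv _] isBu isBv us vs QX QZ.
set E := eps * Z2 + _.
have C0 : 0 <= Cyoung eps * sigma `^ (2 / theta).
  by rewrite mulr_ge0 ?powR_ge0// mulr_ge0 ?powR_ge0// ltW.
have QE N : (2 * Kadv * sigma) ^+ 2 * Q (alpha + d%:R / 4) (u - v) N <= E.
  apply: le_trans (Q_interpolation (u - v) N s0 e0) _; apply: lerD.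
  - by apply: ler_wpM2l; [exact: ltW|exact: QZ].
  - by apply: ler_wpM2l; [exact: C0|exact: QX].
have E0 : 0 <= E by apply: le_trans (QE 0%N); rewrite mulr_ge0 ?sqr_ge0 ?Q_ge0.
have Ks : 0 <= 2 * Kadv * sigma by rewrite !mulr_ge0 ?Kadv_ge0.
rewrite -[leRHS]sqr_sqrtr// lerXn2r ?nnegrE ?sqrtr_ge0 ?L2norm_ge0//.
have e : 2 * alpha / 2 = alpha by field.
rewrite -e in flu flv.
apply: (B_diff_le flu flv isBu isBv) => N.
apply: le_trans (advect_diff_le N (H_divfree Hu) (H_divfree Hv) us vs) _.
rewrite -[X in X * _]ger0_norm// -sqrtr_sqr -sqrtrM ?sqr_ge0//.
by apply: ler_wsqrtr; exact: QE.
Qed.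

(** The Leray projection inside A disappears against a divergence-free test field. *)
Lemma inner_A g a w N : is_A alpha g a -> divfree w ->
  inner a (fraclap_sum alpha w N) = \sum_(m : Box N) Lam (freq m) `^ (2 * alpha) *
    \sum_i (ac (w i) (freq m) * (Lam (freq m) `^ (2 * alpha) * ac (g i) (freq m)) +
            bs (w i) (freq m) * (Lam (freq m) `^ (2 * alpha) * bs (g i) (freq m))).
Proof.
move=> [b fl [lb Ha le]] dw; have la := H_L2 Ha.
have VS := Vtrig_fraclap_sum alpha N dw.
have /eqP := le _ (Vtrig_H VS); rewrite innerBl//; last exact: Vtrig_L2.
rewrite subr_eq0 => /eqP <-; rewrite innerC inner_fraclap_sum//.
apply: eq_bigr => m _; congr (_ * _); apply: eq_bigr => i _.
by rewrite (ac_fraclap _ _ fl) (bs_fraclap _ _ fl).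
Qed.

Lemma inner_A_diff u v Au Av N : H u -> H v -> is_A alpha u Au -> is_A alpha v Av ->
  inner (Au - Av) (fraclap_sum alpha (u - v) N) = Q (2 * alpha) (u - v) N.
Proof.
move=> Hu Hv Au_ Av_.
have [lu lv] := (H_L2 Hu, H_L2 Hv).
have [_ _ [_ HAu _]] := Au_; have [_ _ [_ HAv _]] := Av_.
rewrite innerBl; [|exact: H_L2|exact: H_L2|exact: L2_fraclap_sum].
have dw := divfreeB (H_divfree Hu) (H_divfree Hv).
rewrite (inner_A N Au_ dw) (inner_A N Av_ dw) -sumrB; apply: eq_bigr => m _.
rewrite -mulrBr -sumrB -[in RHS]powR_sqr expr2 -mulrA; congr (_ * _).
rewrite [RHS]mulr_sumr; apply: eq_bigr => i _; rewrite acB// bsB//; ring.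
Qed.

Lemma inner_fraclap_half w N : L2 w ->
  inner w (fraclap_sum alpha w N) = Q alpha w N.
Proof.
by move=> lw; rewrite innerC inner_fraclap_sum//; exact: eq_bigr.
Qed.

(** The interpolation estimate at s = 0. It bounds a field z that represents the Fourier series of I
    w - w; z and I w - w have the same coefficients, hence the same pairing with the truncated test
    field. The number r is the norm of z. *)
Lemma interpolant_inner (c0 h X2 : R) (I : vfield R d -> vfield R d) w w2 p N :
  interpolant alpha c0 h I -> 0 < c0 -> H w ->
  is_fraclap (alpha / 2) w w2 -> L2norm w2 ^+ 2 <= X2 -> is_leray (I w) p ->
  exists2 r, r ^+ 2 <= c0 * h ^+ 2 * X2 &
    `|inner p (fraclap_sum alpha w N) - Q alpha w N| <= r * Num.sqrt (Q (2 * alpha) w N).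
Proof.
move=> [[IL2 _ _] Iest] c00 Hw fl wX [lI Hp le]; have lw := H_L2 Hw.
have Vw : V alpha w := V_of_fraclap Hw fl.
have Vw0 : V (0 + alpha) w by rewrite add0r.
have := Iest 0 w (lexx _) Vw0; rewrite add0r (VnormE fl) -EFin_expe -EFinM => est.
have [z flz] : exists z, is_fraclap (0 / 2) (I w - w) z.
  apply: Vnorm_lty; rewrite ltey; apply/eqP => h0; move: est.
  by rewrite h0 expe2 mulyy leye_eq.
move: est; rewrite (VnormE flz) -EFin_expe lee_fin => est.
exists (L2norm z).
  by apply: le_trans est _; rewrite ler_wpM2l// mulr_ge0 ?sqr_ge0// ltW.
have VS := Vtrig_fraclap_sum alpha N (H_divfree Hw).
have lS := Vtrig_L2 VS; have lp := H_L2 Hp.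
have /eqP := le _ (Vtrig_H VS); rewrite innerBl// subr_eq0 => /eqP <-.
rewrite -inner_fraclap_half// -innerBl//.
have [lIw lz _] := flz.
have -> : inner (I w - w) (fraclap_sum alpha w N) = inner z (fraclap_sum alpha w N).
  rewrite !(innerC _ (fraclap_sum _ _ _)) !inner_fraclap_sum//.
  apply: eq_bigr => m _; congr (_ * _); apply: eq_bigr => i _.
  by rewrite (ac_fraclap _ _ flz) (bs_fraclap _ _ flz) mul0r mulr0 powRr0 !mul1r.
apply: le_trans (inner_cauchy_schwarz_norm lz lS) _.
by rewrite {2}/L2norm inner_fraclap_sum_sqr.
Qed.

Lemma young2 (x y k : R) : 0 < k -> 2 * (x * y) <= k^-1 * x ^+ 2 + k * y ^+ 2.
Proof.
move=> k0; rewrite -subr_ge0.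
have -> : k^-1 * x ^+ 2 + k * y ^+ 2 - 2 * (x * y) = k^-1 * (x - k * y) ^+ 2.
  by field; rewrite gt_eqF.
by rewrite mulr_ge0 ?sqr_ge0// invr_ge0 ltW.
Qed.

(** Young's inequality with weight nu/4 multiplies the squared norm of the nonlinear difference by
    4/nu; eps = nu^2/16 then turns its V^{2 alpha} part into nu/4. *)
Definition Cdecay (nu : R) : R := 4 / nu * Cyoung (nu ^+ 2 / 16).

(** X2 and Z2 bound the truncated norms at all levels, as the nonlinear and interpolation errors are
    not truncated. The losses in Z2 are nu/4 (size of the nonlinear difference), nu/4 (its Young
    partner) and nu (interpolation); those in X2 are m/2 (nonlinear) and m (interpolation). *)
Lemma energy_inequality (nu m c0 h sigma X2 Z2 : R) (I : vfield R d -> vfield R d)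
    f u v u' v' Au Av Bu Bv p N :
  0 < nu -> 0 < m -> 0 < c0 -> 0 < h -> 0 <= sigma -> interpolant alpha c0 h I ->
  L2 f -> H u -> H v -> H u' -> H v' ->
  is_A alpha u Au -> is_A alpha v Av ->
  is_B (2 * alpha) u u Bu -> is_B (2 * alpha) v v Bv -> is_leray (I (u - v)) p ->
  eq_field (u' + Bu + nu *: Au) f -> eq_field (v' + Bv + nu *: Av) (f + m *: p) ->
  (Vnorm alpha u <= sigma%:E)%E -> (Vnorm alpha v <= sigma%:E)%E ->
  m * h ^+ 2 * c0 <= nu -> Cdecay nu * sigma `^ (2 / theta) <= m / 2 ->
  (forall N, Q alpha (u - v) N <= X2) -> (forall N, Q (2 * alpha) (u - v) N <= Z2) ->
  2 * inner (u' - v') (fraclap_sum alpha (u - v) N) <=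
  3 / 2 * nu * Z2 - 2 * nu * Q (2 * alpha) (u - v) N +
  (3 / 2 * m * X2 - 2 * m * Q alpha (u - v) N).
Proof.
move=> nu0 m0 c00 h0 s0 Int lf Hu Hv Hu' Hv' Au_ Av_ Bu_ Bv_ lerp equ eqv us vs mh Cm QX QZ.
have Hw := HB Hu Hv; set w := u - v in Hw *; set S := fraclap_sum alpha w N.
have [_ Hp _] := lerp; have [_ _ HBu _] := Bu_; have [_ _ HBv _] := Bv_.
have [_ _ [_ HAu _]] := Au_; have [_ _ [_ HAv _]] := Av_.
have lS : L2 S := L2_fraclap_sum _ _ _.
have [[lu' lv'] lp] := (H_L2 Hu', H_L2 Hv', H_L2 Hp).
have [[lBu lBv] [lAu lAv]] := ((H_L2 HBu, H_L2 HBv), (H_L2 HAu, H_L2 HAv)).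
have lnAu := L2Z nu lAu; have lnAv := L2Z nu lAv; have lmp := L2Z m lp.
have eu : inner u' S = inner f S - inner Bu S - nu * inner Au S.
  have := eq_field_inner (L2D (L2D lu' lBu) lnAu) lf lS equ.
  rewrite innerDl//; [|exact: L2D]; rewrite innerDl// innerZl// => <-; ring.
have ev : inner v' S = inner f S + m * inner p S - inner Bv S - nu * inner Av S.
  have := eq_field_inner (L2D (L2D lv' lBv) lnAv) (L2D lf lmp) lS eqv.
  rewrite innerDl//; [|exact: L2D]; rewrite (innerDl lv' lBv lS) (innerDl lf lmp lS).
  rewrite !innerZl// => <-; ring.
have eA := inner_A_diff N Hu Hv Au_ Av_; rewrite -/w -/S innerBl// in eA.
have Bbound := B_diff_sqr_le s0 (divr_gt0 (exprn_gt0 2 nu0) (ltr0n R 16)) Hu Hv Au_ Av_ Bu_ Bv_ us vs QX QZ.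
have [wu flu _] := Vnorm_le_fraclap us; have [wv flv _] := Vnorm_le_fraclap vs.
have flw := is_fraclapB flu flv; rewrite -/w in flw.
have w2X : L2norm (wu - wv) ^+ 2 <= X2.
  have cv := Q_cvg_fraclap flw; rewrite -(cvg_lim _ cv)//.
  by apply: limr_le; [apply/cvg_ex; eexists; exact: cv|apply: nearW => n; rewrite mul2div2; exact: QX].
have [r r2 rI] := interpolant_inner N Int c00 Hw flw w2X lerp.
rewrite innerBl// eu ev.
set Y := Num.sqrt (Q (2 * alpha) w N) in rI.
have Y2 : Y ^+ 2 = Q (2 * alpha) w N by rewrite sqr_sqrtr// Q_ge0.
have YZ : Y ^+ 2 <= Z2 by rewrite Y2; exact: QZ.
have B1 : `|inner (Bu - Bv) S| <= L2norm (Bu - Bv) * Y.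
  apply: le_trans (inner_cauchy_schwarz_norm (L2B lBu lBv) lS) _.
  by rewrite {2}/L2norm inner_fraclap_sum_sqr//; exact: H_L2.
rewrite innerBl// in B1.
have nu4 : 0 < nu / 4 by rewrite divr_gt0.
have y1 := young2 (L2norm (Bu - Bv)) Y nu4.
(* With Young weight c0 h^2 the term in r^2 becomes at most X2, and the other one is absorbed by m
   h^2 c0 <= nu. *)
have kap : 0 < c0 * h ^+ 2 by rewrite mulr_gt0// exprn_gt0.
have y2 := young2 r Y kap.
have y2' : (c0 * h ^+ 2)^-1 * r ^+ 2 <= X2 by rewrite ler_pdivrMl.
have B2 : (nu / 4)^-1 * L2norm (Bu - Bv) ^+ 2 <= nu / 4 * Z2 + m / 2 * X2.
  have X20 : 0 <= X2 by apply: le_trans (QX 0%N); exact: Q_ge0.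
  apply: le_trans (ler_wpM2l _ Bbound) _; first by rewrite invr_ge0 ltW.
  rewrite mulrDr; apply: lerD.
    by rewrite le_eqVlt; apply/orP; left; apply/eqP; field; rewrite gt_eqF.
  apply: le_trans (ler_wpM2r X20 Cm); rewrite /Cdecay.
  by rewrite le_eqVlt; apply/orP; left; apply/eqP; field; rewrite gt_eqF.
have kZ : m * (c0 * h ^+ 2 * Y ^+ 2) <= nu * Z2.
  rewrite mulrA; apply: ler_pM => //; rewrite ?sqr_ge0//.
    by rewrite mulr_ge0// ltW.
  by rewrite (mulrC c0) mulrA.
have mr : 2 * (m * (r * Y)) <= m * X2 + nu * Z2.
  apply: (@le_trans _ _ (m * (2 * (r * Y)))); first by rewrite mulrCA.
  apply: le_trans (ler_wpM2l (ltW m0) y2) _; rewrite mulrDr; apply: lerD kZ.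
  by rewrite ler_wpM2l// ltW.
have mI : m * (Q alpha w N - inner p S) <= m * (r * Y).
  apply: ler_wpM2l; first exact: ltW.
  by apply: le_trans rI; rewrite distrC; exact: ler_norm.
have Bs : inner Bv S - inner Bu S <= L2norm (Bu - Bv) * Y.
  by apply: le_trans B1; rewrite distrC; exact: ler_norm.
have nZ : nu / 4 * Y ^+ 2 <= nu / 4 * Z2 by rewrite ler_wpM2l// ltW.
rewrite -eA.
move: (inner Bv S) (inner Bu S) (inner Au S) (inner Av S) (inner p S) (inner f S)
  (L2norm (Bu - Bv)) (Q alpha w N) Bs mI mr B2 y1 nZ => bv bu au av ps fs D q Bs mI mr B2 y1 nZ.
nra.
Qed.

End EnergyInequality.

(** * Integrability of real functions under algebraic operations *)

Section IntegrableReal.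
Context d (T : measurableType d) (R : realType) (mu : {measure set T -> \bar R}).
Context (D : set T) (mD : measurable D).
Implicit Types f g h : T -> R.

Lemma integrable_EFinZ (k : R) f : mu.-integrable D (EFin \o f) ->
  mu.-integrable D (EFin \o (fun x => k * f x)).
Proof. exact: integrableZl. Qed.

Lemma integrable_EFinD f g : mu.-integrable D (EFin \o f) -> mu.-integrable D (EFin \o g) ->
  mu.-integrable D (EFin \o (fun x => f x + g x)).
Proof. exact: integrableD. Qed.

Lemma integrable_EFinB f g : mu.-integrable D (EFin \o f) -> mu.-integrable D (EFin \o g) ->
  mu.-integrable D (EFin \o (fun x => f x - g x)).
Proof. exact: integrableB. Qed.

Lemma integrable_EFinM h f : measurable_fun D h -> [bounded h x | x in D] ->
  mu.-integrable D (EFin \o f) -> mu.-integrable D (EFin \o (fun x => h x * f x)).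
Proof. exact: integrableMr. Qed.

Lemma integrable_EFin_sum (I : Type) (r : seq I) (p : pred I) (F : I -> T -> R) :
  (forall i, p i -> mu.-integrable D (EFin \o F i)) ->
  mu.-integrable D (EFin \o (fun x => \sum_(i <- r | p i) F i x)).
Proof.
move=> iF; elim: r => [|i r IH].
  under [X in integrable _ _ (_ \o X)]eq_fun do rewrite big_nil.
  exact: integrable0.
under [X in integrable _ _ (_ \o X)]eq_fun do rewrite big_cons.
by case: (p i) (iF i) => [/(_ isT) iFi|_] //; exact: integrable_EFinD.
Qed.

Lemma Rintegral_sum (I : Type) (r : seq I) (p : pred I) (F : I -> T -> R) :
  (forall i, p i -> mu.-integrable D (EFin \o F i)) ->
  \int[mu]_(x in D) (\sum_(i <- r | p i) F i x) = \sum_(i <- r | p i) \int[mu]_(x in D) F i x.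
Proof.
move=> iF; elim: r => [|i r IH].
  under eq_Rintegral do rewrite big_nil.
  by rewrite big_nil Rintegral_cst// mul0r.
under eq_Rintegral do rewrite big_cons.
rewrite big_cons; case: ifPn => // pi.
by rewrite RintegralD ?IH//; [exact: iF|exact: integrable_EFin_sum].
Qed.

End IntegrableReal.

(** * Absolutely continuous functions of time, and comparison of integrals *)

Section ProductRule.
Context {R : realType}.
Local Notation leb := (@lebesgue_measure R).
Implicit Types (a b r t q : R) (f F : R -> R).

Lemma integrable_sub_itv a b r t f : leb.-integrable `[a, b] (EFin \o f) -> a <= r -> t <= b ->
  leb.-integrable `[r, t] (EFin \o f).
Proof.
move=> intf ar tb; apply: integrableS intf => //.
by apply: subset_itv; rewrite bnd_simp.
Qed.

Lemma Rintegral_split a r b f : leb.-integrable `[a, b] (EFin \o f) -> a <= r -> r <= b ->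
  \int[leb]_(x in `[a, b]) f x = \int[leb]_(x in `[a, r]) f x + \int[leb]_(x in `[r, b]) f x.
Proof.
move=> intf ar rb.
have := @Rintegral_itvB R f (BLeft a) (BRight b) r intf; rewrite !bnd_simp => /(_ ar rb).
rewrite Rintegral_itv_obnd_cbnd; last first.
  apply: integrableS intf => //.
  by apply: subset_itv; rewrite bnd_simp.
by move=> <-; rewrite addrC subrK.
Qed.

Lemma le0_of_geometric (x K : R) : 0 <= K -> (forall n, x <= K / 2 ^+ n) -> x <= 0.
Proof.
move=> K0 h; rewrite leNgt; apply/negP => x0.
have Kx0 : 0 <= K / x by rewrite divr_ge0// ltW.
have := archi_boundP Kx0; set n := Num.bound _ => Kn.
have := h n; rewrite leNgt => /negP; apply.
rewrite ltr_pdivrMr ?exprn_gt0// mulrC -ltr_pdivrMr//.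
apply: lt_le_trans Kn _; rewrite -natrX ler_nat.
by apply: ltnW; exact: ltn_expl.
Qed.

Section Primitive.
Context (a b : R) (f F : R -> R).
Context (ab : a <= b).
Context (intf : leb.-integrable `[a, b] (EFin \o f)).
Context (Ff : forall r, a <= r -> r <= b -> F r = F a + \int[leb]_(x in `[a, r]) f x).

Lemma primitive_continuous : {within `[a, b], continuous F}.
Proof.
apply: (@subspace_eq_continuous _ _ _ (fun r => F a + \int[leb]_(x in `[a, r]) f x)).
  by move=> r; rewrite inE/= in_itv/= => /andP[ar rb]; rewrite -Ff.
move=> x; apply: cvgD; first exact: cvg_cst.
exact: (parameterized_integral_continuous ab intf).
Qed.

Lemma primitive_measurable : measurable_fun `[a, b] F.
Proof. by apply: subspace_continuous_measurable_fun => //; exact: primitive_continuous. Qed.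

Lemma primitive_bounded : [bounded F x | x in (`[a, b] : set R)].
Proof.
have /compact_bounded[M [_ mrt]] := continuous_compact primitive_continuous (@segment_compact _ a b).
by exists M; split; rewrite ?num_real // => ? ? ? ?; exact: mrt.
Qed.

Lemma primitive_mul_integrable : leb.-integrable `[a, b] (EFin \o (fun x => F x * f x)).
Proof.
apply: integrable_EFinM => //; first exact: primitive_measurable.
exact: primitive_bounded.
Qed.

Let V r t := \int[leb]_(x in `[r, t]) `|f x|.

Let intV : leb.-integrable `[a, b] (EFin \o (fun x => `|f x|)).
Proof. exact: (integrable_norm intf). Qed.

Let V_ge0 r t : 0 <= V r t.
Proof. by apply: Rintegral_ge0. Qed.

Let F_sub r t : a <= r -> r <= t -> t <= b -> F t - F r = \int[leb]_(x in `[r, t]) f x.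
Proof.
move=> ar rt tb; rewrite (Ff (le_trans ar rt) tb) (Ff ar (le_trans rt tb)).
rewrite (@Rintegral_split a r t)//; last exact: integrable_sub_itv intf _ tb.
by ring.
Qed.

Let F_dist r t : a <= r -> r <= t -> t <= b -> `|F t - F r| <= V r t.
Proof.
move=> ar rt tb; rewrite F_sub//; apply: le_normr_Rintegral => //.
exact: integrable_sub_itv intf ar tb.
Qed.

Let V_split r q t : a <= r -> r <= q -> q <= t -> t <= b -> V r t = V r q + V q t.
Proof. by move=> ar rq qt tb; apply: Rintegral_split => //; exact: integrable_sub_itv intV ar tb. Qed.

Let Phi r t := F t ^+ 2 - F r ^+ 2 - 2 * \int[leb]_(x in `[r, t]) (F x * f x).

Let Phi_split r q t : a <= r -> r <= q -> q <= t -> t <= b -> Phi r t = Phi r q + Phi q t.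
Proof.
move=> ar rq qt tb; rewrite /Phi (@Rintegral_split r q t)//.
  by ring.
exact: integrable_sub_itv primitive_mul_integrable ar tb.
Qed.

(** Phi r t is the integral over x of ((F t - F x) - (F x - F r)) f x, and both differences are at
    most the mass of |f| on [r, t]. *)
Let Phi_le r t : a <= r -> r <= t -> t <= b -> `|Phi r t| <= 2 * V r t ^+ 2.
Proof.
move=> ar rt tb.
have irt := integrable_sub_itv intf ar tb.
have iFf := integrable_sub_itv primitive_mul_integrable ar tb.
have icf : leb.-integrable `[r, t] (EFin \o (fun x => (F t + F r) * f x)).
  exact: integrable_EFinZ.
have i2Ff : leb.-integrable `[r, t] (EFin \o (fun x => 2 * (F x * f x))).
  exact: integrable_EFinZ.
have -> : Phi r t = \int[leb]_(x in `[r, t]) ((F t + F r) * f x - 2 * (F x * f x)).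
  rewrite RintegralB// RintegralZl// RintegralZl// -F_sub//.
  by rewrite /Phi; ring.
have iB : leb.-integrable `[r, t] (EFin \o (fun x => (F t + F r) * f x - 2 * (F x * f x))).
  exact: integrable_EFinB.
have iV : leb.-integrable `[r, t] (EFin \o (fun x => `|f x|)) := integrable_norm irt.
apply: le_trans (le_normr_Rintegral _ iB) _ => //.
rewrite expr2 mulrA -[X in _ <= _ * X]/(\int[leb]_(x in `[r, t]) `|f x|) -RintegralZl//.
apply: le_Rintegral => //.
- exact: integrable_norm iB.
- exact: integrable_EFinZ.
move=> q; rewrite /= in_itv/= => /andP[rq qt].
have -> : (F t + F r) * f q - 2 * (F q * f q) = ((F t - F q) - (F q - F r)) * f q by ring.
rewrite normrM; apply: ler_wpM2r => //.
apply: le_trans (ler_normB _ _) _; rewrite mulr_natl mulr2n; apply: lerD.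
- apply: le_trans (F_dist (le_trans ar rq) qt tb) _.
  by rewrite (V_split ar rq qt tb) lerDr.
- apply: le_trans (F_dist ar rq (le_trans qt tb)) _.
  by rewrite (V_split ar rq qt tb) lerDl.
Qed.

(** The point halves the mass of |f|, not the length of the interval; it exists because the mass is
    continuous in its upper end. *)
Let V_midpoint r t : a <= r -> r <= t -> t <= b ->
  exists q, [/\ r <= q, q <= t, V r q = V r t / 2 & V q t = V r t / 2].
Proof.
move=> ar rt tb.
have cV : {within `[r, t], continuous (fun x => V r x)}.
  exact: (parameterized_integral_continuous rt (integrable_sub_itv intV ar tb)).
have Vrr : V r r = 0 by rewrite /V set_itv1 Rintegral_set1.
have [|q] := @IVT _ (fun x => V r x) r t (V r t / 2) rt cV.
  rewrite Vrr min_l// max_r// divr_ge0//= ler_piMr// invf_le1// ler1n.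
  done.
rewrite in_itv/= => /andP[rq qt] Vq; exists q; split=> //.
have := V_split ar rq qt tb; rewrite Vq => e.
by rewrite -[LHS](addKr (V r t / 2)) -e addrC {1}(splitr (V r t)) addrK.
Qed.

(** Two pieces, each with a quarter of the squared mass: every bisection halves the bound. *)
Let Phi_geometric n : forall r t, a <= r -> r <= t -> t <= b ->
  `|Phi r t| <= 2 * V r t ^+ 2 / 2 ^+ n.
Proof.
elim: n => [|n IH] r t ar rt tb; first by rewrite expr0 divr1; exact: Phi_le.
have [q [rq qt Vrq Vqt]] := V_midpoint ar rt tb.
rewrite (Phi_split ar rq qt tb); apply: le_trans (ler_normD _ _) _.
apply: le_trans (lerD (IH _ _ ar rq (le_trans qt tb)) (IH _ _ (le_trans ar rq) qt tb)) _.
rewrite Vrq Vqt le_eqVlt; apply/orP; left; apply/eqP; rewrite (exprS _ n).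
have p2 : 2 ^+ n != 0 :> R by rewrite expf_neq0.
move: (V r t) (2 ^+ n : R) p2 => x y y0; by field.
Qed.

(* Halving the mass of |f| repeatedly shows that the defect [Phi] in the
   product rule, additive in the interval and quadratically small, vanishes. *)
Lemma sqr_primitive : F b ^+ 2 - F a ^+ 2 = \int[leb]_(x in `[a, b]) (2 * (F x * f x)).
Proof.
rewrite RintegralZl//; last exact: primitive_mul_integrable.
apply/eqP; rewrite -subr_eq0 -normr_le0.
apply: (@le0_of_geometric _ (2 * V a b ^+ 2)); first by rewrite mulr_ge0 ?sqr_ge0.
by move=> n; exact: Phi_geometric.
Qed.

End Primitive.

(* The library's comparison of integrals asks for measurability, which is
   not available for the norms [Vnorm s (z t)] as functions of time. *)
Lemma ge0_le_integral_nonmeasurable d (T : measurableType d) (mu : {measure set T -> \bar R})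
    (D1 D2 : set T) (f1 f2 : T -> \bar R) : D1 `<=` D2 ->
  (forall x, D1 x -> (0 <= f1 x)%E) -> (forall x, D2 x -> (0 <= f2 x)%E) ->
  (forall x, D1 x -> (f1 x <= f2 x)%E) ->
  (\int[mu]_(x in D1) f1 x <= \int[mu]_(x in D2) f2 x)%E.
Proof.
move=> D12 f10 f20 f12; rewrite !ge0_integralE//.
apply: le_ereal_sup; apply: image_subset => h /= hf1 x.
apply: le_trans (hf1 x) _; rewrite !patchE; case: ifPn => xD1.
  by rewrite mem_set ?f12//; [exact: set_mem xD1|apply: D12; exact: set_mem xD1].
by case: ifPn => // xD2; apply: f20; exact: set_mem xD2.
Qed.

Lemma ae_mono d (T : measurableType d) (mu : {measure set T -> \bar R}) (P Q : T -> Prop) :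
  (forall x, P x -> Q x) -> {ae mu, forall x, P x} -> {ae mu, forall x, Q x}.
Proof. by move=> PQ; apply: filterS. Qed.

Lemma ae_and d (T : measurableType d) (mu : {measure set T -> \bar R}) (P Q : T -> Prop) :
  {ae mu, forall x, P x} -> {ae mu, forall x, Q x} -> {ae mu, forall x, P x /\ Q x}.
Proof. exact: filterI. Qed.

(** The difference agrees almost everywhere with its absolute value, whose integral is
    nonnegative. *)
Lemma ae_le_Rintegral d (T : measurableType d) (mu : {measure set T -> \bar R})
    (D : set T) (f1 f2 : T -> R) : measurable D ->
  mu.-integrable D (EFin \o f1) -> mu.-integrable D (EFin \o f2) ->
  {ae mu, forall x, D x -> f1 x <= f2 x} ->
  \int[mu]_(x in D) f1 x <= \int[mu]_(x in D) f2 x.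
Proof.
move=> mD i1 i2 h; rewrite -subr_ge0 -RintegralB//.
have iB : mu.-integrable D (EFin \o (fun x => f2 x - f1 x)).
  exact: integrable_EFinB.
rewrite [leRHS](_ : _ = \int[mu]_(x in D) `|f2 x - f1 x|).
  by apply: Rintegral_ge0.
congr fine; apply: ae_eq_integral => //.
- by case/integrableP: iB.
- by case/integrableP: (integrable_norm iB).
apply: filterS h => x h Dx /=; rewrite ger0_norm// subr_ge0; exact: h.
Qed.

End ProductRule.

(** * Time evolution of the truncated norms *)

Section TimeDependence.
Context {R : realType} {d : nat}.
Local Notation leb := (@lebesgue_measure R).
Local Notation Box N := {ffun 'I_d -> 'I_(N.*2.+1)}.
Implicit Types (k n : 'I_d -> int) (N M : nat) (w u v z : R -> vfield R d) (phi : vfield R d)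
  (a b t r s : R) (i : 'I_d).

(* [w'] is a weak derivative of [w]. Outside of the set [P] of times, of full
   measure in applications, [w' t] may not be in H, and [inner (w' t) phi] is
   replaced with the value of a measurable function. *)
Definition weak_primitive a b (P : set R) w w' :=
  [/\ forall t, a <= t <= b -> H (w t), forall t, P t -> H (w' t) &
      forall phi, Vtrig phi -> exists f : R -> R,
        [/\ leb.-integrable `[a, b] (EFin \o f),
            forall t, a <= t -> t <= b ->
              inner (w t) phi = inner (w a) phi + \int[leb]_(r in `[a, t]) f r &
            forall t, P t -> f t = inner (w' t) phi]].

Lemma weak_primitive_time t0 z z' a b : time_derivative t0 z z' ->
  (forall t, t0 <= t -> H (z t)) -> t0 <= a -> a <= b ->
  weak_primitive a b [set t | H (z' t)] z z'.
Proof.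
move=> [_ dz] Hz t0a ab; split=> //.
  by move=> t /andP[at_ _]; apply: Hz; exact: le_trans at_.
move=> phi vphi; exists (fun t => inner (z' t) phi).
have Hphi := Vtrig_H vphi; have t0b := le_trans t0a ab.
have [intb _] := dz _ Hphi _ t0b.
split=> //; first exact: integrable_sub_itv intb t0a (lexx _).
move=> t at_ tb; have [intt et] := dz _ Hphi _ (le_trans t0a at_).
have [_ ea] := dz _ Hphi _ t0a.
have := Rintegral_split intt t0a at_; rewrite -et -ea => e.
by rewrite -[LHS](subrK (inner (z t0) phi)) e; ring.
Qed.

Lemma weak_primitiveB a b P P' u u' v v' : weak_primitive a b P u u' ->
  weak_primitive a b P' v v' ->
  weak_primitive a b (P `&` P') (fun t => u t - v t) (fun t => u' t - v' t).
Proof.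
move=> [Hu Hu' du] [Hv Hv' dv]; split.
- by move=> t atb; apply: HB; [exact: Hu|exact: Hv].
- by move=> t [Pt Pt']; apply: HB; [exact: Hu'|exact: Hv'].
move=> phi vphi; have lphi := Vtrig_L2 vphi.
have [f [intf ef Pf]] := du _ vphi; have [g [intg eg Pg]] := dv _ vphi.
exists (fun t => f t - g t); split.
- by apply: integrable_EFinB.
- move=> t at_ tb.
  have ab := le_trans at_ tb.
  have Lu r : a <= r <= b -> L2 (u r) by move=> /Hu/H_L2.
  have Lv r : a <= r <= b -> L2 (v r) by move=> /Hv/H_L2.
  have atb : a <= t <= b by rewrite at_.
  have aab : a <= a <= b by rewrite lexx.
  rewrite (innerBl (Lu _ atb) (Lv _ atb) lphi) (innerBl (Lu _ aab) (Lv _ aab) lphi).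
  rewrite RintegralB//; last 2 first.
  + exact: integrable_sub_itv intf (lexx _) tb.
  + exact: integrable_sub_itv intg (lexx _) tb.
  by rewrite (ef _ at_ tb) (eg _ at_ tb); ring.
- move=> t [Pt Pt']; rewrite Pf// Pg// innerBl//; apply: H_L2; [exact: Hu'|exact: Hv'].
Qed.

Section WeakPrimitive.
Context (a b : R) (P : set R) (w w' : R -> vfield R d).
Context (ab : a <= b).
Context (wp : weak_primitive a b P w w').

Let Hw t : a <= t -> t <= b -> H (w t).
Proof. by move=> at_ tb; have [+ _ _] := wp; apply; rewrite at_. Qed.

Lemma ac_primitive n i : exists f : R -> R, n != 0 ->
  [/\ leb.-integrable `[a, b] (EFin \o f),
      forall t, a <= t -> t <= b ->
        ac (w t i) n = ac (w a i) n + \int[leb]_(r in `[a, t]) f r &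
      forall t, P t -> f t = ac (w' t i) n].
Proof.
have [->|n0] := eqVneq n 0; first by exists (fun=> 0).
have [phi vphi Ephi] := @test_ac R d n i n0.
have [_ Hw' /(_ _ vphi)[f [intf ef Pf]]] := wp.
exists f => _; split=> // [t at_ tb|t Pt]; last by rewrite Pf// Ephi//; exact: Hw'.
have Ht := Ephi _ (Hw at_ tb); have Ha := Ephi _ (Hw (lexx a) (le_trans at_ tb)).
by rewrite -Ht -Ha ef.
Qed.

Lemma bs_primitive n i : exists f : R -> R, n != 0 ->
  [/\ leb.-integrable `[a, b] (EFin \o f),
      forall t, a <= t -> t <= b ->
        bs (w t i) n = bs (w a i) n + \int[leb]_(r in `[a, t]) f r &
      forall t, P t -> f t = bs (w' t i) n].
Proof.
have [->|n0] := eqVneq n 0; first by exists (fun=> 0).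
have [phi vphi Ephi] := @test_bs R d n i n0.
have [_ Hw' /(_ _ vphi)[f [intf ef Pf]]] := wp.
exists f => _; split=> // [t at_ tb|t Pt]; last by rewrite Pf// Ephi//; exact: Hw'.
have Ht := Ephi _ (Hw at_ tb); have Ha := Ephi _ (Hw (lexx a) (le_trans at_ tb)).
by rewrite -Ht -Ha ef.
Qed.

(** Coefficients at nonzero frequencies are primitives, hence continuous. For s != 0 the weight at
    frequency 0 is zero, which disposes of the one frequency without a test field. *)
Lemma Q_measurable s N : s != 0 -> measurable_fun `[a, b] (fun t => Q s (w t) N).
Proof.
move=> s0; rewrite /Q; apply: measurable_sum => m.
have [m0|m0] := eqVneq (freq m) 0.
  rewrite m0 Lam0 powR0 ?mulf_neq0//.
  rewrite (_ : (fun _ => _) = cst 0); last by apply/funext => t; rewrite mul0r.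
  exact: measurable_cst.
apply: measurable_funM; first exact: measurable_cst.
rewrite /pw; apply: measurable_sum => i.
have [fa /(_ m0)[ia ea _]] := ac_primitive (freq m) i.
have [fb /(_ m0)[ib eb _]] := bs_primitive (freq m) i.
apply: measurable_funD; apply: measurable_funX.
- exact: (primitive_measurable ab ia ea).
- exact: (primitive_measurable ab ib eb).
Qed.

(** [sqr_primitive] summed over finitely many coefficients. G is an integrable substitute, defined
    at all times, for the pairing with w', which is meaningful only on P. *)
Lemma Q_primitive s N : s != 0 -> exists G : R -> R,
  [/\ leb.-integrable `[a, b] (EFin \o G),
      Q s (w b) N - Q s (w a) N = \int[leb]_(r in `[a, b]) G r &
      forall t, a <= t -> t <= b -> P t -> G t = 2 * inner (w' t) (fraclap_sum s (w t) N)].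
Proof.
move=> s0.
have /choice[fa hfa] : forall ni : ('I_d -> int) * 'I_d, exists f : R -> R, ni.1 != 0 ->
  [/\ leb.-integrable `[a, b] (EFin \o f),
      forall t, a <= t -> t <= b ->
        ac (w t ni.2) ni.1 = ac (w a ni.2) ni.1 + \int[leb]_(r in `[a, t]) f r &
      forall t, P t -> f t = ac (w' t ni.2) ni.1].
  by move=> [n i]; exact: ac_primitive.
have /choice[fb hfb] : forall ni : ('I_d -> int) * 'I_d, exists f : R -> R, ni.1 != 0 ->
  [/\ leb.-integrable `[a, b] (EFin \o f),
      forall t, a <= t -> t <= b ->
        bs (w t ni.2) ni.1 = bs (w a ni.2) ni.1 + \int[leb]_(r in `[a, t]) f r &
      forall t, P t -> f t = bs (w' t ni.2) ni.1].
  by move=> [n i]; exact: bs_primitive.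
have L00 : Lam (0 : 'I_d -> int) `^ (2 * s) = 0 :> R by rewrite Lam0 powR0// mulf_neq0.
pose g (m : Box N) i t : R := 2 * (ac (w t i) (freq m) * fa (freq m, i) t) +
   2 * (bs (w t i) (freq m) * fb (freq m, i) t).
have ig m i : freq m != 0 -> leb.-integrable `[a, b] (EFin \o g m i).
  move=> m0; have [ia ea _] := hfa (freq m, i) m0; have [ib eb _] := hfb (freq m, i) m0.
  apply: integrable_EFinD => //; apply: integrable_EFinZ => //.
  - exact: (primitive_mul_integrable ab ia ea).
  - exact: (primitive_mul_integrable ab ib eb).
exists (fun t => \sum_(m : Box N | freq m != 0) Lam (freq m) `^ (2 * s) * \sum_i g m i t); split.
- apply: integrable_EFin_sum => // m m0; apply: integrable_EFinZ => //.
  by apply: integrable_EFin_sum => // i _; exact: ig.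
- rewrite Rintegral_sum//; last first.
    move=> m m0; apply: integrable_EFinZ => //.
    by apply: integrable_EFin_sum => // i _; exact: ig.
  rewrite /Q -sumrB [RHS]big_mkcond; apply: eq_bigr => m _.
  have [m0|m0] := eqVneq (freq m) 0; first by rewrite m0 L00 !mul0r subrr.
  rewrite RintegralZl//; last by apply: integrable_EFin_sum => // i _; exact: ig.
  rewrite -mulrBr; congr (_ * _); rewrite Rintegral_sum//; last by move=> i _; exact: ig.
  rewrite /pw -sumrB; apply: eq_bigr => i _.
  have [ia ea _] := hfa (freq m, i) m0; have [ib eb _] := hfb (freq m, i) m0.
  rewrite /g RintegralD//; last 2 first.
  + by apply: integrable_EFinZ => //; exact: (primitive_mul_integrable ab ia ea).
  + by apply: integrable_EFinZ => //; exact: (primitive_mul_integrable ab ib eb).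
  rewrite -(sqr_primitive ab ia ea) -(sqr_primitive ab ib eb) /=.
  by ring.
- move=> t at_ tb Pt; have [_ Hw' _] := wp.
  rewrite innerC inner_fraclap_sum; last by apply: H_L2; exact: Hw'.
  rewrite mulr_sumr big_mkcond; apply: eq_bigr => m _.
  have [m0|m0] := eqVneq (freq m) 0; first by rewrite m0 L00 !mul0r mulr0.
  rewrite mulrCA; congr (_ * _); rewrite mulr_sumr; apply: eq_bigr => i _.
  have [_ _ pa] := hfa (freq m, i) m0; have [_ _ pb] := hfb (freq m, i) m0.
  by rewrite /g pa// pb//=; ring.
Qed.

End WeakPrimitive.

Lemma le_Q_exponent s s' (g : vfield R d) N : divfree g -> 0 < s -> s <= s' ->
  Q s g N <= Q s' g N.
Proof.
move=> dg s0 ss'; apply: ler_sum => m _; apply: ler_wpM2r; first exact: pw_ge0.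
have [m0|m0] := eqVneq (freq m) 0.
  by rewrite m0 Lam0 powR0 ?powR_ge0// mulf_neq0// gt_eqF.
by rewrite ler_powR ?Lam_ge1// ler_pM2l.
Qed.

Lemma Q_sub_le s (g h : vfield R d) N : L2 g -> L2 h ->
  Q s (g - h) N <= 2 * Q s g N + 2 * Q s h N.
Proof.
move=> lg lh; rewrite /Q !mulr_sumr -big_split/=; apply: ler_sum => m _.
rewrite mulrCA (mulrCA 2) -mulrDr; apply: ler_wpM2l; first exact: powR_ge0.
rewrite /pw !mulr_sumr -big_split/=; apply: ler_sum => i _; rewrite acB// bsB//.
have E (x y : R) : (x - y) ^+ 2 <= 2 * x ^+ 2 + 2 * y ^+ 2.
  rewrite -subr_ge0 (_ : _ - _ = (x + y) ^+ 2) ?sqr_ge0//; ring.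
apply: le_trans (lerD (E _ _) (E _ _)) _.
by rewrite le_eqVlt; apply/orP; left; apply/eqP; ring.
Qed.

Lemma L2_time_bound s a b t0 T z P z' : s != 0 -> t0 <= a -> a <= b -> b <= T ->
  L2_time s t0 T z -> weak_primitive a b P z z' ->
  exists K : R, forall N, (\int[leb]_(t in `[a, b]) (Q s (z t) N)%:E <= K%:E)%E.
Proof.
move=> s0 t0a ab bT [_ fin] wp.
have V0 t : (0 <= Vnorm s (z t) ^+ 2)%E by rewrite sqre_ge0.
exists (fine (\int[leb]_(t in `]t0, T[) (Vnorm s (z t) ^+ 2))%E) => N.
rewrite fineK; last by rewrite ge0_fin_numE// integral_ge0.
have mQ : measurable_fun `[a, b] (fun t => (Q s (z t) N)%:E).
  by apply/measurable_EFinP; exact: (Q_measurable ab wp N s0).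
(* The end points are dropped while the integrand is the measurable [Q]; only then is it compared
   with the norm on the larger open interval. *)
rewrite -integral_itv_obnd_cbnd; last first.
  by apply: measurable_funS mQ => //; apply: subset_itv; rewrite bnd_simp.
rewrite -integral_itv_bndo_bndc; last first.
  by apply: measurable_funS mQ => //; apply: subset_itv; rewrite bnd_simp.
apply: ge0_le_integral_nonmeasurable => //.
- by apply: subset_itv; rewrite bnd_simp.
- by move=> t _; rewrite lee_fin Q_ge0.
- by move=> t _; exact: Q_le_Vnorm.
Qed.

End TimeDependence.

(** * Monotone convergence, and decay from an integrated inequality *)

Section MonotoneLimit.
Context {R : realType}.
Local Notation leb := (@lebesgue_measure R).

(** The limit may be +oo at exceptional times, where [fine] returns 0. The fourth clause is an
    inequality for that reason; the losses have to be bounded only from above. *)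
Lemma monotone_limit (a b K : R) (q : nat -> R -> R) :
  (forall n, measurable_fun `[a, b] (q n)) -> (forall n t, 0 <= q n t) ->
  (forall t n m, (n <= m)%N -> q n t <= q m t) ->
  (forall n, (\int[leb]_(t in `[a, b]) (q n t)%:E <= K%:E)%E) ->
  let l t : \bar R := limn (fun n => (q n t)%:E) in
  exists z : R,
  [/\ forall n, leb.-integrable `[a, b] (EFin \o q n),
      leb.-integrable `[a, b] (EFin \o (fine \o l)),
      (fun n => \int[leb]_(t in `[a, b]) q n t) @ \oo --> z,
      \int[leb]_(t in `[a, b]) fine (l t) <= z &
      (\int[leb]_(t in `[a, b]) l t = z%:E)%E].
Proof.
move=> mq q0 ndq qK l.
have ndE t : nondecreasing_seq (fun n => (q n t)%:E).
  by move=> n m nm; rewrite lee_fin ndq.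
have cvgE t : cvgn (fun n => (q n t)%:E) by exact: ereal_nondecreasing_is_cvgn.
have l0 t : (0 <= l t)%E.
  by apply: lime_ge => //; apply: nearW => n; rewrite lee_fin.
have mE n : measurable_fun `[a, b] (fun t => (q n t)%:E) by apply/measurable_EFinP.
have cv : (fun n => \int[leb]_(t in `[a, b]) (q n t)%:E)%E @ \oo -->
    (\int[leb]_(t in `[a, b]) l t)%E.
  by apply: cvg_monotone_convergence => // n t _; rewrite lee_fin.
have lK : (\int[leb]_(t in `[a, b]) l t <= K%:E)%E.
  rewrite -(cvg_lim _ cv)//; apply: lime_le; first by apply/cvg_ex; eexists; exact: cv.
  by apply: nearW => n; exact: qK.
have I0 : (0 <= \int[leb]_(t in `[a, b]) l t)%E by apply: integral_ge0 => t _.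
have lfin : (\int[leb]_(t in `[a, b]) l t)%E \is a fin_num.
  by rewrite ge0_fin_numE// (le_lt_trans lK)// ltry.
have fl t : ((fine (l t))%:E <= l t)%E.
  by have := l0 t; case: (l t) => //= ?; rewrite ?leey.
have ml : measurable_fun `[a, b] l.
  by apply: (emeasurable_fun_cvg (fun n t => (q n t)%:E)) => // t _; exact: cvgE.
have flI : (\int[leb]_(t in `[a, b]) (fine (l t))%:E <= \int[leb]_(t in `[a, b]) l t)%E.
  apply: ge0_le_integral_nonmeasurable => // t _.
  by rewrite lee_fin fine_ge0.
exists (fine (\int[leb]_(t in `[a, b]) l t)%E); split.
- move=> n; apply/integrableP; split; first exact: mE.
  under eq_integral do rewrite /= ger0_norm//.
  by apply: le_lt_trans (qK n) _; rewrite ltry.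
- apply/integrableP; split.
    by apply/measurable_EFinP; apply: measurableT_comp => //.
  under eq_integral do rewrite /= ger0_norm ?fine_ge0//.
  by apply: le_lt_trans flI _; rewrite -ge0_fin_numE.
- rewrite -[X in X @ _](_ : fine \o (fun n => \int[leb]_(t in `[a, b]) (q n t)%:E)%E = _)//.
  by apply: fine_cvg; rewrite fineK.
- apply: fine_le => //; rewrite ge0_fin_numE; last first.
    by apply: integral_ge0 => t _; rewrite lee_fin fine_ge0.
  by apply: le_lt_trans flI _; rewrite -ge0_fin_numE.
- by rewrite fineK.
Qed.

(** One unit of time divides E by at least 1 + lambda, whose logarithm is the rate; the prefactor 1
    + lambda pays for the incomplete last step. *)
Lemma exponential_decay (E : R -> R) (t0 lambda C : R) : 0 < lambda -> 0 <= C ->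
  (forall t, t0 <= t -> 0 <= E t) -> E t0 <= C ->
  (forall a b, t0 <= a -> a <= b -> E b + lambda * (b - a) * E b <= E a) ->
  forall t, t0 <= t -> E t <= C * (1 + lambda) * expR (- ln (1 + lambda) * (t - t0)).
Proof.
move=> l0 C0 E0 EC dec t t0t.
have l1 : 0 < 1 + lambda by rewrite addr_gt0.
set kappa := ln (1 + lambda).
have k0 : 0 <= kappa by rewrite ln_ge0// lerDl ltW.
have ek : expR kappa = 1 + lambda by rewrite lnK// posrE.
have step n : E (t0 + n%:R) <= C * expR (- kappa * n%:R).
  elim: n => [|n IH]; first by rewrite addr0 mulr0 expR0 mulr1.
  have t0n : t0 <= t0 + n%:R by rewrite lerDl.
  have nn : t0 + n%:R <= t0 + n.+1%:R by rewrite lerD2l ler_nat.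
  have := dec _ _ t0n nn.
  rewrite (_ : t0 + n.+1%:R - (t0 + n%:R) = 1); last by rewrite -natr1; ring.
  rewrite mulr1 -{1}[E (t0 + n.+1%:R)]mul1r -mulrDl => /le_trans /(_ IH).
  rewrite -ler_pdivlMl// => /le_trans; apply.
  rewrite -natr1 mulrDr expRD mulr1 expRN ek.
  by rewrite le_eqVlt; apply/orP; left; apply/eqP; field; rewrite gt_eqF.
have tt0 : 0 <= t - t0 by rewrite subr_ge0.
pose n := Num.trunc (t - t0).
have /andP[nt tn] := Num.Theory.truncn_itv tt0.
have t0n : t0 <= t0 + n%:R by rewrite lerDl.
have nt' : t0 + n%:R <= t by rewrite -lerBrDl.
have mono : E t <= E (t0 + n%:R).
  apply: le_trans (dec _ _ t0n nt'); rewrite lerDl !mulr_ge0 ?subr_ge0//; first exact: ltW.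
  exact: E0.
apply: le_trans mono _; apply: le_trans (step n) _; rewrite -mulrA ler_wpM2l//.
rewrite -{1}ek -expRD ler_expR -subr_ge0.
rewrite (_ : _ - _ = kappa * (n.+1%:R - (t - t0))); last by rewrite -natr1; ring.
by rewrite mulr_ge0// subr_ge0 ltW.
Qed.

End MonotoneLimit.

Lemma dissipation_arith {R : realFieldType} (nu m x z : R) : 0 <= nu * z ->
  3 / 2 * nu * z - 2 * nu * z + (3 / 2 * m * x - 2 * m * x) <= - (m / 2 * x).
Proof. lra. Qed.

(** * Integration of the energy inequality along the two solutions *)

Section Synchronization.
Context {R : realType} {d : nat}.
Local Notation leb := (@lebesgue_measure R).
Context (alpha nu : R) (hd2 : (2 <= d)%N) (halpha : d%:R / 4 + 1 / 2 <= alpha) (hnu : 0 < nu).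
Context (m h c0 t0 sigma : R) (I : vfield R d -> vfield R d) (f u0 v0 : vfield R d)
  (u v : R -> vfield R d).
Context (hm : 0 < m) (hh : 0 < h) (hc0 : 0 < c0) (hI : interpolant alpha c0 h I)
  (hf : V alpha f) (ht0 : 0 <= t0)
  (hu : classical_solution_u alpha nu f u0 u)
  (hv : classical_solution_v alpha nu m I f u t0 v0 v)
  (us : forall t, t0 <= t -> (Vnorm alpha (u t) <= sigma%:E)%E)
  (vs : forall t, t0 <= t -> (Vnorm alpha (v t) <= sigma%:E)%E)
  (hs : 0 < sigma) (mh : m * h ^+ 2 * c0 <= nu)
  (Cm : @Cdecay R d alpha nu * sigma `^ (2 / (1 - d%:R / (4 * alpha))) <= m / 2).

Let w t := u t - v t.

Let alpha_ge1 : 1 <= alpha.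
Proof.
apply: le_trans halpha; have : 2 <= d%:R :> R by rewrite ler_nat.
by move: (d%:R : R) => D D2; lra.
Qed.

Let alpha_gt0 : 0 < alpha. Proof. exact: lt_le_trans alpha_ge1. Qed.

Let Hu t : 0 <= t -> H (u t).
Proof. by move=> t0'; have [[Vu _] _ _] := hu; have [] := Vu _ t0'. Qed.

Let Hv t : t0 <= t -> H (v t).
Proof. by have [[+ _] _ _] := hv; exact. Qed.

Let Hw t : t0 <= t -> H (w t).
Proof. by move=> tt; apply: HB; [apply: Hu; exact: le_trans tt|exact: Hv]. Qed.

(** A limit of the measurable [Q] in the extended reals, so defined at every time; it is the squared
    V^s norm whenever the fractional Laplacian exists. *)
Let energy (s t : R) : \bar R := limn (fun N => (Q s (w t) N)%:E).
Let E t := fine (energy alpha t).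

Let energyE s t z : is_fraclap (s / 2) (w t) z -> energy s t = (L2norm z ^+ 2)%:E.
Proof.
move=> fl; apply: cvg_lim => //; apply: cvg_EFin; first exact: nearW.
by have := Q_cvg_fraclap fl; rewrite mul2div2.
Qed.

Let fraclap_w t : t0 <= t -> exists z, is_fraclap (alpha / 2) (w t) z.
Proof.
move=> tt; have [wu flu _] := Vnorm_le_fraclap (us tt).
have [wv flv _] := Vnorm_le_fraclap (vs tt).
by exists (wu - wv); exact: is_fraclapB.
Qed.

Let Vnorm_w t : t0 <= t -> Vnorm alpha (w t) = (Num.sqrt (E t))%:E.
Proof.
move=> /fraclap_w[z fl]; rewrite (VnormE fl) /E (energyE fl)/=.
by rewrite sqrtr_sqr ger0_norm// L2norm_ge0.
Qed.

Let E_ge0 t : t0 <= t -> 0 <= E t.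
Proof. by move=> /fraclap_w[z fl]; rewrite /E (energyE fl) sqr_ge0. Qed.

Let Q_cvg_E t : t0 <= t -> Q alpha (w t) @ \oo --> E t.
Proof.
by move=> /fraclap_w[z fl]; rewrite /E (energyE fl); have := Q_cvg_fraclap fl; rewrite mul2div2.
Qed.

Let Q_le_energy s t z N : is_fraclap (s / 2) (w t) z -> Q s (w t) N <= fine (energy s t).
Proof. by move=> fl; rewrite (energyE fl) /=; have := Q_le_fraclap N fl; rewrite mul2div2. Qed.

Let weak_derivative a b : t0 <= a -> a <= b -> exists P w' K,
  [/\ weak_primitive a b P w w',
      forall N, (\int[leb]_(t in `[a, b]) (Q (2 * alpha) (w t) N)%:E <= K%:E)%E &
      {ae leb, forall t, a <= t <= b -> P t /\
        (exists z, is_fraclap (2 * alpha / 2) (w t) z) /\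
        forall X2 Z2, (forall N, Q alpha (w t) N <= X2) ->
        (forall N, Q (2 * alpha) (w t) N <= Z2) -> forall N,
        2 * inner (w' t) (fraclap_sum alpha (w t) N) <=
        3 / 2 * nu * Z2 - 2 * nu * Q (2 * alpha) (w t) N +
        (3 / 2 * m * X2 - 2 * m * Q alpha (w t) N)}].
Proof.
move=> t0a ab.
have a0 : 0 <= a := le_trans ht0 t0a.
have [_ L2u [_ [u' du equ]]] := hu.
have [_ L2v [p lerp [_ [v' dv eqv]]]] := hv.
have wpu := weak_primitive_time du Hu a0 ab.
have wpv := weak_primitive_time dv Hv t0a ab.
(* The regularity hypotheses concern nondegenerate intervals, whereas a = b is allowed here;
   enlarging to b + 1 covers that case. *)
have b0 : 0 < b + 1 by rewrite ltr_wpDl// (le_trans a0).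
have bb : b <= b + 1 by rewrite lerDl.
have t0b : t0 < b + 1 by rewrite ltr_pwDr// (le_trans t0a).
have s3 : 3 * alpha != 0 by rewrite mulf_neq0// gt_eqF.
have [Ku hKu] := L2_time_bound s3 a0 ab bb (L2u _ b0) wpu.
have [Kv hKv] := L2_time_bound s3 t0a ab bb (L2v _ t0b).2 wpv.
exists ([set t | H (u' t)] `&` [set t | H (v' t)]), (fun t => u' t - v' t), (2 * Ku + 2 * Kv).
split; first exact: weak_primitiveB wpu wpv.
- move=> N.
  apply: (@le_trans _ _ (\int[leb]_(t in `[a, b])
    (2%:E * (Q (3 * alpha) (u t) N)%:E + 2%:E * (Q (3 * alpha) (v t) N)%:E))%E).
    apply: ge0_le_integral_nonmeasurable => //.
    + by move=> t _; rewrite lee_fin Q_ge0.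
    + by move=> t _; rewrite lee_fin addr_ge0// mulr_ge0// Q_ge0.
    move=> t; rewrite /= in_itv/= => /andP[at_ tb]; rewrite lee_fin.
    have Hut := Hu (le_trans a0 at_); have Hvt := Hv (le_trans t0a at_).
    apply: le_trans (Q_sub_le _ _ (H_L2 Hut) (H_L2 Hvt)) _.
    (* The bound in V^{2 alpha} comes from the V^{3 alpha} regularity: nonzero frequencies satisfy
       Lam >= 1 and the mean is zero. *)
    have a2 : 0 < 2 * alpha by rewrite mulr_gt0.
    have a23 : 2 * alpha <= 3 * alpha by rewrite ler_pM2r// ler_nat.
    apply: lerD; rewrite ler_pM2l//; apply: le_Q_exponent => //; exact: H_divfree.
  have mu_ : measurable_fun `[a, b] (fun t => (Q (3 * alpha) (u t) N)%:E).
    by apply/measurable_EFinP; exact: (Q_measurable ab wpu N s3).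
  have mv_ : measurable_fun `[a, b] (fun t => (Q (3 * alpha) (v t) N)%:E).
    by apply/measurable_EFinP; exact: (Q_measurable ab wpv N s3).
  have Qu0 t : (0 <= (Q (3 * alpha) (u t) N)%:E)%E by rewrite lee_fin Q_ge0.
  have Qv0 t : (0 <= (Q (3 * alpha) (v t) N)%:E)%E by rewrite lee_fin Q_ge0.
  rewrite ge0_integralD//; last 4 first.
  + by move=> t _; rewrite mule_ge0.
  + by apply: emeasurable_funM => //; exact: measurable_cst.
  + by move=> t _; rewrite mule_ge0.
  + by apply: emeasurable_funM => //; exact: measurable_cst.
  rewrite !ge0_integralZl//.
  rewrite [leRHS](_ : _ = (2%:E * Ku%:E + 2%:E * Kv%:E)%E)//.
  by apply: leeD; apply: lee_wpmul2l.
- have [Hu' _] := du; have [Hv' _] := dv.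
  have := ae_and (ae_and Hu' Hv') (ae_and (ae_and equ eqv) lerp).
  apply: ae_mono => t [[Hu't Hv't] [[equt eqvt] lert]] /andP[at_ tb].
  have tt := le_trans t0a at_; have t0' := le_trans a0 at_.
  have [Au [Bu [Au_ Bu_ eu]]] := equt t0'.
  have [Av [Bv [Av_ Bv_ ev]]] := eqvt tt.
  split; first by split; [exact: Hu't|exact: Hv't].
  split.
    (* At almost every time the equation contains A^alpha u and A^alpha v, so w has a finite V^{2
       alpha} norm. *)
    have [zu flu _] := Au_; have [zv flv _] := Av_.
    exists (zu - zv); rewrite (_ : 2 * alpha / 2 = alpha); last by field.
    exact: is_fraclapB.
  move=> X2 Z2 QX QZ N.
  have := (energy_inequality halpha hd2 N hnu hm hc0 hh (ltW hs) hI (H_L2 hf.1) (Hu t0') (Hv tt)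
    (Hu't t0') (Hv't tt) Au_ Av_ Bu_ Bv_ (lert tt) eu ev (us tt) (vs tt) mh Cm QX QZ); exact.
Qed.

Let E_dissipation a b : t0 <= a -> a <= b -> exists x : R,
  [/\ 0 <= x, (\int[leb]_(t in `[a, b]) energy alpha t = x%:E)%E & E b - E a <= - (m / 2 * x)].
Proof.
move=> t0a ab; have t0b := le_trans t0a ab.
have [P [w' [K [wp QK key]]]] := weak_derivative t0a ab.
have s1 : alpha != 0 by rewrite gt_eqF.
have s2 : 2 * alpha != 0 by rewrite mulf_neq0.
have QK1 N : (\int[leb]_(t in `[a, b]) (Q alpha (w t) N)%:E <= K%:E)%E.
  apply: le_trans (QK N); apply: ge0_le_integral_nonmeasurable => //.
  - by move=> t _; rewrite lee_fin Q_ge0.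
  - by move=> t _; rewrite lee_fin Q_ge0.
  move=> t; rewrite /= in_itv/= => /andP[at_ tb]; rewrite lee_fin.
  apply: le_Q_exponent => //; first by apply: H_divfree; apply: Hw; exact: le_trans at_.
  by rewrite ler_peMl ?ler1n// ltW.
have [x [iQ1 iX cx Xx Ex]] := monotone_limit
  (fun N => Q_measurable ab wp N s1) (fun N t => Q_ge0 alpha (w t) N)
  (fun t N M => @le_Q R d alpha (w t) N M) QK1.
have [z [iQ2 iZ cz Zz _]] := monotone_limit
  (fun N => Q_measurable ab wp N s2) (fun N t => Q_ge0 (2 * alpha) (w t) N)
  (fun t N M => @le_Q R d (2 * alpha) (w t) N M) QK.
have z0 : 0 <= z.
  apply: le_trans Zz; apply: Rintegral_ge0 => t _; apply: fine_ge0.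
  apply: lime_ge; last by apply: nearW => N; rewrite lee_fin Q_ge0.
  by apply: ereal_nondecreasing_is_cvgn => N M NM; rewrite lee_fin; exact: le_Q.
have x0 : 0 <= x.
  apply: le_trans Xx; apply: Rintegral_ge0 => t _; apply: fine_ge0.
  apply: lime_ge; last by apply: nearW => N; rewrite lee_fin Q_ge0.
  by apply: ereal_nondecreasing_is_cvgn => N M NM; rewrite lee_fin; exact: le_Q.
exists x; split=> //.
pose q1 N := \int[leb]_(t in `[a, b]) Q alpha (w t) N.
pose q2 N := \int[leb]_(t in `[a, b]) Q (2 * alpha) (w t) N.
(* The losses already stand at their limits z and x, while the gains are still truncated at N. *)
pose bound N := 3 / 2 * nu * z - 2 * nu * q2 N + (3 / 2 * m * x - 2 * m * q1 N).
have step N : Q alpha (w b) N - Q alpha (w a) N <= bound N.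
  have [G [iG -> GE]] := Q_primitive ab wp N s1.
  pose hZ t := 3 / 2 * nu * fine (energy (2 * alpha) t) - 2 * nu * Q (2 * alpha) (w t) N.
  pose hX t := 3 / 2 * m * fine (energy alpha t) - 2 * m * Q alpha (w t) N.
  have iZc : leb.-integrable `[a, b] (EFin \o (fun t => 3 / 2 * nu * fine (energy (2 * alpha) t))).
    exact: integrable_EFinZ.
  have iQ2c : leb.-integrable `[a, b] (EFin \o (fun t => 2 * nu * Q (2 * alpha) (w t) N)).
    by apply: integrable_EFinZ => //; exact: iQ2.
  have iXc : leb.-integrable `[a, b] (EFin \o (fun t => 3 / 2 * m * fine (energy alpha t))).
    exact: integrable_EFinZ.
  have iQ1c : leb.-integrable `[a, b] (EFin \o (fun t => 2 * m * Q alpha (w t) N)).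
    by apply: integrable_EFinZ => //; exact: iQ1.
  have ihZ : leb.-integrable `[a, b] (EFin \o hZ) by exact: integrable_EFinB.
  have ihX : leb.-integrable `[a, b] (EFin \o hX) by exact: integrable_EFinB.
  apply: (@le_trans _ _ (\int[leb]_(t in `[a, b]) (hZ t + hX t))).
    suff ae_le : {ae leb, forall t, `[a, b]%classic t -> G t <= hZ t + hX t}.
      by apply: ae_le_Rintegral => //; exact: integrable_EFinD.
    move: key; apply: ae_mono => t kt; rewrite /= in_itv/= => atb.
    have [Pt [[zt flz] ineq]] := kt atb; case/andP: (atb) => at_ tb.
    (* X2 and Z2 are taken to be the two energies at time t, which dominate all truncations. *)
    rewrite GE//; apply: ineq => M; last exact: Q_le_energy flz.
    have [y fly] := fraclap_w (le_trans t0a at_).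
    exact: Q_le_energy fly.
  rewrite RintegralD// (RintegralB _ iZc iQ2c)// (RintegralB _ iXc iQ1c)//.
  have iQ1N := iQ1 N; have iQ2N := iQ2 N.
  rewrite !RintegralZl//.
  apply: lerD; apply: lerB => //; apply: ler_wpM2l => //.
  - by rewrite mulr_ge0// ltW.
  - by rewrite mulr_ge0// ltW.
have cE : (fun N => Q alpha (w b) N - Q alpha (w a) N) @ \oo --> E b - E a.
  by apply: cvgB; exact: Q_cvg_E.
have cbound : bound @ \oo --> 3 / 2 * nu * z - 2 * nu * z + (3 / 2 * m * x - 2 * m * x).
  apply: cvgD; apply: cvgB; [exact: cvg_cst| |exact: cvg_cst|].
  - by apply: cvgMr; exact: cz.
  - by apply: cvgMr; exact: cx.
have le1 : E b - E a <= 3 / 2 * nu * z - 2 * nu * z + (3 / 2 * m * x - 2 * m * x).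
  rewrite -(cvg_lim _ cE)// -(cvg_lim _ cbound)//.
  apply: ler_lim; [by apply/cvg_ex; eexists; exact: cE|by apply/cvg_ex; eexists; exact: cbound|].
  exact: nearW.
apply: le_trans le1 _.
(* What remains of the dissipation, - (nu/2) z, is dropped; - (m/2) x is kept. *)
by apply: dissipation_arith; rewrite mulr_ge0// ltW.
Qed.

Let E_decay a b : t0 <= a -> a <= b -> E b + m / 2 * (b - a) * E b <= E a.
Proof.
move=> t0a ab; have t0b := le_trans t0a ab.
have [x [x0 Ex dE]] := E_dissipation t0a ab.
(* Dissipation on [t, b] gives monotonicity, so the integral of E over [a, b] is at least (b - a) E
   b. *)
have mono t : a <= t -> t <= b -> E b <= E t.
  move=> at_ tb; have [y [y0 _ dE']] := E_dissipation (le_trans t0a at_) tb.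
  rewrite -subr_le0; apply: le_trans dE' _.
  by rewrite oppr_le0 mulr_ge0// divr_ge0// ltW.
have : (b - a) * E b <= x.
  rewrite -lee_fin -Ex.
  apply: (@le_trans _ _ (\int[leb]_(t in `[a, b]) (E b)%:E)%E).
    rewrite integral_cst//= lebesgue_measure_itv/= lte_fin.
    case: ifPn => [_|]; first by rewrite -EFinD -EFinM lee_fin mulrC.
    by rewrite -leNgt mule0 lee_fin => ba; rewrite mulr_le0_ge0 ?E_ge0// subr_le0.
  apply: ge0_le_integral_nonmeasurable => //.
  - by move=> t _; rewrite lee_fin E_ge0.
  - move=> t; rewrite /= in_itv/= => /andP[at_ tb].
    have [y fly] := fraclap_w (le_trans t0a at_).
    by rewrite (energyE fly) lee_fin sqr_ge0.
  - move=> t; rewrite /= in_itv/= => /andP[at_ tb].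
    have := mono _ at_ tb; rewrite {2}/E.
    have [y fly] := fraclap_w (le_trans t0a at_).
    by rewrite (energyE fly) lee_fin.
move=> Ebx; have := ler_wpM2l (ltW (divr_gt0 hm (ltr0n R 2))) Ebx.
rewrite mulrA; move: dE.
by move: (E a) (E b) (m / 2 * x) => Ea Eb y; move: (_ * Eb) => y' ? ?; lra.
Qed.

Lemma synchronization : exists M lambda : R, [/\ 0 < M, 0 < lambda &
  forall t, t0 <= t -> (Vnorm alpha (u t - v t) <= (M * expR (- lambda * (t - t0)))%:E)%E].
Proof.
have l0 : 0 < m / 2 by rewrite divr_gt0.
(* The 1 keeps M positive even when u and v agree at time t0. *)
have EC : E t0 <= E t0 + 1 by rewrite lerDl.
have C0 : 0 < E t0 + 1 by rewrite ltr_wpDl// E_ge0.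
have dec := exponential_decay l0 (ltW C0) E_ge0 EC E_decay.
set kappa := ln (1 + m / 2) in dec; set C := (E t0 + 1) * (1 + m / 2) in dec.
have k0 : 0 < kappa by rewrite ln_gt0// ltrDl.
have CC : 0 < C by rewrite mulr_gt0// addr_gt0.
exists (Num.sqrt C), (kappa / 2); split; [by rewrite sqrtr_gt0|by rewrite divr_gt0|].
move=> t tt; rewrite Vnorm_w// lee_fin.
(* The norm is the square root of E, so the rate is halved. *)
have -> : Num.sqrt C * expR (- (kappa / 2) * (t - t0)) =
    Num.sqrt (C * expR (- kappa * (t - t0))).
  rewrite [RHS]sqrtrM ?(ltW CC)//; congr (_ * _).
  rewrite -[LHS]ger0_norm ?expR_ge0// -sqrtr_sqr expr2 -expRD; congr (Num.sqrt (expR _)).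
  by field.
by apply: ler_wsqrtr; exact: dec.
Qed.

End Synchronization.

Theorem theorem4p2 (R : realType) (d : nat) (alpha nu : R)
    (hd2 : (2 <= d)%N) (hd8 : (d <= 8)%N)
    (halpha : d%:R / 4 + 1 / 2 <= alpha) (hnu : 0 < nu) :
  let theta : R := 1 - d%:R / (4 * alpha) in
  exists2 C : R, 0 < C &
  forall (mu h c0 : R) (Ih : vfield R d -> vfield R d) (f : vfield R d)
    (t0 : R) (u0 v0 : vfield R d) (u v : R -> vfield R d)
    (sigma_1 sigma_a sigma_a1 : R),
    0 < mu -> 0 < h -> 0 < c0 ->
    interpolant alpha c0 h Ih ->
    V alpha f ->
    0 <= t0 ->
    V (2 * alpha) u0 -> V (2 * alpha) v0 ->
    classical_solution_u alpha nu f u0 u ->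
    classical_solution_v alpha nu mu Ih f u t0 v0 v ->
    0 < sigma_1 -> 0 < sigma_a -> 0 < sigma_a1 ->
    (forall t, t0 <= t ->
      [/\ (Vnorm 1 (u t) <= sigma_1%:E)%E, (Vnorm 1 (v t) <= sigma_1%:E)%E,
          (Vnorm alpha (u t) <= sigma_a%:E)%E,
          (Vnorm alpha (v t) <= sigma_a%:E)%E &
          (Vnorm (alpha + 1) (u t) <= sigma_a1%:E)%E]) ->
    C * (4 * sigma_a `^ (2 / theta) + sigma_1 `^ (1 / theta)
         + 2 * sigma_1 `^ (2 / theta) + sigma_a1) <= mu ->
    mu * h ^+ 2 * c0 <= nu ->
    exists M lambda : R, [/\ 0 < M, 0 < lambda &
      forall t, t0 <= t ->
        (Vnorm alpha (u t - v t) <= (M * expR (- lambda * (t - t0)))%:E)%E].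
Proof.
move=> theta.
have C0 : 0 <= @Cdecay R d alpha nu.
  by rewrite mulr_ge0 ?divr_ge0 ?(ltW hnu)// Cyoung_ge0// divr_gt0// exprn_gt0.
(* The 1 makes the constant positive. The hypothesis gives 4 C sigma_a^(2/theta) <= mu, which
   implies the bound by mu/2 required for the nonlinear term. *)
exists (@Cdecay R d alpha nu + 1); first by rewrite ltr_wpDl.
move=> m h c0 I f t0 u0 v0 u v s1 sa sa1 m0 h0 c00 hI hf ht0 _ _ hu hv s10 sa0 sa10 bounds Cm mh.
apply: (@synchronization R d alpha nu hd2 halpha hnu m h c0 t0 sa I f u0 v0 u v) => //.
- by move=> t /bounds[].
- by move=> t /bounds[].
rewrite -/theta.
have p1 : 0 <= sa `^ (2 / theta) by exact: powR_ge0.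
have p2 : 0 <= s1 `^ (1 / theta) by exact: powR_ge0.
have p3 : 0 <= s1 `^ (2 / theta) by exact: powR_ge0.
move: C0 p1 p2 p3 Cm.
move: (Cdecay _ _) (sa `^ _) (s1 `^ _) (s1 `^ _) => C a b e C0 p1 p2 p3 Cm.
nra.
Qed.
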